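(* Let $\Omega\subset\mathbb{R}^n$ be open, $T>0$, let $H=H(t,x,p)\in C^2([0,T]\times\Omega\times\mathbb{R}^n)$ have positive definite Hessian $D_{pp}H(t,x,p)$ for all $(t,x,p)$, and let $u_0:\Omega\to\mathbb{R}$ be locally Lipschitz continuous. Let $u\in \mathrm{Lip}_{loc}([0,T]\times\Omega)$ be a viscosity solution of $$\partial_t u+H(t,x,D_xu)=0 \ \text{ in } ]0,T[\times\Omega,\qquad u(0,x)=u_0(x)\ \text{ in }\Omega.$$ Consider the Hamiltonian system $$\dot\xi(s)=D_pH(s,\xi(s),p(s)),\qquad \dot p(s)=-D_xH(s,\xi(s),p(s)).\qquad ( * )$$ Then, for any $y_0\in\Omega$, the following hold. (i) Given $p_0\in D^-_{pr}u_0(y_0)$, let $(\xi(\cdot),p(\cdot))$ be the solution of $( * )$ with initial conditions $\xi(0)=y_0$, $p(0)=p_0$. Then there exists $\tau_0>0$ such that $\xi(\cdot)$ is a classical characteristic (associated with $u$) on $[0,\tau_0]$. (ii) Conversely, let $\xi:[0,\tau_0]\to\Omega$ be a classical characteristic (associated with $u$) starting at $y_0$, i.e. $\xi(0)=y_0$. Then there exists a unique $p_0\in D^-_{pr}u_0(y_0)$ such that $\xi(\cdot)$ is the first component of the solution of $( * )$ with initial conditions $\xi(0)=y_0$, $p(0)=p_0$.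
   Context: Notation: $]a,b[$ denotes the open interval. Proximal subdifferential: given $K>0$, a vector $p_0\in\mathbb{R}^n$ is a proximal $K$-subgradient of $v:\Omega\to\mathbb{R}$ at $x_0\in\Omega$ if $v(x)\ge v(x_0)+\langle p_0,x-x_0\rangle-\frac K2|x-x_0|^2$ for all $x$ in a neighbourhood of $x_0$. The proximal subdifferential $D^-_{pr}v(x_0)$ is the set of all $p_0$ that are proximal $K$-subgradients of $v$ at $x_0$ for some $K>0$. Classical characteristic: a $C^1$ arc $\gamma:[t_0,t_1]\to\Omega$ is a classical characteristic associated with $u$ if, for all $t\in\,]t_0,t_1[$, $u$ is differentiable at $(t,\gamma(t))$ and $\dot\gamma(t)=D_pH(t,\gamma(t),D_xu(t,\gamma(t)))$. *)

(* Defs.v *)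
From HB Require Import structures.
From mathcomp Require Import all_boot all_order all_algebra.
From mathcomp Require Import all_classical all_reals.
From mathcomp Require Import topology normedtype derive.

Set Implicit Arguments.
Unset Strict Implicit.
Unset Printing Implicit Defensive.

Import Order.TTheory GRing.Theory Num.Theory.
Import numFieldNormedType.Exports.

Local Open Scope classical_set_scope.
Local Open Scope ring_scope.

(* The norm of 'rV[R]_n in the library is the sup norm, so the Euclidean
   quantities go through [dot]. *)

Definition dot (R : realType) (n : nat) (v w : 'rV[R]_n) : R :=
  \sum_(i < n) v 0 i * w 0 i.

Definition grad (R : realType) (n : nat) (f : 'rV[R]_n -> R) (x : 'rV[R]_n) :
    'rV[R]_n :=
  \row_(i < n) 'D_('e_i) f x.

Definition hessian (R : realType) (n : nat) (f : 'rV[R]_n -> R)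
    (x : 'rV[R]_n) : 'M[R]_n :=
  \matrix_(i < n, j < n) 'D_('e_j) (fun y => 'D_('e_i) f y) x.

Definition posdef (R : realType) (n : nat) (A : 'M[R]_n) : Prop :=
  forall v : 'rV[R]_n, v != 0 -> 0 < dot (v *m A) v.

(* Continuity of the differential is required direction by direction, which in
   finite dimension is continuity for the operator norm. *)
Definition C1_open (R : realType) (V W : normedModType R) (U : set V)
    (f : V -> W) : Prop :=
  (forall x, U x -> differentiable f x) /\
  (forall v x, U x -> {for x, continuous (fun y => 'd f y v)}).

Definition C2_open (R : realType) (V W : normedModType R) (U : set V)
    (f : V -> W) : Prop :=
  C1_open U f /\ forall v, C1_open U (fun y => 'd f y v).

(* On a set A that need not be open, such as [0,T] x Omega x R^n, C^k means
   being the restriction of a C^k function on an open set containing A. *)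
Definition C1_on (R : realType) (V W : normedModType R) (A : set V)
    (f : V -> W) : Prop :=
  exists (U : set V) (g : V -> W),
    [/\ open U, A `<=` U, forall x, A x -> f x = g x & C1_open U g].

Definition C2_on (R : realType) (V W : normedModType R) (A : set V)
    (f : V -> W) : Prop :=
  exists (U : set V) (g : V -> W),
    [/\ open U, A `<=` U, forall x, A x -> f x = g x & C2_open U g].

Section HamiltonJacobi.
Variables (R : realType) (n : nat).
Local Notation E := 'rV[R]_n.
Implicit Types (Omega : set E) (T : R) (H : R * E * E -> R) (u : R * E -> R).

Definition Dt (f : R * E -> R) (t : R) (x : E) : R :=
  derive1 (fun s => f (s, x)) t.

Definition Dx (f : R * E -> R) (t : R) (x : E) : E :=
  grad (fun y => f (t, y)) x.

Definition DxH H (t : R) (x p : E) : E := grad (fun y => H (t, y, p)) x.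

Definition DpH H (t : R) (x p : E) : E := grad (fun q => H (t, x, q)) p.

Definition DppH H (t : R) (x p : E) : 'M[R]_n :=
  hessian (fun q => H (t, x, q)) p.

Definition viscosity_subsolution Omega T H u : Prop :=
  forall phi : R * E -> R, C1_open (`]0, T[ `*` Omega) phi ->
  forall (t : R) (x : E), 0 < t < T -> Omega x ->
    (\forall z \near (t, x), u z - phi z <= u (t, x) - phi (t, x)) ->
    Dt phi t x + H (t, x, Dx phi t x) <= 0.

Definition viscosity_supersolution Omega T H u : Prop :=
  forall phi : R * E -> R, C1_open (`]0, T[ `*` Omega) phi ->
  forall (t : R) (x : E), 0 < t < T -> Omega x ->
    (\forall z \near (t, x), u (t, x) - phi (t, x) <= u z - phi z) ->
    0 <= Dt phi t x + H (t, x, Dx phi t x).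

Definition viscosity_solution Omega T H (u0 : E -> R) u : Prop :=
  [/\ viscosity_subsolution Omega T H u,
      viscosity_supersolution Omega T H u
    & forall x, Omega x -> u (0, x) = u0 x].

Definition proximal_subgradient (K : R) (v : E -> R) (x0 p0 : E) : Prop :=
  \forall x \near x0,
    v x0 + dot p0 (x - x0) - K / 2 * dot (x - x0) (x - x0) <= v x.

Definition proximal_subdifferential (v : E -> R) (x0 : E) : set E :=
  [set p0 | exists2 K : R, 0 < K & proximal_subgradient K v x0 p0].

Definition classical_characteristic Omega T H u (t0 t1 : R) (gamma : R -> E) :
    Prop :=
  [/\ 0 <= t0, t0 < t1 & t1 <= T] /\
  [/\ C1_on `[t0, t1] gamma,
      forall t, t0 <= t <= t1 -> Omega (gamma t)
    & forall t, t0 < t < t1 ->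
        differentiable u (t, gamma t) /\
        derive1 gamma t = DpH H t (gamma t) (Dx u t (gamma t))].

(* The equations at the endpoints of [0, tau], for the one-sided derivatives,
   follow from those inside by continuity of xi, p and of the vector field. *)
Definition hamiltonian_solution Omega T H (tau : R) (y0 p0 : E)
    (xi p : R -> E) : Prop :=
  [/\ 0 < tau <= T,
      {within `[0, tau], continuous xi} /\ {within `[0, tau], continuous p},
      forall s : R, 0 <= s <= tau -> Omega (xi s),
      forall s : R, 0 < s < tau ->
        is_derive s 1 xi (DpH H s (xi s) (p s)) /\
        is_derive s 1 p (- DxH H s (xi s) (p s))
    & xi 0 = y0 /\ p 0 = p0].

End HamiltonJacobi.

(* Main.v *)
(** Along a characteristic (xi, p) put g' = <p, xi'> - H, so that g should be
    u(t, xi t).  Since H is convex in p, testing the subsolution property with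
    |x - eta|^2 / (2 k) shows that u grows along any curve eta at most by the
    integral of the Legendre transform of H; applied to eta = xi + h this bounds
    u(t, xi t + h t) - u(s, xi s + h s) above by the increment of g + <p, h>, up
    to terms quadratic in h.

    (i) Taking for h a segment shrinking to 0 at time 0 gives a quadratic upper
    bound of u around xi.  The proximal inequality at time 0 is propagated to a
    lower bound: g + <p, x - xi> - M(t)/2 |x - xi|^2 is a strict subsolution for
    short times when M increases fast enough, and is compared with u by the
    supersolution property.  The two quadratic bounds make u differentiable along
    xi, with gradient p.

    (ii) Conversely set p = D_x u along xi.  Strong convexity recovers p
    continuously from xi' = D_p H, up to the endpoints; the upper bound with h
    constant, at points where u is differentiable, forces p' = - D_x H, and with
    h shrinking from x - y0 to 0 it makes p(0) a proximal subgradient of u0.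
    Strict convexity gives the uniqueness of p(0). *)

From HB Require Import structures.
From mathcomp Require Import all_boot all_order all_algebra.
From mathcomp Require Import all_classical all_reals.
From mathcomp Require Import topology normedtype landau derive realfun sequences.
From mathcomp Require measure lebesgue_measure lebesgue_integral ftc.
From mathcomp Require Import ring lra.
Require Import Defs.

Set Implicit Arguments.
Unset Strict Implicit.
Unset Printing Implicit Defensive.

Import Order.TTheory GRing.Theory Num.Theory.
Import numFieldNormedType.Exports.

Local Open Scope classical_set_scope.
Local Open Scope ring_scope.

(* The import is local: it would otherwise change the inferred normed-module
   structure of R in later statements. *)
Section Antiderivative.
Import measure lebesgue_measure lebesgue_integral ftc.

(** The viscosity inequalities hold only at interior times and only against functions that are C1 on
    the whole cylinder, while characteristics live on closed intervals starting at time 0. This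
    shapes the tools: curves are extended in a C1 way to a larger open interval, all test functions
    are quadratic around a moving centre, and comparison takes place in tubes where a penalty in
    time excludes contact at the final time.

    Constants are local. The Lipschitz constant of u near a point bounds the gradients of test
    functions at contact points, so H matters only on compact boxes, where its second derivatives
    are bounded and its convexity in p has a uniform modulus.

    No representation formula and no semiconcavity of u is invoked; the growth bound along curves
    takes their place. It is one-sided. In (i) the missing side is the propagated proximal
    inequality, which enters nowhere else. In (ii) differentiability at two interior times, together
    with a change of sign of the displacement, makes the bound two-sided. *)

Lemma antiderivative (R : realType) (f : R -> R) (a b : R) :
  continuous f -> a < b -> exists F : R -> R, forall x, a < x < b -> is_derive x 1 F (f x).
Proof.
move=> fc ab.
have fi : lebesgue_measure.-integrable `[a, b] (EFin \o f).
  apply: continuous_compact_integrable; first exact: segment_compact.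
  exact: continuous_subspaceT.
exists (fun x => \int[lebesgue_measure]_(t in `[a, x]) f t) => x /andP[ax xb].
have [dF F'x] := continuous_FTC1_closed xb fi ax (fc x).
by apply: DeriveDef dF _; rewrite -derive1E F'x.
Qed.

End Antiderivative.

(** * Elementary inequalities; the Euclidean product against the sup norm *)

Lemma ler_divSn (R : realFieldType) (x : R) k : 0 <= x -> x / k.+1%:R <= x.
Proof. by move=> x0; rewrite ler_pdivrMr ?ltr0Sn // ler_peMr // ler1n. Qed.

Lemma ltr_half (R : realFieldType) (x : R) : 0 < x -> x / 2 < x.
Proof. by move=> x0; rewrite ltr_pdivrMr // ltr_pMr // ltr1n. Qed.

Lemma norm_le_dist (R : realFieldType) (V : normedZmodType R) (x y : V) (k r : R) :
  `|y| + k <= r -> `|x - y| <= k -> `|x| <= r.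
Proof.
move=> yr xy; rewrite -(subrK y x) addrC.
by apply: le_trans (ler_normD _ _) (le_trans _ yr); rewrite lerD2l.
Qed.

Section Dot.
Variables (R : realType) (n : nat).
Implicit Types (a b c x y : 'rV[R]_n) (k : R).

Lemma dotC a b : dot a b = dot b a.
Proof. by apply: eq_bigr => i _; rewrite mulrC. Qed.

Lemma dotDl a b c : dot (a + b) c = dot a c + dot b c.
Proof. by rewrite /dot -big_split; apply: eq_bigr => i _; rewrite mxE mulrDl. Qed.

Lemma dotZl k a b : dot (k *: a) b = k * dot a b.
Proof. by rewrite /dot mulr_sumr; apply: eq_bigr => i _; rewrite mxE mulrA. Qed.

Lemma dotNl a b : dot (- a) b = - dot a b.
Proof. by rewrite -scaleN1r dotZl mulN1r. Qed.

Lemma dotDr a b c : dot c (a + b) = dot c a + dot c b.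
Proof. by rewrite dotC dotDl !(dotC c). Qed.

Lemma dotZr k a b : dot b (k *: a) = k * dot b a.
Proof. by rewrite dotC dotZl (dotC b). Qed.

Lemma dotNr a b : dot b (- a) = - dot b a.
Proof. by rewrite dotC dotNl (dotC b). Qed.

Definition dotE := (dotDl, dotDr, dotNl, dotNr, dotZl, dotZr).

Lemma dot0l a : dot 0 a = 0.
Proof. by rewrite -(scale0r a) dotZl mul0r. Qed.

Lemma dot0r a : dot a 0 = 0.
Proof. by rewrite dotC dot0l. Qed.

Lemma dot_ge0 a : 0 <= dot a a.
Proof. by apply: sumr_ge0 => i _; rewrite -expr2 sqr_ge0. Qed.

(** Complete the square in [a - b / (2 k)]. With the convexity modulus for [k], it lets strong
    convexity absorb the cross term between a momentum gap and a velocity perturbation. *)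
Lemma dot_young k a b : 0 < k -> dot a b <= k * dot a a + dot b b / (4 * k).
Proof.
move=> k0; rewrite -subr_ge0.
have -> : k * dot a a + dot b b / (4 * k) - dot a b =
          k * dot (a - (2 * k)^-1 *: b) (a - (2 * k)^-1 *: b).
  by rewrite !dotE (dotC b a); field; rewrite gt_eqF.
by rewrite mulr_ge0 ?dot_ge0 // ltW.
Qed.

Lemma coord_le_norm x i : `|x 0 i| <= `|x|.
Proof.
rewrite [leRHS]/Num.Def.normr/= mx_normrE.
exact: (le_trans _ (le_bigmax _ (fun k : 'I_1 * 'I_n => `|x k.1 k.2|) (0, i))).
Qed.

Lemma norm_le_coord x k : 0 <= k -> (forall i, `|x 0 i| <= k) -> `|x| <= k.
Proof.
move=> k0 xk; rewrite [leLHS]/Num.Def.normr/= mx_normrE.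
by apply: bigmax_le => // -[i j] _; rewrite ord1.
Qed.

Lemma norm_lt_coord x k : 0 < k -> (forall i, `|x 0 i| < k) -> `|x| < k.
Proof.
move=> k0 xk; rewrite [ltLHS]/Num.Def.normr/= mx_normrE.
by apply: bigmax_lt => // -[i j] _; rewrite ord1.
Qed.

Lemma sqr_coord_le_dot x i : x 0 i ^+ 2 <= dot x x.
Proof.
by rewrite /dot (bigD1 i) //= -expr2 lerDl sumr_ge0 // => j _; rewrite -expr2 sqr_ge0.
Qed.

Lemma sqr_norm_le_dot x : `|x| ^+ 2 <= dot x x.
Proof.
rewrite -[leRHS]sqr_sqrtr ?dot_ge0 // lerXn2r ?nnegrE ?sqrtr_ge0 //.
apply: norm_le_coord => [|i]; first exact: sqrtr_ge0.
by rewrite -sqrtr_sqr ler_sqrt ?dot_ge0 // sqr_coord_le_dot.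
Qed.

Lemma normr_dot_le a b : `|dot a b| <= n%:R * (`|a| * `|b|).
Proof.
apply: le_trans (ler_norm_sum _ _ _) _.
apply: (@le_trans _ _ (\sum_(i < n) `|a| * `|b|)); last first.
  by rewrite sumr_const card_ord mulr_natl.
by apply: ler_sum => i _; rewrite normrM ler_pM // coord_le_norm.
Qed.

Lemma dot_le_norm a b : dot a b <= n%:R * (`|a| * `|b|).
Proof. exact: le_trans (ler_norm _) (normr_dot_le _ _). Qed.

Lemma dot_delta a i : dot a 'e_i = a 0 i.
Proof.
rewrite /dot (bigD1 i) //= big1 => [|j ji]; rewrite mxE eqxx ?eqxx /= ?mulr1 ?addr0 //.
by rewrite (negbTE ji) mulr0.
Qed.

Lemma row_delta_sum a : a = \sum_(i < n) a 0 i *: 'e_i.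
Proof. by rewrite {1}(matrix_sum_delta a) big_ord1. Qed.

End Dot.

(** * Curves and test functions *)

Section Curves.
Variables (R : realType) (n : nat).
Local Notation E := 'rV[R]_n.

Lemma is_derive_coord (V : normedModType R) (f : V -> E) (x v : V) (df : E) i :
  is_derive x v f df -> is_derive x v (fun y => f y 0 i) (df 0 i).
Proof.
move=> [fx <-]; have /derivable_mxP fxi := fx.
by split; [exact: fxi | rewrite derive_mx // mxE].
Qed.

Lemma is_derive_rV (V : normedModType R) (f : V -> E) (x v : V) (df : E) :
  (forall i, is_derive x v (fun y => f y 0 i) (df 0 i)) -> is_derive x v f df.
Proof.
move=> H; have fx : derivable f x v.
  by apply/derivable_mxP => i j; rewrite ord1; have [] := H j.
split=> //; rewrite derive_mx //; apply/rowP => j; rewrite mxE.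
by have [_ ->] := H j.
Qed.

Lemma is_derive_bigsum (V : normedModType R) (h : 'I_n -> V -> R) (x v : V) dh :
  (forall i, is_derive x v (h i) (dh i)) ->
  is_derive x v (fun y => \sum_(i < n) h i y) (\sum_(i < n) dh i).
Proof.
move=> H; rewrite (_ : (fun y => _) = \sum_(i < n) h i); first exact: is_derive_sum.
by apply/funext => y; rewrite fct_sumE.
Qed.

Lemma is_derive_dot (V : normedModType R) (f g : V -> E) (x v : V) (df dg : E) :
  is_derive x v f df -> is_derive x v g dg ->
  is_derive x v (fun y => dot (f y) (g y)) (dot df (g x) + dot (f x) dg).
Proof.
move=> Hf Hg; rewrite -big_split /=; apply: is_derive_bigsum => i.
have fi := is_derive_coord i Hf; have gi := is_derive_coord i Hg.
by apply: is_derive_eq; rewrite /GRing.scale /= addrC mulrC (mulrC (df 0 i)).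
Qed.

Lemma derive1_is_derive (V : normedModType R) (f : R -> V) (t : R) (df : V) :
  is_derive t 1 f df -> derive1 f t = df.
Proof. by move=> [_ <-]; rewrite derive1E. Qed.

Lemma is_derive_continuous (V : normedModType R) (f : R -> V) (t : R) (df : V) :
  is_derive t 1 f df -> {for t, continuous f}.
Proof. by move=> [/derivable1_diffP ft _]; exact: differentiable_continuous. Qed.

(** The derivative is a parameter rather than [derive1 f], so that the time derivative of a test
    function assembled from several curves is an explicit expression in the chosen derivatives. *)
Definition c1curve (V : normedModType R) (I : set R) (f f' : R -> V) :=
  forall t, I t -> is_derive t 1 f (f' t) /\ {for t, continuous f'}.

Lemma c1curve_coord (I : set R) (f f' : R -> E) i :
  c1curve I f f' -> c1curve I (fun t => f t 0 i) (fun t => f' t 0 i).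
Proof.
move=> H t It; have [fd fc] := H t It; split; first exact: is_derive_coord.
by apply: (@continuous_comp _ _ _ f' (fun v : E => v 0 i)) => //; exact: coord_continuous.
Qed.

End Curves.

Section C1Open.
Variables (R : realType) (V : normedModType R) (U : set V).
Hypothesis U_open : open U.
Implicit Types f g : V -> R.

Lemma C1_open_cst (c : R) : C1_open U (fun _ : V => c).
Proof.
split=> [x _|v x _]; first exact: differentiable_cst.
rewrite (_ : (fun y => _) = fun _ => 0); first exact: cst_continuous.
by apply/funext => y; rewrite diff_cst.
Qed.

Lemma C1_openD f g : C1_open U f -> C1_open U g -> C1_open U (fun x => f x + g x).
Proof.
move=> [df cf] [dg cg]; split=> [x Ux|v x Ux]; first exact: (differentiableD (df x Ux) (dg x Ux)).
have E y : U y -> 'd (fun x => f x + g x) y v = 'd f y v + 'd g y v.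
  by move=> Uy; rewrite (diffD (df y Uy) (dg y Uy)).
have : (fun y => 'd f y v + 'd g y v) @ x --> 'd f x v + 'd g x v.
  by apply: cvgD; [exact: cf | exact: cg].
rewrite /prop_for /continuous_at -E //.
apply: cvg_trans; apply: near_eq_cvg; near=> y.
by rewrite E //; near: y; exact: open_nbhs_nbhs.
Unshelve. all: by end_near. Qed.

Lemma C1_openM f g : C1_open U f -> C1_open U g -> C1_open U (fun x => f x * g x).
Proof.
move=> [df cf] [dg cg]; split=> [x Ux|v x Ux]; first exact: (differentiableM (df x Ux) (dg x Ux)).
have E y : U y -> 'd (fun x => f x * g x) y v = f y * 'd g y v + g y * 'd f y v.
  by move=> Uy; rewrite (diffM (df y Uy) (dg y Uy)).
have : (fun y => f y * 'd g y v + g y * 'd f y v) @ x --> f x * 'd g x v + g x * 'd f x v.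
  have fc := differentiable_continuous (df x Ux); have gc := differentiable_continuous (dg x Ux).
  by apply: cvgD; apply: cvgM => //; [exact: cg | exact: cf].
rewrite /prop_for /continuous_at -E //.
apply: cvg_trans; apply: near_eq_cvg; near=> y.
by rewrite E //; near: y; exact: open_nbhs_nbhs.
Unshelve. all: by end_near. Qed.

Lemma C1_open_sum m (f : 'I_m -> V -> R) :
  (forall i, C1_open U (f i)) -> C1_open U (fun x => \sum_(i < m) f i x).
Proof.
move=> H; elim: m f H => [|m IH] f H.
  by under [fun x => _]eq_fun do rewrite big_ord0; exact: C1_open_cst.
under [fun x => _]eq_fun do rewrite big_ord_recl.
by apply: C1_openD => //; apply: IH => i; exact: H.
Qed.

Lemma C1_open_linear (f : {linear V -> R}) : continuous f -> C1_open U f.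
Proof.
move=> fc; split=> [x _|v x _]; first exact: linear_differentiable.
rewrite (_ : (fun y => _) = fun _ => f v); first exact: cst_continuous.
by apply/funext => y; rewrite diff_lin.
Qed.

End C1Open.

Lemma linear_is_diff (R : realType) (V W : normedModType R) (f : V -> W) x :
  linear f -> continuous f -> is_diff x f f.
Proof.
move=> fl fc; pose fL : {linear V -> W} := HB.pack f (GRing.isLinear.Build R V W _ f fl).
have -> : f = fL by [].
by split; [exact: linear_differentiable | rewrite diff_lin].
Qed.

Lemma near_continuous_at (T W : topologicalType) (f g : T -> W) (x : T) :
  (\forall y \near x, f y = g y) -> {for x, continuous g} -> {for x, continuous f}.
Proof.
move=> fg gc; rewrite /prop_for /continuous_at (nbhs_singleton fg).
by apply: cvg_trans gc; apply: near_eq_cvg; apply: filterS fg => y ->.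
Qed.

Lemma open_setX (S T : topologicalType) (A : set S) (B : set T) :
  open A -> open B -> open (A `*` B).
Proof.
rewrite !openE => oA oB [x y] [Ax By]; exists (A, B) => //.
by split; [exact: oA | exact: oB].
Qed.

Section Paraboloid.
Variables (R : realType) (n : nat).
Local Notation E := 'rV[R]_n.

Lemma C1_open_fst (I : set R) (W : set E) (f f' : R -> R) :
  open I -> open W -> c1curve I f f' ->
  C1_open (I `*` W) (fun z : R * E => f z.1).
Proof.
move=> oI oW H.
have D (z : R * E) : I z.1 -> is_diff z (fun z : R * E => f z.1) (fun w => w.1 * f' z.1).
  move=> Iz; have [fd _] := H _ Iz.
  have fz : differentiable f z.1 by apply/derivable1_diffP.
  have d1 : is_diff z (fst : R * E -> R) fst by apply: linear_is_diff => // y; exact: cvg_fst.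
  have d2 : is_diff (z.1) f (fun w => w *: f' z.1).
    split=> //; have [_ <-] := fd.
    by rewrite diff1E // derive1E.
  exact: (is_diff_comp d1 d2).
split=> [z [Iz _]|v z [Iz Wz]]; first by have [] := D z Iz.
apply: (@near_continuous_at _ _ _ (fun y : R * E => v.1 * f' y.1)); last first.
  apply: cvgM; first exact: cvg_cst.
  by apply: (@continuous_comp _ _ _ fst f'); [exact: cvg_fst | have [] := H _ Iz].
near=> y; have Iy : I y.1.
  near: y; apply: (@cvg_fst _ _ (nbhs z.1) (nbhs z.2)).
  exact: open_nbhs_nbhs.
by have [_ /(congr1 (fun h => h v))] := D y Iy.
Unshelve. all: by end_near. Qed.

Lemma C1_open_snd_coord (U : set (R * E)) i : open U -> C1_open U (fun z : R * E => z.2 0 i).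
Proof.
move=> oU; pose f (z : R * E) : R := z.2 0 i.
have fl : linear f by move=> k x y; rewrite /f /= !mxE.
pose fL : {linear (R * E)%type -> R} := HB.pack f (GRing.isLinear.Build R (R * E)%type R _ f fl).
apply: (@C1_open_linear _ _ _ fL) => z.
apply: (@continuous_comp _ _ _ snd (fun v : E => v 0 i)); first exact: cvg_snd.
exact: coord_continuous.
Qed.

(** [A], [P] and [N] are value, gradient and curvature at the moving centre [X]. Every viscosity
    test below is of this form, up to a penalty in time: [P = 0] with large curvature for growth
    along a curve, [P] the momentum with negative curvature for the lower bound, constant [P] and
    [X] at a point of differentiability. *)
Definition paraboloid (A : R -> R) (P X : R -> E) (N : R -> R) (z : R * E) : R :=
  A z.1 + dot (P z.1) (z.2 - X z.1) + N z.1 / 2 * dot (z.2 - X z.1) (z.2 - X z.1).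

Section Curve.
Variables (I : set R) (W : set E).
Variables (A A' N N' : R -> R) (P P' X X' : R -> E).
Hypotheses (oI : open I) (oW : open W).
Hypotheses (HA : c1curve I A A') (HP : c1curve I P P') (HX : c1curve I X X') (HN : c1curve I N N').

Lemma paraboloid_C1 : C1_open (I `*` W) (paraboloid A P X N).
Proof.
have oU : open (I `*` W) by exact: open_setX.
have Hy i : C1_open (I `*` W) (fun z : R * E => (z.2 - X z.1) 0 i).
  rewrite (_ : (fun z : R * E => _) = fun z => z.2 0 i + (-1) * X z.1 0 i); last first.
    by apply/funext => z; rewrite !mxE mulN1r.
  apply: C1_openD => //; first exact: C1_open_snd_coord.
  apply: C1_openM => //; first exact: C1_open_cst.
  by apply: (C1_open_fst oI oW (f := fun t => X t 0 i)); apply: c1curve_coord HX.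
have HPi i : C1_open (I `*` W) (fun z : R * E => P z.1 0 i).
  by apply: (C1_open_fst oI oW (f := fun t => P t 0 i)); apply: c1curve_coord HP.
have HAz := C1_open_fst oI oW HA; have HNz := C1_open_fst oI oW HN.
have HPy := C1_open_sum oU (fun i => C1_openM oU (HPi i) (Hy i)).
have Hyy := C1_open_sum oU (fun i => C1_openM oU (Hy i) (Hy i)).
have HNyy := C1_openM oU (C1_openM oU HNz (C1_open_cst (I `*` W) 2^-1)) Hyy.
exact: (C1_openD oU (C1_openD oU HAz HPy) HNyy).
Qed.

Lemma paraboloid_Dt t x : I t ->
  Dt (paraboloid A P X N) t x =
  A' t + dot (P' t) (x - X t) - dot (P t) (X' t)
  + N' t / 2 * dot (x - X t) (x - X t) - N t * dot (x - X t) (X' t).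
Proof.
move=> It; apply: derive1_is_derive; rewrite /paraboloid /=.
have [dA _] := HA It; have [dP _] := HP It; have [dX _] := HX It; have [dN _] := HN It.
have dy : is_derive t 1 (fun s => x - X s) (- X' t).
  by apply: is_derive_eq; rewrite add0r.
have dPy := is_derive_dot dP dy; have dyy := is_derive_dot dy dy.
have dN2 : is_derive t 1 (fun s => N s / 2) (N' t / 2).
  by apply: is_derive_eq; rewrite scaler0 add0r /GRing.scale /= mulrC.
apply: is_derive_eq; rewrite /GRing.scale /=; move: (x - X t) => y.
by rewrite !dotE (dotC (X' t) y); field.
Qed.

End Curve.

Lemma paraboloid_derive A P X N t (x v : E) :
  is_derive x v (fun y => paraboloid A P X N (t, y)) (dot (P t + N t *: (x - X t)) v).
Proof.
rewrite /paraboloid /=.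
have dy : is_derive x v (fun y : E => y - X t) v.
  by apply: is_derive_eq; rewrite subr0.
have dP : is_derive x v (fun _ : E => P t) 0 by exact: is_derive_cst.
have dPy := is_derive_dot dP dy; have dyy := is_derive_dot dy dy.
apply: is_derive_eq; rewrite /GRing.scale /=; move: (x - X t) => y.
by rewrite !dotE !dot0l (dotC v y); field.
Qed.

Lemma grad_is_derive (f : E -> R) (x w : E) :
  (forall v, is_derive x v f (dot w v)) -> grad f x = w.
Proof. by move=> H; apply/rowP => i; rewrite mxE; have [_ ->] := H 'e_i; rewrite dot_delta. Qed.

Lemma paraboloid_Dx A P X N t x :
  Dx (paraboloid A P X N) t x = P t + N t *: (x - X t).
Proof. by apply: grad_is_derive => v; exact: paraboloid_derive. Qed.

End Paraboloid.

(** * Extension of curves beyond a closed interval *)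

Section Clamp.
Variable R : realType.

Definition clamp (a b t : R) : R := Num.max a (Num.min b t).

Lemma clamp_itv a b t : a <= b -> a <= clamp a b t <= b.
Proof. by move=> ab; rewrite /clamp le_max lexx ge_max ab ge_min lexx. Qed.

Lemma clamp_id a b t : a <= t <= b -> clamp a b t = t.
Proof. by move=> /andP[at_ tb]; rewrite /clamp (min_idPr tb) (max_idPr at_). Qed.

Lemma clamp_lipschitz a b s t : `|clamp a b s - clamp a b t| <= `|s - t|.
Proof.
wlog st : s t / s <= t.
  by move=> H; case: (leP s t) => [/H //|/ltW/H]; rewrite distrC (distrC t).
have mono : clamp a b s <= clamp a b t.
  by rewrite /clamp ge_max !le_max lexx /= le_min !ge_min lexx st !orbT.
rewrite !ler0_norm ?subr_le0 //; move: mono st; rewrite /clamp !maxEle !minEle.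
case: (leP b s) => ?; case: (leP b t) => ?;
  repeat match goal with |- context [if ?x <= ?y then _ else _] => case: (leP x y) => ? end; lra.
Qed.

Lemma clamp_continuous a b : continuous (clamp a b).
Proof.
move=> t; apply/cvgrPdist_lt => e e0; near=> s.
apply: le_lt_trans (clamp_lipschitz _ _ _ _) _.
by near: s; exact: cvgr_dist_lt.
Unshelve. all: by end_near. Qed.

Lemma continuous_clamp_comp (V : topologicalType) (g : R -> V) a b : a <= b ->
  {within `[a, b], continuous g} -> continuous (g \o clamp a b).
Proof.
move=> ab /subspace_continuousP gc t; have ct := clamp_itv t ab.
have gct : g x @[x --> within `[a, b] (nbhs (clamp a b t))] --> g (clamp a b t).
  by apply: gc; rewrite /= in_itv.
move=> Q /= /gct HQ.
have : \forall s \near t, `[a, b]%classic (clamp a b s) -> Q (g (clamp a b s)).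
  have /(_ [set x | `[a, b]%classic x -> Q (g x)]) := @clamp_continuous a b t.
  by apply; exact: HQ.
by apply: filterS => s; apply; rewrite /= in_itv /= clamp_itv.
Qed.

Lemma continuous_within_coord n (g : R -> 'rV[R]_n) (A : set R) i :
  {within A, continuous g} -> {within A, continuous (fun t => g t 0 i)}.
Proof.
move=> /subspace_continuousP gc; apply/subspace_continuousP => x Ax.
apply: (@cvg_comp _ _ _ g (fun v : 'rV[R]_n => v 0 i) _ (nbhs (g x))); first exact: gc.
exact: coord_continuous.
Qed.

End Clamp.

(** Integrate [g \o clamp a b], which is continuous on the whole line; by the mean value theorem the
    antiderivative differs from [f] by a constant on [[a, b]]. The extension is affine on either
    side. It lets curves known on a closed interval enter test functions that must be C1 on an open
    cylinder. *)
Lemma c1_extend (R : realType) (lo hi a b : R) (f g : R -> R) :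
  lo < a -> a < b -> b < hi ->
  {within `[a, b], continuous f} -> {within `[a, b], continuous g} ->
  (forall t, a < t < b -> is_derive t 1 f (g t)) ->
  exists F F' : R -> R, c1curve `]lo, hi[ F F' /\
    forall t, a <= t <= b -> F t = f t /\ F' t = g t.
Proof.
move=> loa ab bhi fc gc fd; have gcc := continuous_clamp_comp (ltW ab) gc.
have lohi : lo < hi by lra.
have [F FD] := antiderivative gcc lohi.
have Fab t : a <= t <= b -> F t - f t = F a - f a.
  move=> /andP[]; rewrite le_eqVlt => /predU1P[<- //|at_ tb].
  have D x : x \in `]a, t[ -> is_derive x 1 (fun s => F s - f s) 0.
    rewrite in_itv /= => /andP[ax xt].
    have Fx : is_derive x 1 F (g x).
      by have := FD x; rewrite /= clamp_id; [apply; lra | lra].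
    have fx : is_derive x 1 f (g x) by apply: fd; lra.
    by apply: is_derive_eq; rewrite subrr.
  have C : {within `[a, t], continuous (fun s => F s - f s)}.
    have Fc : {within `[a, t], continuous F}.
      apply: continuous_in_subspaceT => x; rewrite inE /= in_itv /= => xat.
      by apply: (is_derive_continuous (df := (g \o clamp a b) x)); apply: FD; lra.
    have fc' : {within `[a, t], continuous f}.
      by apply: continuous_subspaceW fc; apply: subset_itvl; rewrite bnd_simp.
    by move=> x; apply: cvgB; [exact: Fc | exact: fc'].
  by have [c _] := MVT at_ D C; rewrite mul0r => /eqP; rewrite subr_eq0 => /eqP.
exists (fun t => F t - (F a - f a)), (g \o clamp a b); split=> [t|t tab]; last first.
  by rewrite /= clamp_id //; split=> //; have := Fab t tab; lra.
rewrite /= in_itv /= => It; split; last exact: gcc.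
have Ft : is_derive t 1 F (g (clamp a b t)) by exact: FD.
by apply: is_derive_eq; rewrite subr0.
Qed.

Lemma c1_extend_rV (R : realType) (lo hi a b : R) n (f g : R -> 'rV[R]_n) :
  lo < a -> a < b -> b < hi ->
  {within `[a, b], continuous f} -> {within `[a, b], continuous g} ->
  (forall t, a < t < b -> is_derive t 1 f (g t)) ->
  exists F F' : R -> 'rV[R]_n, c1curve `]lo, hi[ F F' /\
    forall t, a <= t <= b -> F t = f t /\ F' t = g t.
Proof.
move=> loa ab bhi fc gc fd.
have H i := c1_extend loa ab bhi (continuous_within_coord (i := i) fc)
  (continuous_within_coord (i := i) gc) (fun t tab => is_derive_coord i (fd t tab)).
have /choice[F HF] : forall i : 'I_n, exists FF : (R -> R) * (R -> R), c1curve `]lo, hi[ FF.1 FF.2 /\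
    forall t, a <= t <= b -> FF.1 t = f t 0 i /\ FF.2 t = g t 0 i.
  by move=> i; have [F [F' HF]] := H i; exists (F, F').
exists (fun t => \row_i (F i).1 t), (fun t => \row_i (F i).2 t); split; last first.
  by move=> t tab; split; apply/rowP => i; rewrite mxE; have [_ /(_ t tab)[]] := HF i.
move=> t It; split.
  apply: is_derive_rV => i; rewrite mxE; have [/(_ t It)[D _] _] := HF i.
  by under [fun y => _]eq_fun do rewrite mxE.
apply/cvgrPdist_lt => e e0; near=> s.
apply: norm_lt_coord => // i; rewrite !mxE.
move: i; near: s; apply: filter_forall => i.
by have [/(_ t It)[_ C] _] := HF i; move/cvgrPdist_lt : C; apply.
Unshelve. all: by end_near. Qed.

(** * Local estimates on the Hamiltonian *)

Lemma is_derive_chain (R : realType) (V W : normedModType R) (c : R -> V) (F : V -> W) (t : R) (v : V) :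
  is_derive t 1 c v -> differentiable F (c t) ->
  is_derive t 1 (fun s => F (c s)) ('d F (c t) v).
Proof.
move=> [dc cv] dF; have dc' : differentiable c t by apply/derivable1_diffP.
have dFc : differentiable (F \o c) t by exact: differentiable_comp.
apply: DeriveDef; first by apply/derivable1_diffP.
by rewrite deriveE // diff_comp // /= diff1E // scale1r derive1E cv.
Qed.

(** A one-sided bound on the second derivative is enough for a one-sided expansion; applied to [- f]
    it gives the opposite one. *)
Lemma taylor2_le (R : realType) (f f1 f2 : R -> R) (k : R) :
  (forall s : R, 0 <= s <= 1 -> is_derive s 1 f (f1 s)) ->
  (forall s : R, 0 <= s <= 1 -> is_derive s 1 f1 (f2 s)) ->
  (forall s : R, 0 <= s <= 1 -> f2 s <= k) ->
  f 1 <= f 0 + f1 0 + k / 2.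
Proof.
move=> d1 d2 fk.
have H1 (s : R) : 0 <= s <= 1 -> f1 s - f1 0 <= k * s.
  move=> /andP[s0 s1].
  have D (x : R) : x \in `]0, s[ -> is_derive x 1 f1 (f2 x).
    by rewrite in_itv /= => /andP[x0 xs]; apply: d2; lra.
  have C : {within `[0, s], continuous f1}.
    apply: continuous_in_subspaceT => x; rewrite inE /= in_itv /= => xs.
    by apply: (is_derive_continuous (df := f2 x)); apply: d2; lra.
  have [c] := MVT_segment s0 D C.
  rewrite in_itv /= subr0 => cs ->; apply: ler_wpM2r => //; apply: fk; lra.
pose h s := f s - f1 0 * s - k / 2 * (s * s).
have D (x : R) : x \in `]0, 1[ -> is_derive x 1 h (f1 x - f1 0 - k * x).
  rewrite in_itv /= => /andP[x0 x1].
  have fx : is_derive x 1 f (f1 x) by apply: d1; lra.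
  rewrite /h; apply: is_derive_eq; rewrite /GRing.scale /=.
  by field.
have C : {within `[0, 1], continuous h}.
  apply: continuous_in_subspaceT => x; rewrite inE /= in_itv /= => xs.
  have fx : is_derive x 1 f (f1 x) by apply: d1; lra.
  apply: (@is_derive_continuous R _ h x (f1 x - f1 0 - k * x)).
  rewrite /h; apply: is_derive_eq; rewrite /GRing.scale /=.
  by field.
have [c] := MVT ltr01 D C.
rewrite in_itv /= subr0 mulr1 => /andP[c0 c1] E.
have : f1 c - f1 0 <= k * c by apply: H1; lra.
by move: E; rewrite /h !mulr0 !mulr1; lra.
Qed.

Lemma compact_bounded_fun (R : realType) (V : topologicalType) (K : set V) (f : V -> R) :
  compact K -> (forall z, K z -> {for z, continuous f}) ->
  exists2 C : R, 0 < C & forall z, K z -> `|f z| <= C.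
Proof.
move=> cK fc; have [->|/set0P K0] := eqVneq K set0; first by exists 1.
have fcK : {within K, continuous (fun z => `|f z|)}.
  apply: continuous_in_subspaceT => z; rewrite inE => /fc fz.
  by apply: (@continuous_comp _ _ _ f (fun r : R => `|r|)) => //; exact: norm_continuous.
have [c _ Hc] := compact_EVT_max K0 cK fcK.
exists (`|f c| + 1) => [|z Kz]; first by rewrite ltr_wpDl.
by apply: le_trans (Hc z _) _; rewrite ?inE // lerDl.
Qed.

Lemma normB_continuous (R : realType) (V : normedModType R) (x0 : V) :
  continuous (fun x : V => `|x - x0|).
Proof. by move=> x; apply: cvg_norm; apply: cvgB; [exact: cvg_id | exact: cvg_cst]. Qed.

Lemma cube_compact (R : realType) n (x0 : 'rV[R]_n) (r : R) :
  compact [set x : 'rV[R]_n | `|x - x0| <= r].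
Proof.
apply: bounded_closed_compact.
  exists (`|x0| + r); split=> [|M HM]; first exact: num_real.
  move=> x /= xr; apply: le_trans (ltW HM).
  by rewrite -(subrK x0 x) addrC (le_trans (ler_normD _ _)) // lerD2l.
have -> : [set x : 'rV[R]_n | `|x - x0| <= r] = (fun x => `|x - x0|) @^-1` [set y : R | y <= r] by [].
apply: closed_comp; last exact: closed_le.
by move=> x _; exact: normB_continuous.
Qed.

(** * Compact boxes of times, positions and momenta *)

Section Box.
Variables (R : realType) (n : nat).
Local Notation E := 'rV[R]_n.
Local Notation V := (R * E * E)%type.

Definition box (T : R) (x0 : E) (rho r : R) : set V :=
  [set z | [/\ 0 <= z.1.1 <= T, `|z.1.2 - x0| <= rho & `|z.2| <= r]].

Lemma box_compact T x0 rho r : compact (box T x0 rho r).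
Proof.
have -> : box T x0 rho r = `[0, T]%classic `*` [set x : E | `|x - x0| <= rho] `*` [set p : E | `|p
  - 0| <= r].
  apply/seteqP; split=> -[[t x] p]; rewrite /box /= in_itv /= subr0.
    by move=> [? ? ?]; split.
  by move=> [[? ?] ?]; split.
by apply: compact_setX; [apply: compact_setX;
  [exact: segment_compact | exact: cube_compact] | exact: cube_compact].
Qed.

Lemma segment_norm (W : normedModType R) (x y x0 : W) (r s : R) : 0 <= s <= 1 ->
  `|x - x0| <= r -> `|y - x0| <= r -> `|x + s *: (y - x) - x0| <= r.
Proof.
move=> /andP[s0 s1] xr yr.
have -> : x + s *: (y - x) - x0 = (1 - s) *: (x - x0) + s *: (y - x0).
  have -> : y - x = (y - x0) - (x - x0) by rewrite opprB addrA subrK.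
  rewrite scalerBr scalerBl scale1r addrAC -!addrA; congr (_ + (_ + _)).
  exact: addrC.
apply: le_trans (ler_normD _ _) _; rewrite !normrZ (ger0_norm s0) ger0_norm ?subr_ge0 //.
apply: (@le_trans _ _ ((1 - s) * r + s * r)); last by rewrite -mulrDl subrK mul1r.
by rewrite lerD // ler_wpM2l // subr_ge0.
Qed.

Lemma box_segment T x0 rho r (z z' : V) s : 0 <= s <= 1 ->
  box T x0 rho r z -> box T x0 rho r z' -> box T x0 rho r (z + s *: (z' - z)).
Proof.
move: z z' => [[t x] p] [[t' x'] p'] s01 [/= tT xr pr] [/= tT' xr' pr'].
split=> /=; last 2 first.
- exact: segment_norm.
- by rewrite -[_ + _]subr0; apply: segment_norm; rewrite ?subr0.
rewrite /GRing.scale /=.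
have -> : t + s * (t' - t) = (1 - s) * t + s * t' by ring.
move: s01 tT tT' => /andP[s0 s1] /andP[t0 tT] /andP[t0' tT'].
apply/andP; split; first by rewrite addr_ge0 // mulr_ge0 // subr_ge0.
apply: (@le_trans _ _ ((1 - s) * T + s * T)); last by rewrite -mulrDl subrK mul1r.
by rewrite lerD // ler_wpM2l // subr_ge0.
Qed.

Lemma triple_expand (w : V) :
  w = w.1.1 *: ((1, 0, 0) : V) + \sum_(i < n) w.1.2 0 i *: ((0, 'e_i, 0) : V)
      + \sum_(i < n) w.2 0 i *: ((0, 0, 'e_i) : V).
Proof.
have S1 (y : E) : \sum_(i < n) y 0 i *: ((0, 'e_i, 0) : V) = (0, y, 0).
  rewrite {2}(row_delta_sum y).
  rewrite (big_morph (fun y : E => ((0, y, 0) : V)) (id1 := 0) (op1 := +%R)) //; last first.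
    by move=> a b; congr (_, _, _); rewrite ?addr0.
  by apply: eq_bigr => i _; congr (_, _, _); rewrite ?scaler0.
have S2 (y : E) : \sum_(i < n) y 0 i *: ((0, 0, 'e_i) : V) = (0, 0, y).
  rewrite {2}(row_delta_sum y).
  rewrite (big_morph (fun y : E => ((0, 0, y) : V)) (id1 := 0) (op1 := +%R)) //; last first.
    by move=> a b; congr (_, _, _); rewrite ?addr0.
  by apply: eq_bigr => i _; congr (_, _, _); rewrite ?scaler0.
rewrite S1 S2; case: w => [[t x] p] /=.
by congr (_, _, _); rewrite /= ?scaler0 ?addr0 ?add0r // /GRing.scale /= ?mulr1.
Qed.

End Box.

Lemma is_derive_scalel (R : realType) (V : normedModType R) (w : V) (s : R) :
  is_derive s 1 (fun s : R => s *: w) w.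
Proof.
have [d E] : is_diff s (fun s : R => s *: w) (fun s : R => s *: w).
  apply: (@linear_is_diff R R^o V) => [k x y|]; last exact: scalel_continuous.
  by rewrite scalerDl scalerA.
apply: DeriveDef; first exact: diff_derivable.
by rewrite deriveE // E scale1r.
Qed.

Section BoxLipschitz.
Variables (R : realType) (n : nat).
Local Notation E := 'rV[R]_n.
Local Notation V := (R * E * E)%type.
Variables (T : R) (x0 : E) (rho r : R) (U : set V).
Hypotheses (boxU : box T x0 rho r `<=` U).

(** Continuity of the differential is available direction by direction only. Each basis direction is
    therefore bounded separately on the compact box, and the bounds are added along the expansion of
    [w]. *)
Lemma C1_box_diff_bound (F : V -> R) : C1_open U F ->
  exists2 C : R, 0 < C & forall z, box T x0 rho r z -> forall w, `|'d F z w| <= C * `|w|.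
Proof.
move=> [dF cF].
have B (w : V) : exists2 C : R, 0 < C & forall z, box T x0 rho r z -> `|'d F z w| <= C.
  by apply: compact_bounded_fun; [exact: box_compact | move=> z /boxU; exact: cF].
have [C0 C00 H0] := B (1, 0, 0).
have /choice[Cx Hx] : forall i : 'I_n, exists C : R, 0 < C /\
    forall z, box T x0 rho r z -> `|'d F z (0, 'e_i, 0)| <= C.
  by move=> i; have [C ? ?] := B (0, 'e_i, 0); exists C.
have /choice[Cp Hp] : forall i : 'I_n, exists C : R, 0 < C /\
    forall z, box T x0 rho r z -> `|'d F z (0, 0, 'e_i)| <= C.
  by move=> i; have [C ? ?] := B (0, 0, 'e_i); exists C.
exists (C0 + \sum_(i < n) Cx i + \sum_(i < n) Cp i) => [|z Kz w].
  by rewrite !ltr_wpDr // sumr_ge0 // => i _; [have [/ltW] := Hp i | have [/ltW] := Hx i].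
have w1 : `|w.1.1| <= `|w| by rewrite !prod_normE /= !le_max lexx.
have w2 : `|w.1.2| <= `|w| by rewrite !prod_normE /= !le_max lexx orbT.
have w3 : `|w.2| <= `|w| by rewrite !prod_normE /= !le_max lexx orbT.
rewrite {1}(triple_expand w) !linearD !linear_sum /= !mulrDl !mulr_suml.
apply: le_trans (ler_normD _ _) _; apply: lerD; first (apply: le_trans (ler_normD _ _) _; apply: lerD).
- by rewrite linearZ /= normrM mulrC ler_pM // H0.
- apply: le_trans (ler_norm_sum _ _ _) _; apply: ler_sum => i _.
  rewrite linearZ /= normrM mulrC ler_pM //; first by have [_] := Hx i; apply.
  exact: le_trans (coord_le_norm _ _) w2.
- apply: le_trans (ler_norm_sum _ _ _) _; apply: ler_sum => i _.
  rewrite linearZ /= normrM mulrC ler_pM //; first by have [_] := Hp i; apply.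
  exact: le_trans (coord_le_norm _ _) w3.
Qed.

Lemma is_derive_line (F : V -> R) (z w : V) (s : R) :
  differentiable F (z + s *: w) ->
  is_derive s 1 (fun s : R => F (z + s *: w)) ('d F (z + s *: w) w).
Proof.
move=> dF; apply: (@is_derive_chain R V R^o (fun s : R => z + s *: w) F s w) => //.
have dw := is_derive_scalel w s.
by apply: is_derive_eq; rewrite add0r.
Qed.

Lemma C1_box_lipschitz (F : V -> R) : C1_open U F ->
  exists2 C : R, 0 < C & forall z z', box T x0 rho r z -> box T x0 rho r z' ->
    `|F z' - F z| <= C * `|z' - z|.
Proof.
move=> HF; have [C C0 HC] := C1_box_diff_bound HF; exists C => // z z' Kz Kz'.
pose c s := F (z + s *: (z' - z)).
have D (s : R) : 0 <= s <= 1 -> is_derive s 1 c ('d F (z + s *: (z' - z)) (z' - z)).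
  move=> s01; apply: is_derive_line; have [dF _] := HF; apply: dF; apply: boxU.
  exact: box_segment.
have D' (s : R) : s \in `]0, 1[ -> is_derive s 1 c ('d F (z + s *: (z' - z)) (z' - z)).
  by rewrite in_itv /= => /andP[s0 s1]; apply: D; rewrite !ltW.
have Cc : {within `[0, 1], continuous c}.
  apply: continuous_in_subspaceT => s; rewrite inE /= in_itv /= => s01.
  exact: (is_derive_continuous (D s s01)).
have [s] := MVT_segment ler01 D' Cc.
rewrite in_itv /= /c scale0r addr0 scale1r subr0 mulr1 (addrC z) subrK => s01 ->.
by apply: HC; exact: box_segment.
Qed.

End BoxLipschitz.

Lemma is_diff_is_derive (R : realType) (V W : normedModType R) (f df : V -> W) (x v : V) :
  is_diff x f df -> is_derive x v f (df v).
Proof.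
move=> [d E]; apply: DeriveDef; first exact: diff_derivable.
by rewrite deriveE // E.
Qed.

Section Partial.
Variables (R : realType) (n : nat).
Local Notation E := 'rV[R]_n.
Local Notation V := (R * E * E)%type.
Variables (W : normedModType R) (F : V -> W) (t : R) (x p : E).
Hypothesis dF : differentiable F (t, x, p).

Lemma is_derive_partial_p v : is_derive p v (fun q => F (t, x, q)) ('d F (t, x, p) (0, 0, v)).
Proof.
have d1 : is_diff p (fun q : E => ((t, x), q)) (fun v : E => ((0, 0), v)).
  exact: (@is_diff_pair _ E (R * E)%type E (cst (t, x)) (cst 0) id id).
have d2 : is_diff (t, x, p) F ('d F (t, x, p)) by [].
exact: (is_diff_is_derive v (is_diff_comp d1 d2)).
Qed.

Lemma is_derive_partial_x v : is_derive x v (fun y => F (t, y, p)) ('d F (t, x, p) (0, v, 0)).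
Proof.
have d0 : is_diff x (fun y : E => (t, y)) (fun v : E => (0, v)).
  exact: (@is_diff_pair _ E R E (cst t) (cst 0) id id).
have d1 : is_diff x (fun y : E => ((t, y), p)) (fun v : E => ((0, v), 0)).
  exact: (@is_diff_pair _ E (R * E)%type E _ _ (cst p) (cst 0)).
have d2 : is_diff (t, x, p) F ('d F (t, x, p)) by [].
exact: (is_diff_is_derive v (is_diff_comp d1 d2)).
Qed.

End Partial.

Lemma linear_p_expand (R : realType) n (L : {linear (R * 'rV[R]_n * 'rV[R]_n)%type -> R}) (q : 'rV[R]_n) :
  L (0, 0, q) = \sum_(j < n) q 0 j * L (0, 0, 'e_j).
Proof.
rewrite {1}(triple_expand (0, 0, q)) /= scale0r add0r.
rewrite [X in X + _]big1 ?add0r => [|j _]; last by rewrite mxE scale0r.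
by rewrite linear_sum; apply: eq_bigr => j _; rewrite linearZ.
Qed.

Lemma linear_x_expand (R : realType) n (L : {linear (R * 'rV[R]_n * 'rV[R]_n)%type -> R}) (y : 'rV[R]_n) :
  L (0, y, 0) = \sum_(j < n) y 0 j * L (0, 'e_j, 0).
Proof.
rewrite {1}(triple_expand (0, y, 0)) /= scale0r add0r.
rewrite [X in _ + X]big1 ?addr0 => [|j _]; last by rewrite mxE scale0r.
by rewrite linear_sum; apply: eq_bigr => j _; rewrite linearZ.
Qed.

Lemma cvg_sum_ord (R : realType) (T : Type) (F : set_system T) (n : nat)
    (f : 'I_n -> T -> R) (l : 'I_n -> R) : Filter F ->
  (forall i, f i x @[x --> F] --> l i) ->
  \sum_(i < n) f i x @[x --> F] --> \sum_(i < n) l i.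
Proof.
move=> FF; elim: n f l => [|n IH] f l H.
  by under eq_fun do rewrite big_ord0; rewrite big_ord0; exact: cvg_cst.
under eq_fun do rewrite big_ord_recl; rewrite big_ord_recl.
by apply: cvgD => //; apply: IH => i; exact: H.
Qed.

(** All that the rest of the proof draws from the C2 regularity and the convexity of [H]: Lipschitz
    bounds for [H] and its first derivatives in x and p, and second-order expansions from above and
    below at a fixed time. [th] is the modulus of convexity in p; in the lower expansion the mixed
    terms in x and p have been absorbed into [C] and a smaller [th]. *)
Definition box_estimates (R : realType) n (H : R * 'rV[R]_n * 'rV[R]_n -> R) (T : R)
    (x0 : 'rV[R]_n) (rho r C th : R) : Prop :=
  forall (t s : R) (x x' p p' : 'rV[R]_n), 0 <= t <= T -> 0 <= s <= T ->
    `|x - x0| <= rho -> `|x' - x0| <= rho -> `|p| <= r -> `|p'| <= r ->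
  [/\ `|H (s, x', p') - H (t, x, p)| <= C * (`|s - t| + `|x' - x| + `|p' - p|),
      `|DxH H s x' p' - DxH H t x p| <= C * (`|s - t| + `|x' - x| + `|p' - p|),
      `|DpH H s x' p' - DpH H t x p| <= C * (`|s - t| + `|x' - x| + `|p' - p|),
      H (t, x', p') <= H (t, x, p) + dot (DxH H t x p) (x' - x) + dot (DpH H t x p) (p' - p)
                       + C * (dot (x' - x) (x' - x) + dot (p' - p) (p' - p))
    & H (t, x, p) + dot (DxH H t x p) (x' - x) + dot (DpH H t x p) (p' - p)
        + th * dot (p' - p) (p' - p) - C * dot (x' - x) (x' - x) <= H (t, x', p')].

(** Half of the coercivity [m] pays for the mixed terms: after replacing [dy] and [dq] by [Y ^+ 2]
    and [Q ^+ 2], the gap between the two sides is the square [m / 2 * (Q - 2 * c / m * Y) ^+ 2]. *)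
Lemma young_gap (R : realType) (c m Y Q dy dq : R) : 0 < c -> 0 < m -> Y ^+ 2 <= dy -> Q ^+ 2 <= dq ->
  m / 2 * dq - (c + 2 * c ^+ 2 / m) * dy <= - (c * (Y * (Y + Q))) + (- (c * (Q * Y)) + m * dq).
Proof.
move=> c0 m0 Yd Qd; set C := c + _.
have h1 : C * Y ^+ 2 <= C * dy by rewrite ler_pM2l // addr_gt0 // divr_gt0 // mulr_gt0 // exprn_gt0.
have h2 : m / 2 * Q ^+ 2 <= m / 2 * dq by rewrite ler_pM2l // divr_gt0.
have h3 : C * Y ^+ 2 - c * (Y * (Y + Q)) - c * (Q * Y) + m / 2 * Q ^+ 2 = m / 2 * (Q - 2 * c / m * Y) ^+ 2.
  by rewrite /C; field; rewrite gt_eqF.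
have h4 : 0 <= m / 2 * (Q - 2 * c / m * Y) ^+ 2 by rewrite mulr_ge0 ?sqr_ge0 // divr_ge0 // ltW.
lra.
Qed.

Section Hamiltonian.
Variables (R : realType) (n : nat).
Local Notation E := 'rV[R]_n.
Local Notation V := (R * E * E)%type.
Variables (Omega : set E) (T : R) (H g : V -> R) (U : set V).
Local Notation A := (`[0, T]%classic `*` Omega `*` [set: E]).
Hypotheses (oU : open U) (oOmega : open Omega) (AU : A `<=` U).
Hypotheses (Hg : forall z, A z -> H z = g z) (g2 : C2_open U g).

Let inA t x p : 0 <= t <= T -> Omega x -> A (t, x, p).
Proof. by move=> tT Ox; split => //; split=> //=; rewrite in_itv. Qed.

Let dg t x p : 0 <= t <= T -> Omega x -> differentiable g (t, x, p).
Proof. by move=> tT Ox; have [[d _] _] := g2; apply: d; apply: AU; apply: inA. Qed.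

Let HpE t x : 0 <= t <= T -> Omega x -> (fun q => H (t, x, q)) = (fun q => g (t, x, q)).
Proof. by move=> tT Ox; apply/funext => q; rewrite Hg //; apply: inA. Qed.

Lemma dot_DpH t x p q : 0 <= t <= T -> Omega x -> dot (DpH H t x p) q = 'd g (t, x, p) (0, 0, q).
Proof.
move=> tT Ox; rewrite /DpH HpE // /grad /dot.
rewrite linear_p_expand; apply: eq_bigr => i _; rewrite mxE mulrC; congr (_ * _).
by have [_ ->] := is_derive_partial_p (dg p tT Ox) 'e_i.
Qed.

Lemma dot_DxH t x p y : 0 <= t <= T -> Omega x -> dot (DxH H t x p) y = 'd g (t, x, p) (0, y, 0).
Proof.
move=> tT Ox; rewrite /DxH /grad /dot.
rewrite linear_x_expand; apply: eq_bigr => i _; rewrite mxE mulrC; congr (_ * _).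
have [_ <-] := is_derive_partial_x (dg p tT Ox) 'e_i.
(* [H] and [g] agree only above [Omega], so the x-derivative passes from one to the other because
   [Omega] is open. *)
apply: near_eq_derive; near=> z; rewrite Hg //; apply: inA => //.
by near: z; exact: open_nbhs_nbhs.
Unshelve. all: by end_near. Qed.

Lemma DpH_coord t x p i : 0 <= t <= T -> Omega x -> DpH H t x p 0 i = 'd g (t, x, p) (0, 0, 'e_i).
Proof. by move=> tT Ox; rewrite -dot_DpH // dot_delta. Qed.

Lemma DxH_coord t x p i : 0 <= t <= T -> Omega x -> DxH H t x p 0 i = 'd g (t, x, p) (0, 'e_i, 0).
Proof. by move=> tT Ox; rewrite -dot_DxH // dot_delta. Qed.

Lemma DppH_coord t x p i j : 0 <= t <= T -> Omega x ->
  DppH H t x p i j = 'd (fun z => 'd g z (0, 0, 'e_i)) (t, x, p) (0, 0, 'e_j).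
Proof.
move=> tT Ox; rewrite /DppH HpE // mxE.
have -> : (fun y => 'D_('e_i) (fun q => g (t, x, q)) y) = (fun y => 'd g (t, x, y) (0, 0, 'e_i)).
  by apply/funext => y; have [_ ->] := is_derive_partial_p (dg y tT Ox) 'e_i.
have [_ /(_ (0, 0, 'e_i))[d _]] := g2.
by have [_ ->] := is_derive_partial_p (d _ (AU (inA p tT Ox))) 'e_j.
Qed.

Hypothesis (Hpos : forall (t : R) (x p : E), 0 <= t <= T -> Omega x -> posdef (DppH H t x p)).
Variables (x0 : E) (rho r : R).
Hypothesis cubeO : forall x : E, `|x - x0| <= rho -> Omega x.
Local Notation K := (box T x0 rho r).

Lemma boxA z : K z -> A z.
Proof. by case: z => [[t x] p] [/= tT /cubeO Ox _]; split => //; split=> //=; rewrite in_itv. Qed.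

Let b (i : 'I_n) (z : V) : R := 'd g z (0, 0, 'e_i).

Lemma Hpp_form z (q : E) : K z ->
  \sum_(i < n) q 0 i * 'd (b i) z (0, 0, q) = dot (q *m DppH H z.1.1 z.1.2 z.2) q.
Proof.
case: z => [[t x] p] [/= tT /cubeO Ox _].
under eq_bigr => i _ do rewrite linear_p_expand mulr_sumr.
rewrite exchange_big; apply: eq_bigr => j _; rewrite !mxE mulr_suml; apply: eq_bigr => i _.
have -> := DppH_coord p i j tT Ox.
by rewrite mulrCA mulrC; congr (_ * _); rewrite mulrC.
Qed.

(** The quadratic form is continuous and positive on the compact product of the box with the unit
    sphere, hence bounded below there by a positive minimum; homogeneity of degree 2 extends the
    bound to all [q]. *)
Lemma Hpp_coercive : exists2 m : R, 0 < m &
  forall z, K z -> forall q : E, m * dot q q <= \sum_(i < n) q 0 i * 'd (b i) z (0, 0, q).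
Proof.
pose S : set E := [set q | `|q| = 1].
have cS : compact S.
  apply: (@subclosed_compact _ S [set x : E | `|x - 0| <= 1]); last 2 first.
  - exact: cube_compact.
  - by move=> q; rewrite /S /= subr0 => ->.
  have -> : S = (fun q : E => `|q - 0|) @^-1` [set 1].
    by apply/seteqP; split=> q /=; rewrite subr0.
  apply: closed_comp; last exact: closed_eq.
  by move=> q _; exact: normB_continuous.
pose D (i j : 'I_n) (z : V) : R := 'd (b i) z (0, 0, 'e_j).
pose f (zq : V * E) : R := \sum_(i < n) \sum_(j < n) zq.2 0 i * zq.2 0 j * D i j zq.1.
have fE z (q : E) : f (z, q) = \sum_(i < n) q 0 i * 'd (b i) z (0, 0, q).
  apply: eq_bigr => i _; rewrite linear_p_expand mulr_sumr.
  by apply: eq_bigr => j _; rewrite mulrA.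
have fpos z (q : E) : K z -> q != 0 -> 0 < f (z, q).
  by case: z => [[t x] p] Kz q0; rewrite fE Hpp_form //; case: Kz => /= tT /cubeO Ox _; exact: Hpos.
have fc : {within K `*` S, continuous f}.
  apply: continuous_in_subspaceT => -[z q]; rewrite inE => -[/= /boxA/AU Uz _].
  have c2 i : {for (z, q), continuous (fun zq : V * E => zq.2 0 i)}.
    by apply: (@continuous_comp _ _ _ snd (fun v : E => v 0 i)); [exact: cvg_snd | exact: coord_continuous].
  have cb i j : {for (z, q), continuous (fun zq : V * E => D i j zq.1)}.
    apply: (@continuous_comp _ _ _ fst (D i j)); first exact: cvg_fst.
    by have [_ /(_ (0, 0, 'e_i))[_ /(_ (0, 0, 'e_j) z Uz)]] := g2.
  apply: cvg_sum_ord => i; apply: cvg_sum_ord => j; apply: cvgM; last exact: cb.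
  by apply: cvgM; exact: c2.
have hom z (q : E) : q != 0 -> f (z, q) = `|q| ^+ 2 * f (z, `|q|^-1 *: q).
  move=> q0; rewrite /f mulr_sumr; apply: eq_bigr => i _; rewrite mulr_sumr; apply: eq_bigr => j _ /=.
  by rewrite !mxE; field; rewrite normr_eq0.
have qS (q : E) : q != 0 -> S (`|q|^-1 *: q) by move=> q0; rewrite /S /= normfZV.
have dn (q : E) : dot q q <= n%:R * `|q| ^+ 2 by rewrite expr2; exact: dot_le_norm.
(* The product is empty when the box is empty or when [n = 0], where the sphere has no point; in a
   nonempty box the only [q] is then 0, and any constant works. *)
have [E0|/set0P KS0] := eqVneq (K `*` S) set0.
  exists 1 => // z Kz q; have [->|q0] := eqVneq q 0.
    by rewrite dot0l mulr0 big1 // => i _; rewrite mxE mul0r.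
  have KSq : (K `*` S) (z, `|q|^-1 *: q) by split=> //=; exact: qS.
  by rewrite E0 in KSq.
have cKS : compact (K `*` S) by apply: compact_setX => //; exact: box_compact.
have [[z1 q1]] := compact_EVT_min KS0 cKS fc.
rewrite inE => -[/= Kz1 Sq1] fmin.
have q10 : q1 != 0 by rewrite -normr_gt0 Sq1.
have m0 : 0 < f (z1, q1) by exact: fpos.
(* The sphere is that of the sup norm, and [dot q q] is at most [n] times its square; [n.+1] avoids
   dividing by 0. *)
exists (f (z1, q1) / n.+1%:R) => [|z Kz q]; first by rewrite divr_gt0.
rewrite -fE; have [->|q0] := eqVneq q 0.
  by rewrite dot0l mulr0 fE big1 // => i _; rewrite mxE mul0r.
rewrite hom //; apply: (@le_trans _ _ (`|q| ^+ 2 * f (z1, q1))); last first.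
  apply: ler_wpM2l; first exact: sqr_ge0.
  have KSq : (z, `|q|^-1 *: q) \in K `*` S by rewrite inE; split=> //=; exact: qS.
  exact: fmin KSq.
move: (f (z1, q1)) m0 => m m0.
rewrite mulrAC ler_pdivrMr // mulrC [leRHS]mulrAC; apply: ler_wpM2r; first exact: ltW.
apply: le_trans (dn q) _; rewrite mulrC; apply: ler_wpM2l; first exact: sqr_ge0.
by rewrite ler_nat.
Qed.

Let KU : K `<=` U.
Proof. by move=> z /boxA/AU. Qed.

Let a (i : 'I_n) (z : V) : R := 'd g z (0, 'e_i, 0).

Let a1 i : C1_open U (a i). Proof. by have [_] := g2; apply. Qed.
Let b1 i : C1_open U (b i). Proof. by have [_] := g2; apply. Qed.

(** Taylor expansion of [g] on the segment from [z] to [z + (0, y, q)]. The second derivative is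
    split into the part carrying [y], the mixed part and the part quadratic in [q]. From above all
    three are bounded by [c]; from below the last one is bounded by coercivity and [young_gap]
    handles the others. *)
Lemma second_order_bounds : exists c m : R, [/\ 0 < c, 0 < m &
  forall z (y q : E), K z -> K (z + ((0, y, q) : V)) ->
    g (z + ((0, y, q) : V)) <= g z + 'd g z (0, y, q) + c * (dot y y + dot q q) /\
    g z + 'd g z (0, y, q) + m * dot q q - c * dot y y <= g (z + ((0, y, q) : V))].
Proof.
have [m m0 Hm] := Hpp_coercive.
have /choice[ca Hca] : forall i, exists C : R, 0 < C /\
    forall z, K z -> forall w, `|'d (a i) z w| <= C * `|w|.
  by move=> i; have [C ? ?] := C1_box_diff_bound KU (a1 i); exists C.
have /choice[cb Hcb] : forall i, exists C : R, 0 < C /\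
    forall z, K z -> forall w, `|'d (b i) z w| <= C * `|w|.
  by move=> i; have [C ? ?] := C1_box_diff_bound KU (b1 i); exists C.
pose c := 1 + \sum_(i < n) ca i + \sum_(i < n) cb i.
have sa0 : 0 <= \sum_(i < n) ca i by apply: sumr_ge0 => i _; have [/ltW] := Hca i.
have sb0 : 0 <= \sum_(i < n) cb i by apply: sumr_ge0 => i _; have [/ltW] := Hcb i.
have c0 : 0 < c by rewrite /c; lra.
have sac : \sum_(i < n) ca i <= c by rewrite /c -addrA addrCA lerDl addr_ge0.
have sbc : \sum_(i < n) cb i <= c by rewrite /c lerDr addr_ge0.
have bound (d : 'I_n -> V -> R) (cd : 'I_n -> R) (z w : V) (v : E) : K z ->
    (forall i, 0 < cd i /\ forall z, K z -> forall w, `|'d (d i) z w| <= cd i * `|w|) ->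
    `|\sum_(i < n) v 0 i * 'd (d i) z w| <= (\sum_(i < n) cd i) * (`|v| * `|w|).
  move=> Kz Hd; apply: le_trans (ler_norm_sum _ _ _) _; rewrite mulr_suml; apply: ler_sum => i _.
  rewrite normrM mulrCA; apply: ler_pM => //; first exact: coord_le_norm.
  by have [_] := Hd i; apply.
pose C := c + 2 * c ^+ 2 / m.
have C0 : 0 < C by rewrite addr_gt0 // divr_gt0 // mulr_gt0 // exprn_gt0.
(* The modulus [m] is halved once in [young_gap] and once more by the factor 1/2 of the Taylor
   formula. *)
exists C, (m / 4); split=> // [|z y q Kz Kz']; first by rewrite divr_gt0.
pose w : V := (0, y, q).
have wn : `|w| <= `|y| + `|q| by rewrite !prod_normE /= normr0 !ge_max addr_ge0 // lerDl lerDr !normr_ge0.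
have yn : `|(0, y, 0) : V| <= `|y| by rewrite !prod_normE /= !normr0 !ge_max normr_ge0 lexx.
have qn : `|(0, 0, q) : V| <= `|q| by rewrite !prod_normE /= !normr0 !ge_max normr_ge0 lexx.
pose zs (s : R) := z + s *: w.
have Kzs s : 0 <= s <= 1 -> K (zs s).
  by move=> s01; have := box_segment s01 Kz Kz'; rewrite -/w addrAC subrr add0r.
pose f s := g (zs s).
pose f1 s := \sum_(i < n) y 0 i * a i (zs s) + \sum_(i < n) q 0 i * b i (zs s).
pose f2 s := \sum_(i < n) y 0 i * 'd (a i) (zs s) w + \sum_(i < n) q 0 i * 'd (b i) (zs s) w.
have f1E s : 'd g (zs s) w = f1 s.
  have -> : w = ((0, y, 0) : V) + ((0, 0, q) : V) by congr (_, _, _); rewrite /= ?addr0 ?add0r.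
  by rewrite linearD /= linear_x_expand linear_p_expand.
have d1 (s : R) : 0 <= s <= 1 -> is_derive s 1 f (f1 s).
  move=> s01; rewrite -f1E; apply: is_derive_line.
  by have [[gd _] _] := g2; apply: gd; apply: KU; exact: Kzs.
have d2 (s : R) : 0 <= s <= 1 -> is_derive s 1 f1 (f2 s).
  move=> s01; apply: is_deriveD; apply: is_derive_bigsum => i.
    have da : is_derive s 1 (fun s => a i (zs s)) ('d (a i) (zs s) w).
      by apply: is_derive_line; have [ad _] := a1 i; apply: ad; apply: KU; exact: Kzs.
    exact: (is_deriveZ (y 0 i) da).
  have db : is_derive s 1 (fun s => b i (zs s)) ('d (b i) (zs s) w).
    by apply: is_derive_line; have [bd _] := b1 i; apply: bd; apply: KU; exact: Kzs.
  exact: (is_deriveZ (q 0 i) db).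
have Y0 := normr_ge0 y; have Q0 := normr_ge0 q.
have YD := sqr_norm_le_dot y; have QD := sqr_norm_le_dot q.
have P1 s : 0 <= s <= 1 -> `|\sum_(i < n) y 0 i * 'd (a i) (zs s) w| <= c * (`|y| * (`|y| + `|q|)).
  move=> s01; apply: le_trans (bound a ca _ w y (Kzs s s01) Hca) _.
  by apply: ler_pM => //; [rewrite mulr_ge0 | rewrite ler_wpM2l].
have f2E s : f2 s = \sum_(i < n) y 0 i * 'd (a i) (zs s) w +
    (\sum_(i < n) q 0 i * 'd (b i) (zs s) (0, y, 0) + \sum_(i < n) q 0 i * 'd (b i) (zs s) (0, 0, q)).
  congr (_ + _); rewrite -big_split; apply: eq_bigr => i _ /=; rewrite -mulrDr; congr (_ * _).
  rewrite -linearD /=; congr ('d (b i) (zs s) _).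
  by congr (_, _, _); rewrite /= ?addr0 ?add0r.
have P2 s : 0 <= s <= 1 -> `|\sum_(i < n) q 0 i * 'd (b i) (zs s) (0, y, 0)| <= c * (`|q| * `|y|).
  move=> s01; apply: le_trans (bound b cb _ _ q (Kzs s s01) Hcb) _.
  by apply: ler_pM => //; [exact: mulr_ge0 | exact: ler_wpM2l].
have P3 s : 0 <= s <= 1 -> `|\sum_(i < n) q 0 i * 'd (b i) (zs s) (0, 0, q)| <= c * (`|q| * `|q|).
  move=> s01; apply: le_trans (bound b cb _ _ q (Kzs s s01) Hcb) _.
  by apply: ler_pM => //; [exact: mulr_ge0 | exact: ler_wpM2l].
have zs0 : zs 0 = z by rewrite /zs scale0r addr0.
have zs1 : zs 1 = z + w by rewrite /zs scale1r.
have cC : c <= C by rewrite /C lerDl divr_ge0 ?mulr_ge0 ?sqr_ge0 ?ltW.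
set Y := `|y| in Y0 YD P1 P2 P3 *; set Q := `|q| in Q0 QD P1 P2 P3 *.
split.
  have k2 s : 0 <= s <= 1 -> f2 s <= 2 * (c * (dot y y + dot q q)).
    move=> s01; rewrite f2E.
    have := P1 s s01; have := P2 s s01; have := P3 s s01; rewrite !ler_norml.
    move=> /andP[_ h3] /andP[_ h2] /andP[_ h1].
    have : c * (Y * (Y + Q)) + c * (Q * Y) + c * (Q * Q) <= 2 * (c * (dot y y + dot q q)).
      have -> : c * (Y * (Y + Q)) + c * (Q * Y) + c * (Q * Q) = c * (2 * (Y ^+ 2 + Q ^+ 2) - (Y -
        Q) ^+ 2) by ring.
      rewrite mulrCA ler_pM2l //; apply: (@le_trans _ _ (2 * (Y ^+ 2 + Q ^+ 2))).
        by rewrite gerBl sqr_ge0.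
      by rewrite ler_pM2l // lerD.
    by apply: le_trans; rewrite -addrA lerD // lerD.
  have h1 := taylor2_le d1 d2 k2.
  rewrite /f zs1 zs0 -f1E zs0 -/w in h1.
  have h2 : c * (dot y y + dot q q) <= C * (dot y y + dot q q).
    by rewrite ler_wpM2r // addr_ge0 // dot_ge0.
  apply: le_trans h1 _; rewrite lerD2l; apply: le_trans h2.
  by rewrite mulrAC divff ?mul1r // pnatr_eq0.
have k2 s : 0 <= s <= 1 -> - f2 s <= - (m / 2 * dot q q - C * dot y y).
  move=> s01; rewrite lerN2 f2E.
  have := P1 s s01; have := P2 s s01; have := Hm (zs s) (Kzs s s01) q; rewrite -/b !ler_norml.
  move=> h3 /andP[h2 _] /andP[h1 _].
  by apply: le_trans (young_gap c0 m0 YD QD) (lerD h1 (lerD h2 h3)).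
have e1 (s : R) : 0 <= s <= 1 -> is_derive s 1 (fun s => - f s) (- f1 s).
  by move=> s01; apply: is_deriveN; exact: d1.
have e2 (s : R) : 0 <= s <= 1 -> is_derive s 1 (fun s => - f1 s) (- f2 s).
  by move=> s01; apply: is_deriveN; exact: d2.
have h1 := taylor2_le e1 e2 k2.
rewrite /f zs1 zs0 -f1E zs0 -/w in h1.
move: h1; rewrite mulNr -!opprD lerN2 => h1.
apply: le_trans h1; rewrite -!addrA !lerD2l.
have -> : (m / 2 * dot q q - C * dot y y) / 2 = m / 4 * dot q q - C * dot y y + C * dot y y / 2 by field.
by rewrite lerDl divr_ge0 // mulr_ge0 ?dot_ge0 // ltW.
Qed.

Lemma box_estimates_ex : exists C th : R, [/\ 0 < C, 0 < th & box_estimates H T x0 rho r C th].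
Proof.
have [c [m [c0 m0 Hcm]]] := second_order_bounds.
have [Cg Cg0 HCg] := C1_box_lipschitz KU g2.1.
have /choice[ca Hca] : forall i, exists C : R, 0 < C /\
    forall z z', K z -> K z' -> `|a i z' - a i z| <= C * `|z' - z|.
  by move=> i; have [C ? ?] := C1_box_lipschitz KU (a1 i); exists C.
have /choice[cb Hcb] : forall i, exists C : R, 0 < C /\
    forall z z', K z -> K z' -> `|b i z' - b i z| <= C * `|z' - z|.
  by move=> i; have [C ? ?] := C1_box_lipschitz KU (b1 i); exists C.
have ca0 i : 0 <= ca i by have [/ltW] := Hca i.
have cb0 i : 0 <= cb i by have [/ltW] := Hcb i.
have ci (f : 'I_n -> R) i : (forall i, 0 <= f i) -> f i <= \sum_(i < n) f i.
  by move=> f0; rewrite (bigD1 i) //= lerDl sumr_ge0.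
have [C [C0 cC CgC caC cbC]] : exists C : R, [/\ 0 < C, c <= C, Cg <= C,
    forall i, ca i <= C & forall i, cb i <= C].
  have sa0 : 0 <= \sum_(i < n) ca i by exact: sumr_ge0.
  have sb0 : 0 <= \sum_(i < n) cb i by exact: sumr_ge0.
  have sa i := ci ca i ca0; have sb i := ci cb i cb0.
  move: (\sum_(i < n) ca i) (\sum_(i < n) cb i) sa0 sb0 sa sb => Sa Sb sa0 sb0 sa sb.
  exists (c + Cg + Sa + Sb); split=> [| | |i|i]; [by clear sa sb; lra|by clear sa sb;
    lra|by clear sa sb; lra| |].
    by have := sa i; lra.
  by have := sb i; lra.
exists C, m; split=> // t s x x' p p' tT sT xr xr' pr pr'.
have Kz : K (t, x, p) by [].
have Kz' : K (s, x', p') by [].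
have Kz'' : K (t, x', p') by [].
have Ox := cubeO xr; have Ox' := cubeO xr'.
have zn : `|(s, x', p') - (t, x, p) : V| <= `|s - t| + `|x' - x| + `|p' - p|.
  rewrite !prod_normE /= !ge_max; apply/andP; split; first (apply/andP; split).
  - by rewrite -addrA lerDl addr_ge0.
  - by rewrite -addrA addrCA lerDl addr_ge0.
  - by rewrite lerDr addr_ge0.
have N0 : 0 <= `|s - t| + `|x' - x| + `|p' - p| by rewrite !addr_ge0.
have L k : 0 <= k -> k <= C -> k * `|(s, x', p') - (t, x, p) : V| <= C * (`|s - t| + `|x' - x| + `|p' - p|).
  by move=> k0 kC; apply: ler_pM.
have HE z : K z -> H z = g z by move=> /boxA/Hg.
split.
- rewrite !HE //; apply: le_trans (HCg _ _ Kz Kz') _; apply: L => //; exact: ltW.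
- apply: norm_le_coord => [|i]; first by rewrite mulr_ge0 // ltW.
  rewrite mxE [X in _ + X]mxE DxH_coord // DxH_coord //.
  have [_ /(_ _ _ Kz Kz') h] := Hca i.
  by apply: le_trans h _; exact: L.
- apply: norm_le_coord => [|i]; first by rewrite mulr_ge0 // ltW.
  rewrite mxE [X in _ + X]mxE DpH_coord // DpH_coord //.
  have [_ /(_ _ _ Kz Kz') h] := Hcb i.
  by apply: le_trans h _; exact: L.
- rewrite !HE // dot_DxH // dot_DpH //.
  have E1 : (t, x, p) + ((0, x' - x, p' - p) : V) = (t, x', p').
    by congr (_, _, _); rewrite /= ?addr0 // addrC subrK.
  have := Hcm _ (x' - x) (p' - p) Kz; rewrite E1 => /(_ Kz'')[h _].
  apply: le_trans h _.
  have -> : (0, x' - x, p' - p) = ((0, x' - x, 0) : V) + ((0, 0, p' - p) : V).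
    by congr (_, _, _); rewrite /= ?addr0 ?add0r.
  by rewrite linearD /= !addrA lerD2l ler_wpM2r ?addr_ge0 ?dot_ge0.
- rewrite !HE // dot_DxH // dot_DpH //.
  have E1 : (t, x, p) + ((0, x' - x, p' - p) : V) = (t, x', p').
    by congr (_, _, _); rewrite /= ?addr0 // addrC subrK.
  have := Hcm _ (x' - x) (p' - p) Kz; rewrite E1 => /(_ Kz'')[_ h].
  apply: le_trans h.
  have -> : (0, x' - x, p' - p) = ((0, x' - x, 0) : V) + ((0, 0, p' - p) : V).
    by congr (_, _, _); rewrite /= ?addr0 ?add0r.
  by rewrite linearD /= !addrA lerD2l lerN2 ler_wpM2r ?dot_ge0.
Qed.

End Hamiltonian.

(** * Comparison with a test function in a tube *)

Lemma cvg_within_comp (T1 T2 T3 : topologicalType) (A : set T1) (B : set T2)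
    (f : T1 -> T2) (g : T2 -> T3) (x : T1) (y : T2) (l : T3) :
  (forall z, A z -> B (f z)) -> f z @[z --> within A (nbhs x)] --> y ->
  g w @[w --> within B (nbhs y)] --> l -> g (f z) @[z --> within A (nbhs x)] --> l.
Proof.
move=> AB fy gl Q /gl /fy /=; rewrite /within /= /nbhs /=; apply: filterS => z H Az.
by apply: H => //; exact: AB.
Qed.

Section Tube.
Variables (R : realType) (n : nat).
Local Notation E := 'rV[R]_n.

Lemma tube_continuous (v : R * E -> R) (S : set (R * E)) (X : R -> E) (a b r : R) :
  {within S, continuous v} -> {within `[a, b], continuous X} ->
  (forall t y, a <= t <= b -> `|y| <= r -> S (t, X t + y)) ->
  {within `[a, b]%classic `*` [set y | `|y - 0| <= r],
    continuous (fun z : R * E => v (z.1, X z.1 + z.2))}.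
Proof.
move=> vc Xc XS; set K := (X in {within X, continuous _}).
apply/subspace_continuousP => -[t y] Kty; have [/= tab yr] := Kty.
have inS z : K z -> S (z.1, X z.1 + z.2).
  case: z => [s z] [/= sab zr]; apply: XS; first by rewrite in_itv /= in sab.
  by rewrite subr0 in zr.
move/subspace_continuousP : vc => /(_ (t, X t + y) (inS (t, y) Kty)) vc.
move/subspace_continuousP : Xc => /(_ t tab) Xct.
have Tz : z.1 @[z --> within K (nbhs (t, y))] --> t.
  by apply: cvg_within_filter; exact: cvg_fst.
have Yz : z.2 @[z --> within K (nbhs (t, y))] --> y.
  by apply: cvg_within_filter; exact: cvg_snd.
have Xz : X z.1 @[z --> within K (nbhs (t, y))] --> X t.
  by apply: (cvg_within_comp (B := `[a, b]%classic) (f := fst)) Xct => // z [].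
apply: (cvg_within_comp (B := S) (f := fun z : R * E => (z.1, X z.1 + z.2)) _ _ vc) => //.
have XY : X z.1 + z.2 @[z --> within K (nbhs (t, y))] --> X t + y by exact: cvgD.
exact: (cvg_pair Tz XY).
Qed.

(** Since [v] is nonpositive on the bottom and the sides of the tube, a maximum with positive value
    can escape only through the top. The penalty reaches the maximum [M] of [v] exactly at time [b],
    which closes the top, and a high power keeps it below [v] at some earlier point where [v] is
    positive. Being polynomial it is C1 past [b] too, as a test function has to be, and its
    derivative has the favourable sign. *)
Lemma tube_max (v : R * E -> R) (S : set (R * E)) (X : R -> E) (a b r : R) :
  a < b -> {within S, continuous v} -> {within `[a, b], continuous X} ->
  (forall t y, a <= t <= b -> `|y| <= r -> S (t, X t + y)) ->
  (forall y, `|y| <= r -> v (a, X a + y) <= 0) ->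
  (forall t y, a <= t <= b -> `|y| = r -> v (t, X t + y) <= 0) ->
  forall t0 y0, a <= t0 <= b -> `|y0| <= r -> 0 < v (t0, X t0 + y0) ->
  exists pen pen' : R -> R, [/\ c1curve [set: R] pen pen', forall t, a <= t -> 0 <= pen' t &
    exists t1 y1, [/\ a < t1 < b, `|y1| < r &
      forall t y, a <= t <= b -> `|y| <= r ->
        v (t, X t + y) - pen t <= v (t1, X t1 + y1) - pen t1]].
Proof.
move=> ab vc Xc XS va vr t0 y0 t0ab y0r v0.
have fc := tube_continuous vc Xc XS.
pose f (z : R * E) := v (z.1, X z.1 + z.2); rewrite -/f in fc.
set K := (X in {within X, continuous _}) in fc.
have KE t y : K (t, y) <-> a <= t <= b /\ `|y| <= r.
  by rewrite /K /= in_itv /= subr0.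
have cK : compact K by apply: compact_setX; [exact: segment_compact | exact: cube_compact].
(* A positive value at the final time persists slightly earlier by continuity, so positivity may be
   assumed strictly before [b]. *)
have [t2 [t2ab v2]] : exists t2, a <= t2 < b /\ 0 < f (t2, y0).
  have /andP[at0] := t0ab; rewrite le_eqVlt => /predU1P[t0b|t0b]; last by exists t0; rewrite at0 t0b.
  have Kb : K (b, y0) by apply/KE; rewrite lexx ltW.
  have vb : 0 < f (b, y0) by rewrite -t0b.
  move/subspace_continuousP : fc => /(_ _ Kb)/cvgrPdist_lt/(_ _ vb).
  move=> [[Q1 Q2] [/= [e /= e0 He] /nbhs_singleton Q2y] HQ].
  pose t2 := Num.max a (b - e / 2).
  have t2b : t2 < b by rewrite gt_max ab /= gtrBl divr_gt0.
  have t2a : a <= t2 by rewrite le_max lexx.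
  exists t2; split; first by apply/andP; split.
  have h : `|f (b, y0) - f (t2, y0)| < f (b, y0).
    apply: (HQ (t2, y0)); last by apply/KE; rewrite t2a ltW.
    split => //=; apply: He; rewrite /ball_ /= gtr0_norm ?subr_gt0 //.
    by rewrite ltrBlDl -ltrBlDr lt_max; apply/orP; right; lra.
  by move: h; rewrite ltr_distl => /andP[]; lra.
have K0 : K !=set0 by exists (t0, y0); apply/KE.
have [[tM yM] KM HM] := compact_EVT_max K0 cK fc.
pose M := f (tM, yM).
have fM t y : a <= t <= b -> `|y| <= r -> f (t, y) <= M.
  by move=> tab yr; apply: HM; rewrite inE; apply/KE.
have M0 : 0 < M by apply: lt_le_trans v2 _; apply: fM; lra.
have at2 : a < t2.
  have /andP[] := t2ab; rewrite le_eqVlt => /predU1P[at2|//] _.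
  by move: v2; rewrite /f /= -at2 ltNge va.
have ba : 0 < b - a by rewrite subr_gt0.
pose q := (t2 - a) / (b - a).
have q0 : 0 < q by rewrite divr_gt0 // subr_gt0.
have q1 : q < 1 by rewrite ltr_pdivrMr // mul1r ltrD2r; case/andP: t2ab.
(* As [q < 1], a large exponent makes the penalty at [t2], which equals [M * q ^+ k.+1], smaller
   than the value of [v] there. *)
have [k qk] : exists k, M * q ^+ k.+1 < f (t2, y0).
  have /cvgrPdist_lt : q ^+ k @[k --> \oo] --> 0 by apply: cvg_expr; rewrite gtr0_norm.
  move=> /(_ (f (t2, y0) / M)); rewrite divr_gt0 // => /(_ isT)[k _ Hk]; exists k.
  have := Hk k.+1 (leqnSn k); rewrite /= sub0r normrN gtr0_norm ?exprn_gt0 //.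
  by rewrite ltr_pdivlMr // mulrC.
pose c := M / (b - a) ^+ k.+1.
have c0 : 0 < c by rewrite divr_gt0 // exprn_gt0.
pose pen t := c * (t - a) ^+ k.+1.
pose pen' t := c * (k.+1%:R * (t - a) ^+ k).
have penb : pen b = M by rewrite /pen /c divfK // expf_neq0 // gt_eqF.
have pen2 : pen t2 = M * q ^+ k.+1.
  by rewrite /pen /c /q expr_div_n; field; rewrite expf_neq0 // gt_eqF.
have pen_ge0 t : a <= t -> 0 <= pen t by move=> at_; rewrite mulr_ge0 ?(ltW c0) // exprn_ge0 // subr_ge0.
have dpen (t : R) : is_derive t 1 pen (pen' t).
  have d : is_derive t 1 (fun t => t - a) 1 by apply: is_derive_eq; rewrite subr0.
  have dX := is_deriveX k.+1 d.
  have -> : pen = c *: (fun t => t - a) ^+ k.+1 by apply/funext => x; rewrite /pen !fctE.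
  have -> : pen' t = c *: ((k.+1%:R * (t - a) ^+ k) *: 1) by rewrite /pen' /GRing.scale /= mulr1.
  exact: (is_deriveZ c dX).
have pen'c : continuous pen'.
  move=> t; rewrite /pen'; apply: cvgM; first exact: cvg_cst.
  apply: cvgM; first exact: cvg_cst.
  apply: (@continuous_comp _ _ _ (fun t => t - a) (fun x : R => x ^+ k)); last exact: exprn_continuous.
  by apply: cvgB; [exact: cvg_id | exact: cvg_cst].
pose h (z : R * E) := f z - pen z.1.
have hc : {within K, continuous h}.
  apply/subspace_continuousP => z Kz; apply: cvgB.
    by move/subspace_continuousP : fc; apply.
  apply: cvg_within_filter; apply: (@continuous_comp _ _ _ fst pen); first exact: cvg_fst.
  exact: (is_derive_continuous (dpen z.1)).
have [[t1 y1]] := compact_EVT_max K0 cK hc.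
rewrite inE => /KE[t1ab y1r] h1.
have h2 : 0 < h (t1, y1).
  apply: lt_le_trans (h1 (t2, y0) _); last by rewrite inE; apply/KE; split=> //; lra.
  by rewrite /h /= pen2 subr_gt0.
exists pen, pen'; split.
- by move=> t _; split; [exact: dpen | exact: pen'c].
- move=> t at_; apply: mulr_ge0; first exact: ltW.
  by apply: mulr_ge0; rewrite ?ler0n // exprn_ge0 // subr_ge0.
exists t1, y1; split; last first.
- by move=> t y tab yr; apply: (h1 (t, y)); rewrite inE; apply/KE.
- rewrite lt_neqAle y1r andbT; apply/eqP => y1r'; move: h2; rewrite /h /f /= ltNge.
  have := vr t1 y1 t1ab y1r'; have := pen_ge0 t1; have /andP[-> _] := t1ab.
  move=> /(_ isT); lra.
- have /andP[at1 t1b] := t1ab; rewrite !lt_neqAle at1 t1b !andbT; apply/andP; split; apply/eqP => E1.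
    have := va y1 y1r; move: h2; rewrite /h /f /= -E1 => h2 va1.
    have := pen_ge0 a (lexx a); lra.
  by have := fM t1 y1 t1ab y1r; move: h2; rewrite /h /= E1 penb; lra.
Qed.

End Tube.

Lemma near_tube (R : realType) (V : normedModType R) (Y : R -> V) (a b r t1 : R) (x1 : V) :
  {for t1, continuous Y} -> a < t1 < b -> `|x1 - Y t1| < r ->
  \forall z \near (t1, x1), a < z.1 < b /\ `|z.2 - Y z.1| < r.
Proof.
move=> Yc t1ab x1r.
have c1 : (fst z @[z --> (t1, x1)] --> t1) by exact: cvg_fst.
have c2 : (snd z @[z --> (t1, x1)] --> x1) by exact: cvg_snd.
have c3 : `|z.2 - Y z.1| @[z --> (t1, x1)] --> `|x1 - Y t1|.
  by apply: cvg_norm; apply: cvgB => //; apply: (cvg_comp _ _ c1).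
near=> z; split.
  apply/andP; split; near: z.
    by apply: (cvgr_gt _ c1); case/andP: t1ab.
  by apply: (cvgr_lt _ c1); case/andP: t1ab.
by near: z; exact: (cvgr_lt _ c3).
Unshelve. all: by end_near. Qed.

Lemma paraboloid_incr (R : realType) n (A N : R -> R) (P X : R -> 'rV[R]_n) t y w :
  paraboloid A P X N (t, X t + (y + w)) - paraboloid A P X N (t, X t + y) =
  dot (P t + N t *: y) w + N t / 2 * dot w w.
Proof.
rewrite /paraboloid /=.
have -> : X t + (y + w) - X t = y + w by rewrite addrC addKr.
have -> : X t + y - X t = y by rewrite addrC addKr.
by rewrite !dotE (dotC w y); field.
Qed.

(** At a contact point the increments of the test function are bounded on one side by the Lipschitz
    constant of u; small steps along each ['e_i], in both directions, transfer this bound to the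
    gradient. This confines the momenta at which [H] has to be controlled. *)
Lemma paraboloid_norm_slope (R : realType) n (q : 'rV[R]_n) (N L e : R) : 0 <= L -> 0 < e ->
  (forall w, `|w| < e -> - (L * `|w|) <= dot q w + N / 2 * dot w w) -> `|q| <= L.
Proof.
move=> L0 e0 Hw; apply: norm_le_coord => // i; apply/ler_addgt0Pr => d d0.
(* The step [s] is short enough for the curvature term to cost at most [s * d]. *)
pose s := Num.min (e / 2) (d / (`|N| + 1)).
have N1 : 0 < `|N| + 1 by rewrite ltr_wpDl.
have s0 : 0 < s by rewrite lt_min !divr_gt0.
have se : s < e by rewrite gt_min; apply/orP; left; lra.
have sd : s * (`|N| + 1) <= d by rewrite -ler_pdivlMr // ge_min lexx orbT.
have Nn := ler_norm N; have Nn' := ler_norm (- N); rewrite normrN in Nn'.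
have nd (k : R) : `|k *: 'e_i : 'rV[R]_n| <= `|k|.
  rewrite normrZ -[leRHS]mulr1 ler_wpM2l //; apply: norm_le_coord => // j.
  by rewrite mxE eqxx /=; case: eqP; rewrite /= ?normr1 ?normr0.
have Hk (k : R) : `|k| = s -> 0 <= L * s + k * q 0 i + N / 2 * s ^+ 2.
  move=> ks; have kn : `|k *: 'e_i : 'rV[R]_n| <= s by rewrite -ks.
  have := Hw (k *: 'e_i) (le_lt_trans kn se).
  rewrite !dotE !dot_delta mxE !eqxx /= mulr1.
  have -> : k * k = s ^+ 2 by rewrite -ks real_normK ?num_real // expr2.
  have : L * `|k *: 'e_i : 'rV[R]_n| <= L * s by rewrite ler_wpM2l.
  lra.
have sN : N / 2 * s ^+ 2 <= s * d.
  rewrite expr2 mulrCA ler_pM2l //.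
  have : N / 2 * s <= s * (`|N| + 1) by rewrite [leRHS]mulrC ler_wpM2r ?ltW //; lra.
  lra.
have h1 := Hk s (gtr0_norm s0); have h2 := Hk (- s); rewrite normrN in h2.
have {h2} := h2 (gtr0_norm s0); rewrite mulNr => h2.
by rewrite -(ler_pM2l s0) mulrDr; case: (lerP 0 (q 0 i)) => qi;
  rewrite ?(ger0_norm qi) ?(ltr0_norm qi); lra.
Qed.

Section Compare.
Variables (R : realType) (n : nat).
Local Notation E := 'rV[R]_n.
Variables (Omega : set E) (T : R) (H : R * E * E -> R) (u : R * E -> R).
Hypothesis Omega_open : open Omega.
Variables (a b r L : R).
Hypotheses (a0 : 0 <= a) (ab : a < b) (bT : b <= T).
Variables (lo hi : R).
Hypotheses (lo0 : lo < 0) (hiT : T < hi).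
Local Notation I := `]lo, hi[%classic.
Variables (A A' N N' : R -> R) (P P' X X' : R -> E).
Hypotheses (HA : c1curve I A A') (HP : c1curve I P P') (HX : c1curve I X X') (HN : c1curve I N N').
Local Notation S := [set z : R * E | a <= z.1 <= b /\ Omega z.2].
Hypothesis uc : {within S, continuous u}.
Hypothesis tubeO : forall t y, a <= t <= b -> `|y| <= r -> Omega (X t + y).
Local Notation phi := (paraboloid A P X N).
(** The left-hand side of the Hamilton-Jacobi equation evaluated on [phi] at the point [X t + y],
    with the formulas for the derivatives of a paraboloid inserted. *)
Local Notation slope t y :=
  (A' t + dot (P' t) y - dot (P t) (X' t) + N' t / 2 * dot y y - N t * dot y (X' t)
   + H (t, X t + y, P t + N t *: y)).

Let abI t : a <= t <= b -> I t.
Proof. by move: (a0) (bT) (lo0) (hiT) => *; rewrite /= in_itv /=; lra. Qed.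

Let curve_c1 (V : normedModType R) (f f' : R -> V) : c1curve I f f' -> c1curve `]0, T[ f f'.
Proof.
move=> Hf t; rewrite /= in_itv /= => t0T; apply: Hf.
by move: (lo0) (hiT) => *; rewrite /= in_itv /=; lra.
Qed.

Let curve_within (V : normedModType R) (f f' : R -> V) : c1curve I f f' -> {within `[a, b], continuous f}.
Proof.
move=> Hf; apply: continuous_in_subspaceT => t; rewrite inE /= in_itv /= => tab.
by have [/is_derive_continuous] := Hf t (abI tab).
Qed.

Lemma paraboloid_within : {within S, continuous phi}.
Proof.
apply: continuous_in_subspaceT => z; rewrite inE => -[zab Oz].
have [dphi _] := paraboloid_C1 (@interval_open R (BRight lo) (BLeft hi) isT isT) Omega_open HA HP HX HN.
by apply: differentiable_continuous; apply: dphi; split; [exact: abI | exact: Oz].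
Qed.

Let phi_tube t y : X t + y - X t = y. Proof. by rewrite addrC addKr. Qed.

Let tubeS t y : a <= t <= b -> `|y| <= r -> S (t, X t + y).
Proof. by move=> tab yr; split=> //=; exact: tubeO. Qed.

Lemma near_tube_max (v : R * E -> R) (pen : R -> R) t1 y1 : a < t1 < b -> `|y1| < r ->
  (forall t y, a <= t <= b -> `|y| <= r ->
     v (t, X t + y) - pen t <= v (t1, X t1 + y1) - pen t1) ->
  \forall z \near (t1, X t1 + y1), v z - pen z.1 <= v (t1, X t1 + y1) - pen t1.
Proof.
move=> t1ab y1r Hmax.
have t1ab' : a <= t1 <= b by move: t1ab; lra.
have [/is_derive_continuous Xc _] := HX (abI t1ab').
have := @near_tube _ E X a b r t1 (X t1 + y1) Xc t1ab; rewrite phi_tube => /(_ y1r).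
apply: filterS => -[t x] [/= tab xr].
have -> : x = X t + (x - X t) by rewrite addrC subrK.
by apply: Hmax; [move: tab; lra | exact: ltW].
Qed.

(** If [u] exceeded [phi] somewhere, [phi] plus the penalty would be an admissible test function at
    an interior maximum, where the subsolution inequality contradicts the positive slope. The sign
    of the slope is asked only for gradients of norm at most [L], the Lipschitz constant of [u] in
    the tube, because no other gradient occurs at contact; this lets the curvature be arbitrarily
    large. *)
Lemma subsolution_compare :
  viscosity_subsolution Omega T H u -> 0 <= L ->
  (forall t y y', a < t < b -> `|y| < r -> `|y'| < r ->
     `|u (t, X t + y') - u (t, X t + y)| <= L * `|y' - y|) ->
  (forall t y, a < t < b -> `|y| < r -> `|P t + N t *: y| <= L -> 0 < slope t y) ->
  (forall y, `|y| <= r -> u (a, X a + y) <= phi (a, X a + y)) ->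
  (forall t y, a <= t <= b -> `|y| = r -> u (t, X t + y) <= phi (t, X t + y)) ->
  forall t y, a <= t <= b -> `|y| <= r -> u (t, X t + y) <= phi (t, X t + y).
Proof.
move=> usub L0 uL Hslope Ha Hr t0 y0 t0ab y0r; rewrite leNgt; apply/negP => v0.
pose v z := u z - phi z.
have vc : {within S, continuous v}.
  by move=> z; apply: cvgB; [exact: uc | exact: paraboloid_within].
have va y : `|y| <= r -> v (a, X a + y) <= 0 by move=> yr; rewrite subr_le0; exact: Ha.
have vr t y : a <= t <= b -> `|y| = r -> v (t, X t + y) <= 0.
  by move=> tab yr; rewrite subr_le0; exact: Hr.
have v0' : 0 < v (t0, X t0 + y0) by rewrite subr_gt0.
have [pen [pen' [Hpen pen'0 [t1 [y1 [t1ab y1r Hmax]]]]]] :=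
  tube_max ab vc (curve_within HX) tubeS va vr t0ab y0r v0'.
have t1T : 0 < t1 < T by move: (a0) (bT) t1ab => *; lra.
have t1ab' : a <= t1 <= b by move: t1ab; lra.
pose A2 t := A t + pen t; pose A2' t := A' t + pen' t.
have HA2 : c1curve I A2 A2'.
  move=> t It; have [dA cA] := HA It; have [dp cp] := Hpen t Logic.I.
  by split; [exact: is_deriveD | exact: cvgD].
have C1 := paraboloid_C1 (@interval_open R (BRight 0) (BLeft T) isT isT) Omega_open
  (curve_c1 HA2) (curve_c1 HP) (curve_c1 HX) (curve_c1 HN).
have Ox1 : Omega (X t1 + y1) by apply: tubeO => //; exact: ltW.
have psiE z : paraboloid A2 P X N z = phi z + pen z.1 by rewrite /paraboloid /A2; ring.
have loc : \forall z \near (t1, X t1 + y1),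
    u z - paraboloid A2 P X N z <= u (t1, X t1 + y1) - paraboloid A2 P X N (t1, X t1 + y1).
  have := near_tube_max t1ab y1r Hmax; apply: filterS => z.
  by rewrite !psiE /v /= !opprD !addrA.
have := usub _ C1 t1 _ t1T Ox1 loc.
rewrite (paraboloid_Dt HA2 HP HX HN _ (abI t1ab')) paraboloid_Dx phi_tube.
have slope0 : 0 < slope t1 y1.
  apply: Hslope => //.
  (* At the contact point the increments of [phi] in x dominate those of [u], which are at least
     [- L] times the displacement. The penalty depends on time only and cancels. *)
  apply: (@paraboloid_norm_slope _ _ _ (N t1) L (r - `|y1|)) => // [|w wr]; first by rewrite subr_gt0.
  have yw : `|y1 + w| < r by apply: le_lt_trans (ler_normD _ _) _; rewrite -ltrBrDl.
  have := Hmax t1 (y1 + w) t1ab' (ltW yw).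
  have := uL t1 y1 (y1 + w) t1ab y1r yw; rewrite addrAC subrr add0r ler_norml => /andP[h _].
  have := paraboloid_incr A N P X t1 y1 w; rewrite /v; lra.
have := pen'0 t1; have -> : a <= t1 by case/andP: t1ab'.
by move=> /(_ isT); rewrite /A2'; lra.
Qed.

(** The mirror image: [phi] minus the penalty touches [u] from below, and the penalty again
    reinforces the sign of the slope. *)
Lemma supersolution_compare :
  viscosity_supersolution Omega T H u ->
  (forall t y, a < t < b -> `|y| < r -> slope t y < 0) ->
  (forall y, `|y| <= r -> phi (a, X a + y) <= u (a, X a + y)) ->
  (forall t y, a <= t <= b -> `|y| = r -> phi (t, X t + y) <= u (t, X t + y)) ->
  forall t y, a <= t <= b -> `|y| <= r -> phi (t, X t + y) <= u (t, X t + y).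
Proof.
move=> usup Hslope Ha Hr t0 y0 t0ab y0r; rewrite leNgt; apply/negP => v0.
pose v z := phi z - u z.
have vc : {within S, continuous v}.
  by move=> z; apply: cvgB; [exact: paraboloid_within | exact: uc].
have va y : `|y| <= r -> v (a, X a + y) <= 0 by move=> yr; rewrite subr_le0; exact: Ha.
have vr t y : a <= t <= b -> `|y| = r -> v (t, X t + y) <= 0.
  by move=> tab yr; rewrite subr_le0; exact: Hr.
have v0' : 0 < v (t0, X t0 + y0) by rewrite subr_gt0.
have [pen [pen' [Hpen pen'0 [t1 [y1 [t1ab y1r Hmax]]]]]] :=
  tube_max ab vc (curve_within HX) tubeS va vr t0ab y0r v0'.
have t1T : 0 < t1 < T by move: (a0) (bT) t1ab => *; lra.
have t1ab' : a <= t1 <= b by move: t1ab; lra.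
pose A2 t := A t - pen t; pose A2' t := A' t - pen' t.
have HA2 : c1curve I A2 A2'.
  move=> t It; have [dA cA] := HA It; have [dp cp] := Hpen t Logic.I.
  by split; [exact: is_deriveB | exact: cvgB].
have C1 := paraboloid_C1 (@interval_open R (BRight 0) (BLeft T) isT isT) Omega_open
  (curve_c1 HA2) (curve_c1 HP) (curve_c1 HX) (curve_c1 HN).
have Ox1 : Omega (X t1 + y1) by apply: tubeO => //; exact: ltW.
have psiE z : paraboloid A2 P X N z = phi z - pen z.1 by rewrite /paraboloid /A2; ring.
have loc : \forall z \near (t1, X t1 + y1),
    u (t1, X t1 + y1) - paraboloid A2 P X N (t1, X t1 + y1) <= u z - paraboloid A2 P X N z.
  have := near_tube_max t1ab y1r Hmax; apply: filterS => z.
  by rewrite !psiE /v /=; lra.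
have := usup _ C1 t1 _ t1T Ox1 loc.
rewrite (paraboloid_Dt HA2 HP HX HN _ (abI t1ab')) paraboloid_Dx phi_tube.
have slope0 : slope t1 y1 < 0 by exact: Hslope.
have := pen'0 t1; have -> : a <= t1 by case/andP: t1ab'.
by move=> /(_ isT); rewrite /A2'; lra.
Qed.

End Compare.

(** * Growth of the solution along curves *)

Definition lipschitz_box (R : realType) n (u : R * 'rV[R]_n -> R) (T t0 : R) (x0 : 'rV[R]_n) (rho L : R) :=
  forall t t' x x', 0 <= t <= T -> 0 <= t' <= T -> `|t - t0| <= rho -> `|t' - t0| <= rho ->
    `|x - x0| <= rho -> `|x' - x0| <= rho -> `|u (t', x') - u (t, x)| <= L * (`|t' - t| + `|x' - x|).

Lemma within_small (R : realType) (V : normedModType R) (f : R -> V) (a b t0 e : R) :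
  {within `[a, b], continuous f} -> a <= t0 <= b -> 0 < e ->
  exists2 d : R, 0 < d & forall t, a <= t <= b -> `|t - t0| <= d -> `|f t - f t0| <= e.
Proof.
move=> /subspace_continuousP fc t0ab e0.
have := fc t0; rewrite /= in_itv /= => /(_ t0ab)/cvgrPdist_le/(_ _ e0) [d /= d0 Hd].
exists (d / 2) => [|t tab td]; first by rewrite divr_gt0.
rewrite distrC; apply: (Hd t) => /=; last by rewrite in_itv.
by rewrite distrC; apply: le_lt_trans td _; lra.
Qed.

Lemma within_itv_W (R : realType) (V : topologicalType) (f : R -> V) (a b a' b' : R) :
  a <= a' -> b' <= b -> {within `[a, b], continuous f} -> {within `[a', b'], continuous f}.
Proof. by move=> aa bb; apply: continuous_subspaceW; apply: subset_itv; rewrite bnd_simp. Qed.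

Section Lip.
Variables (R : realType) (n : nat) (Omega : set 'rV[R]_n) (T : R) (u : R * 'rV[R]_n -> R).
Hypotheses (oOmega : open Omega) (u_lip : [locally [lipschitz u z | z in `[0, T] `*` Omega]]).

Lemma open_cube x0 : Omega x0 -> exists2 rho : R, 0 < rho & forall x, `|x - x0| <= rho -> Omega x.
Proof.
move=> Ox; have /nbhs_ballP[e /= e0 He] : nbhs x0 Omega by exact: open_nbhs_nbhs.
exists (e / 2) => [|x xe]; first by rewrite divr_gt0.
apply: He; rewrite -ball_normE /= distrC; apply: le_lt_trans xe _; lra.
Qed.

Lemma lipschitz_box_ex t0 x0 : 0 <= t0 <= T -> Omega x0 ->
  exists rho L : R, [/\ 0 < rho, 0 < L, forall x, `|x - x0| <= rho -> Omega x
    & lipschitz_box u T t0 x0 rho L].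
Proof.
move=> t0T Ox0; have [rho1 rho10 H1] := open_cube Ox0.
have := u_lip; rewrite /locally_of => /(_ ((t0, x0), (t0, x0))) [].
  by split; split=> //=; rewrite in_itv.
(* Every number above [M] is an admissible Lipschitz constant near the point; this choice is also
   positive. *)
move=> M [_ HM]; have {HM} := HM (Num.max M 0 + 1) _.
rewrite ltr_pwDr // ?le_max ?lexx // => /(_ isT); rewrite /dominated_by /= /within /=.
move=> [[Q1 Q2] /= [/nbhs_ballP[e1 /= e10 He1] /nbhs_ballP[e2 /= e20 He2]] HQ].
pose rho := Num.min rho1 (Num.min (e1 / 2) (e2 / 2)).
have rho0 : 0 < rho by rewrite !lt_min rho10 !divr_gt0.
have rhole : [/\ rho <= rho1, rho <= e1 / 2 & rho <= e2 / 2].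
  by split; rewrite !ge_min lexx ?orbT.
have [r1 r2 r3] := rhole.
exists rho, (Num.max M 0 + 1); split=> //.
- by rewrite ltr_pwDr // le_max lexx orbT.
- by move=> x xr; apply: H1; exact: le_trans xr r1.
move=> t t' x x' tT tT' td td' xd xd'.
have O1 y : `|y - x0| <= rho -> Omega y by move=> yr; apply: H1; exact: le_trans yr r1.
have B (e : R) s y : 0 < e -> rho <= e / 2 -> `|s - t0| <= rho -> `|y - x0| <= rho ->
    ball ((t0, x0) : R * 'rV[R]_n) e (s, y).
  move=> e0 re sr yr; split; rewrite -ball_normE /= distrC.
    by apply: le_lt_trans sr _; lra.
  by apply: le_lt_trans yr _; lra.
have inA s y : 0 <= s <= T -> `|y - x0| <= rho -> (`[0, T]%classic `*` Omega) (s, y).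
  by move=> sT yr; split; [rewrite /= in_itv | exact: O1].
have h := HQ ((t', x'), (t, x)) (conj (He1 _ (B e1 t' x' e10 r2 td' xd')) (He2 _ (B e2 t x e20 r3 td xd)))
  (conj (inA t' x' tT' xd') (inA t x tT xd)).
apply: le_trans h _; rewrite /self_sub /=; apply: ler_wpM2l.
  by rewrite addr_ge0 // le_max lexx orbT.
by rewrite prod_normE /= ge_max lerDl lerDr !normr_ge0.
Qed.

Lemma u_within : {within `[0, T] `*` Omega, continuous u}.
Proof.
apply/subspace_continuousP => -[t0 x0] [/=]; rewrite in_itv /= => t0T Ox0.
have [rho [L [rho0 L0 HO HL]]] := lipschitz_box_ex t0T Ox0.
apply/cvgrPdist_le => e e0.
pose d := Num.min rho (e / (2 * L)).
have d0 : 0 < d by rewrite lt_min rho0 divr_gt0 // mulr_gt0.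
have [dr dL] : d <= rho /\ d <= e / (2 * L) by rewrite !ge_min !lexx orbT.
exists (ball t0 d, ball x0 d); first by split; exact: nbhsx_ballx.
move=> [t x] [/=]; rewrite -!ball_normE /= => td xd [/=]; rewrite in_itv /= => tT Ox.
have LE k : k < d -> k <= rho by move=> kd; apply: ltW; exact: lt_le_trans dr.
rewrite distrC; apply: le_trans (HL t0 t x0 x t0T tT _ _ _ _) _; rewrite ?subrr ?normr0 ?(ltW rho0) //.
- by rewrite distrC; exact: LE.
- by rewrite distrC; exact: LE.
have : `|t - t0| + `|x - x0| <= 2 * d by rewrite distrC (distrC x); lra.
rewrite -(ler_pM2l L0) => h; apply: le_trans h _.
have : L * d <= e / 2.
  by move: dL; rewrite ler_pdivlMr ?mulr_gt0 // => h; lra.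
lra.
Qed.

End Lip.

(** The constants attached to a point: [rho] is the size of the box in time and space, [L] the
    Lipschitz constant of [u] there, [r] the radius of the momenta, [C] and [th] those of
    [box_estimates]. The condition [L <= r] places every gradient of [u], and every test gradient at
    contact, among the controlled momenta. *)
Definition local_setting (R : realType) n (Omega : set 'rV[R]_n) (T : R)
    (H : R * 'rV[R]_n * 'rV[R]_n -> R) (u : R * 'rV[R]_n -> R) (t0 : R) (x0 : 'rV[R]_n)
    (rho L r C th : R) : Prop :=
  [/\ 0 < rho, 0 < L, L <= r, 0 < C & 0 < th] /\
  [/\ forall x, `|x - x0| <= rho -> Omega x, box_estimates H T x0 rho r C th
    & lipschitz_box u T t0 x0 rho L].

Definition standing (R : realType) n (Omega : set 'rV[R]_n) (T : R)
    (H : R * 'rV[R]_n * 'rV[R]_n -> R) (u : R * 'rV[R]_n -> R) : Prop :=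
  [/\ open Omega, C2_on (`[0, T] `*` Omega `*` [set: 'rV[R]_n]) H,
      forall (t : R) (x p : 'rV[R]_n), 0 <= t <= T -> Omega x -> posdef (DppH H t x p)
    & [locally [lipschitz u z | z in `[0, T] `*` Omega]]].

(** The prescribed [r0] lets a caller include a given momentum, with some room around it, among the
    controlled ones. *)
Lemma local_setting_ex (R : realType) n (Omega : set 'rV[R]_n) (T : R)
    (H : R * 'rV[R]_n * 'rV[R]_n -> R) (u : R * 'rV[R]_n -> R) (t0 : R) (x0 : 'rV[R]_n) (r0 : R) :
  standing Omega T H u -> 0 <= t0 <= T -> Omega x0 ->
  exists rho L r C th, local_setting Omega T H u t0 x0 rho L r C th /\ r0 <= r.
Proof.
move=> [oOmega H_C2 H_convex u_lip] t0T Ox0.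
have [rho [L [rho0 L0 HO HL]]] := lipschitz_box_ex oOmega u_lip t0T Ox0.
have [U [g [oU AU Hg g2]]] := H_C2.
have [C [th [C0 th0 HC]]] := box_estimates_ex oOmega AU Hg g2 H_convex (Num.max r0 L) HO.
exists rho, L, (Num.max r0 L), C, th; split; last by rewrite le_max lexx.
by split; split=> //; rewrite le_max lexx orbT.
Qed.

(** [Lam'] dominates the Legendre transform of [H] at the velocity of [eta], restricted to momenta
    of norm at most [L]. The test function is [Lam] plus small corrections plus
    [|x - eta|^2 / (2 k)]: its gradient at [X t + y] is [y / k], and positivity of the slope there
    is exactly the hypothesis at the momentum [y / k], up to the displacement [y] in [H]. *)
Lemma curve_bound (R : realType) n (Omega : set 'rV[R]_n) (T : R)
    (H : R * 'rV[R]_n * 'rV[R]_n -> R) (u : R * 'rV[R]_n -> R)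
    (t0 : R) (x0 : 'rV[R]_n) (rho L r C th a b : R) (eta eta' : R -> 'rV[R]_n) (Lam Lam' : R -> R) :
  open Omega -> viscosity_subsolution Omega T H u ->
  {within `[0, T]%classic `*` Omega, continuous u} ->
  local_setting Omega T H u t0 x0 rho L r C th ->
  0 <= a -> a < b -> b <= T -> (forall t, a <= t <= b -> `|t - t0| <= rho) ->
  {within `[a, b], continuous eta} -> {within `[a, b], continuous eta'} ->
  {within `[a, b], continuous Lam} -> {within `[a, b], continuous Lam'} ->
  (forall t, a < t < b -> is_derive t 1 eta (eta' t)) ->
  (forall t, a < t < b -> is_derive t 1 Lam (Lam' t)) ->
  (forall t, a <= t <= b -> `|eta t - x0| <= rho / 2) ->
  (forall t, a < t < b -> forall q, `|q| <= L -> dot q (eta' t) - H (t, eta t, q) <= Lam' t) ->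
  u (b, eta b) - u (a, eta a) <= Lam b - Lam a.
Proof.
move=> oOmega u_sub uc loc a0 ab bT abrho ec ec' lc lc' ed ld erho Hq.
have [[rho0 L0 Lr C0 th0] [HO HE HL]] := loc.
have hiT : T < T + 1 by rewrite ltrDl.
have loa := lt_le_trans (ltrN10 R) a0.
have bhi : b < T + 1 by apply: le_lt_trans hiT.
have [X [X' [HX XE]]] := c1_extend_rV loa ab bhi ec ec' ed.
have [Y [Y' [HY YE]]] := c1_extend loa ab bhi lc lc' ld.
(* The oscillation of [Y], to be beaten on the sides of the tube. *)
have [M M0 HM] : exists2 M, 0 < M & forall t, a <= t <= b -> `|Y t - Y a| <= M.
  have [M M0 HM] : exists2 M : R, 0 < M & forall t, `[a, b]%classic t -> `|Y t - Y a| <= M.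
    apply: compact_bounded_fun; first exact: segment_compact.
    move=> t; rewrite /= in_itv /= => tab; apply: cvgB; last exact: cvg_cst.
    have It : `]-1, T + 1[%classic t.
      by rewrite /= in_itv /=; case/andP: tab => h1 h2; rewrite (lt_le_trans loa h1) (le_lt_trans h2 bhi).
    by have [/is_derive_continuous] := HY t It.
  by exists M => // t tab; apply: HM; rewrite /= in_itv.
have Xa : X a = eta a by have [] := XE a; rewrite ?lexx ?ltW.
have Xb : X b = eta b by have [] := XE b; rewrite ?lexx ?ltW.
have Ya : Y a = Lam a by have [] := YE a; rewrite ?lexx ?ltW.
have Yb : Y b = Lam b by have [] := YE b; rewrite ?lexx ?ltW.
have Xrho t : a <= t <= b -> `|X t - x0| <= rho / 2 by move=> tab; have [-> _] := XE t tab; exact: erho.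
have tubr t y : a <= t <= b -> `|y| <= rho / 2 -> `|X t + y - x0| <= rho.
  move=> tab yr; rewrite addrAC (splitr rho); apply: le_trans (ler_normD _ _) _.
  by apply: lerD => //; exact: Xrho.
have rho2 : rho / 2 <= rho by exact: ler_divSn (ltW rho0).
have aab : a <= a <= b by rewrite lexx ltW.
have aat : `|a - t0| <= rho by exact: abrho.
have aax : `|eta a - x0| <= rho by exact: le_trans (erho a aab) rho2.
have oc t : a < t < b -> a <= t <= b by move=> /andP[h1 h2]; rewrite !ltW.
have aT t : a <= t <= b -> 0 <= t <= T.
  by move=> /andP[h1 h2]; rewrite (le_trans a0 h1) (le_trans h2 bT).
rewrite lerBlDl; apply/ler_addgt0Pr => e e0.
(* [d] is the excess of slope that makes the inequality strict; over [[a, b]] it costs [e / 2]. *)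
pose d := e / (2 * (b - a)).
have ba : 0 < b - a by rewrite subr_gt0.
have d0 : 0 < d by rewrite divr_gt0 // mulr_gt0.
(* The first bound absorbs the change of position in [H], the second bounds the initial offset by
   the other [e / 2], and the third makes the quadratic term on the sides, where [|y| = rho / 2],
   exceed the variations of [u] and of [Lam]. *)
have [k [k0 k1 k2 k3]] : exists k : R, [/\ 0 < k, C * (k * L) < d, L ^+ 2 * k <= e / 2
    & (4 * rho * L + M) * (2 * k) <= (rho / 2) ^+ 2].
  have B1 : 0 < C * L by rewrite mulr_gt0.
  have B2 : 0 < L ^+ 2 by rewrite exprn_gt0.
  have B3 : 0 < (4 * rho * L + M) * 2 by rewrite mulr_gt0 // addr_gt0 // !mulr_gt0.
  have B4 : 0 < (rho / 2) ^+ 2 by rewrite exprn_gt0 // divr_gt0.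
  pose k := Num.min (d / (C * L) / 2) (Num.min (e / 2 / L ^+ 2) ((rho / 2) ^+ 2 / ((4 * rho * L + M) * 2))).
  have kk : [/\ k <= d / (C * L) / 2, k <= e / 2 / L ^+ 2 & k <= (rho / 2) ^+ 2 / ((4 * rho * L + M) * 2)].
    by split; rewrite !ge_min lexx ?orbT.
  have [kk1 kk2 kk3] := kk; exists k; split.
  - have p1 : 0 < d / (C * L) / 2 by apply: divr_gt0 => //; exact: divr_gt0.
    have p2 : 0 < e / 2 / L ^+ 2 by apply: divr_gt0 => //; exact: divr_gt0.
    have p3 : 0 < (rho / 2) ^+ 2 / ((4 * rho * L + M) * 2) by exact: divr_gt0.
    by rewrite !lt_min p1 p2 p3.
  - apply: (@le_lt_trans _ _ (d / 2)); last by exact: ltr_half.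
    by move: kk1; rewrite mulrAC ler_pdivlMr // => h; rewrite (mulrC k) mulrA mulrC.
  - by move: kk2; rewrite ler_pdivlMr // mulrC.
  - by move: kk3; rewrite ler_pdivlMr // => h; rewrite mulrA mulrC.
(* Since [L |y|] is at most [L^2 k + |y|^2 / (2 k)], the offset [L ^+ 2 * k] puts the test function
   above [u] at time [a] throughout the tube. *)
pose A t := u (a, eta a) + (Y t - Lam a) + d * (t - a) + L ^+ 2 * k.
pose A' t := Y' t + d.
have HA : c1curve `]-1, T + 1[%classic A A'.
  move=> t It; have [dY cY] := HY t It; split.
    by rewrite /A; apply: is_derive_eq; rewrite /A' /GRing.scale /=; ring.
  by apply: cvgD => //; exact: cvg_cst.
have HP : c1curve `]-1, T + 1[%classic (fun _ => 0 : 'rV[R]_n) (fun _ => 0 : 'rV[R]_n).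
  by move=> t It; split; [exact: is_derive_cst | exact: cvg_cst].
have HN : c1curve `]-1, T + 1[%classic (fun _ => k^-1 : R) (fun _ => 0 : R).
  by move=> t It; split; [exact: is_derive_cst | exact: cvg_cst].
have SA : [set z : R * 'rV[R]_n | a <= z.1 <= b /\ Omega z.2] `<=` `[0, T]%classic `*` Omega.
  by move=> z [/aT zT Oz]; split=> //=; rewrite in_itv.
have tubO t y : a <= t <= b -> `|y| <= rho / 2 -> Omega (X t + y) by move=> *; apply: HO; exact: tubr.
have phiE t y : paraboloid A (fun=> 0) X (fun=> k^-1) (t, X t + y) = A t + k^-1 / 2 * dot y y.
  by rewrite /paraboloid /= (addrC (X t)) addrK dot0l addr0.
have Xsub t (y y' : 'rV[R]_n) : X t + y' - (X t + y) = y' - y by rewrite opprD addrACA subrr add0r.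
have main : u (b, X b + 0) <= paraboloid A (fun=> 0) X (fun=> k^-1) (b, X b + 0).
  apply: (subsolution_compare oOmega a0 ab bT (ltrN10 R) hiT HA HP HX HN (continuous_subspaceW SA
    uc) tubO u_sub (ltW L0)).
  - move=> t y y' tab yr yr'; have tab' := oc t tab.
    have := HL t t (X t + y) (X t + y') (aT t tab') (aT t tab') (abrho t tab') (abrho t tab')
      (tubr t y tab' (ltW yr)) (tubr t y' tab' (ltW yr')).
    by rewrite subrr normr0 add0r Xsub.
  - move=> t y tab yr; rewrite add0r => qL; have tab' := oc t tab.
    have [XEt XEt'] := XE t tab'; have [_ YEt] := YE t tab'.
    have := Hq t tab _ qL; rewrite -XEt -XEt' -YEt => h.
    have rr : `|X t - x0| <= rho by exact: le_trans (Xrho t tab') rho2.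
    have [e1 _ _ _ _] := HE t t (X t) (X t + y) (k^-1 *: y) (k^-1 *: y) (aT t tab') (aT t tab') rr
      (tubr t y tab' (ltW yr)) (le_trans qL Lr) (le_trans qL Lr).
    move: e1; rewrite !subrr !normr0 addr0 add0r addrAC subrr add0r ler_norml => /andP[e1 _].
    (* Only points this close to the curve can be contact points. *)
    have yk : `|y| <= k * L.
      by move: qL; rewrite normrZ gtr0_norm ?invr_gt0 // ler_pdivrMl.
    have e2 : C * `|y| <= C * (k * L) by rewrite ler_pM2l.
    move: h; rewrite /A' !dot0l dotZl => h; clear -h e1 e2 k1; lra.
  - move=> y yr; rewrite phiE /A Ya Xa !subrr mulr0 !addr0.
    have h3 := tubr a y aab yr; rewrite Xa in h3.
    have := HL a a (eta a) (eta a + y) (aT a aab) (aT a aab) aat aat aax h3.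
    rewrite subrr normr0 add0r addrAC subrr add0r ler_norml => /andP[_ h4].
    have h5 : L * `|y| <= L ^+ 2 * k + k^-1 / 2 * `|y| ^+ 2.
      rewrite -subr_ge0.
      have -> : L ^+ 2 * k + k^-1 / 2 * `|y| ^+ 2 - L * `|y| =
          k^-1 / 2 * ((`|y| - k * L) ^+ 2 + (k * L) ^+ 2) by field; rewrite gt_eqF.
      by rewrite mulr_ge0 ?addr_ge0 ?sqr_ge0 // divr_ge0 // invr_ge0 ltW.
    have h6 : k^-1 / 2 * `|y| ^+ 2 <= k^-1 / 2 * dot y y.
      by rewrite ler_pM2l ?sqr_norm_le_dot // divr_gt0 // invr_gt0.
    clear -h4 h5 h6; lra.
  - move=> t y tab yr; rewrite phiE /A.
    have yr' : `|y| <= rho / 2 by rewrite yr.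
    have := HL a t (eta a) (X t + y) (aT a aab) (aT t tab) aat (abrho t tab) aax (tubr t y tab yr').
    rewrite ler_norml => /andP[_ h3].
    have h4 : `|t - a| <= 2 * rho.
      by rewrite mulrDl mul1r; apply: le_trans (ler_distD t0 t a) _; rewrite (distrC t0);
        apply: lerD => //; exact: abrho.
    have h5 : `|X t + y - eta a| <= 2 * rho.
      by rewrite mulrDl mul1r; apply: le_trans (ler_distD x0 (X t + y) (eta a)) _;
        rewrite (distrC x0); apply: lerD => //; exact: tubr.
    have h6 : L * (`|t - a| + `|X t + y - eta a|) <= L * (4 * rho).
      by rewrite ler_pM2l //; clear -h4 h5; lra.
    have := HM t tab; rewrite Ya ler_norml => /andP[h7 _].
    have h8 : 0 <= d * (t - a) by rewrite mulr_ge0 ?(ltW d0) // subr_ge0; case/andP: tab.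
    have h9 : 0 <= L ^+ 2 * k by rewrite mulr_ge0 ?sqr_ge0 // ltW.
    have h10 : 4 * rho * L + M <= k^-1 / 2 * dot y y.
      have : (4 * rho * L + M) * (2 * k) <= dot y y.
        by apply: le_trans k3 _; rewrite -yr; exact: sqr_norm_le_dot.
      have -> : k^-1 / 2 * dot y y = dot y y / (2 * k) by field; rewrite gt_eqF.
      by rewrite ler_pdivlMr ?mulr_gt0.
    clear -h3 h6 h7 h8 h9 h10; lra.
  - by rewrite lexx ltW.
  - by rewrite normr0 divr_ge0 // ltW.
move: main; rewrite phiE dot0l mulr0 addr0 !addr0 Xb /A Yb.
have dE : d * (b - a) = e / 2 by rewrite /d; field; rewrite gt_eqF.
move=> h; clear -h dE k2; lra.
Qed.

(** * Arcs, the action along them, and displaced arcs *)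

Lemma within_continuousP (R : realType) (V : normedModType R) (f : R -> V) (a b : R) :
  (forall t0, a <= t0 <= b -> forall e, 0 < e ->
     exists2 d : R, 0 < d & forall t, a <= t <= b -> `|t - t0| <= d -> `|f t - f t0| <= e) ->
  {within `[a, b], continuous f}.
Proof.
move=> Hf; apply/subspace_continuousP => t0; rewrite /= in_itv /= => t0ab.
apply/cvgrPdist_le => e e0; have [d d0 Hd] := Hf t0 t0ab e e0.
exists d => //= t td; rewrite in_itv /= => tab; rewrite distrC; apply: Hd => //.
by apply: ltW; rewrite distrC.
Qed.

(** The form [C * (3 * d)] is that of the Lipschitz estimates of [box_estimates], when time,
    position and momentum each move by at most [d]. *)
Lemma within_continuous_modulus (R : realType) (V : normedModType R) (f : R -> V) (a b : R) :
  (forall t0, a <= t0 <= b -> exists2 C : R, 0 < C & forall d, 0 < d -> exists2 e : R, 0 < e &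
     forall t, a <= t <= b -> `|t - t0| <= e -> `|f t - f t0| <= C * (3 * d)) ->
  {within `[a, b], continuous f}.
Proof.
move=> Hf; apply: within_continuousP => t0 t0ab e e0; have [C C0 HC] := Hf t0 t0ab.
have d0 : 0 < e / (3 * C) by rewrite divr_gt0 // mulr_gt0.
have [d dd0 Hd] := HC _ d0; exists d => // t tab td.
have -> : e = C * (3 * (e / (3 * C))) by field; rewrite gt_eqF.
exact: Hd.
Qed.

Lemma within_add (R : realType) (V : normedModType R) (f g : R -> V) (A : set R) :
  {within A, continuous f} -> {within A, continuous g} -> {within A, continuous (fun t => f t + g t)}.
Proof. by move=> fc gc t; apply: cvgD; [exact: fc | exact: gc]. Qed.

Lemma within_dot (R : realType) n (f g : R -> 'rV[R]_n) (A : set R) :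
  {within A, continuous f} -> {within A, continuous g} -> {within A, continuous (fun t => dot (f t) (g t))}.
Proof.
move=> fc gc; apply/subspace_continuousP => t At; apply: cvg_sum_ord => i; apply: cvgM.
  by have /subspace_continuousP := continuous_within_coord (i := i) fc; apply.
by have /subspace_continuousP := continuous_within_coord (i := i) gc; apply.
Qed.

(* [g] is the value of [u] transported along [xi] when [p] is the gradient of [u] there. *)
Definition action_arc (R : realType) n (H : R * 'rV[R]_n * 'rV[R]_n -> R) (a b : R)
    (xi p : R -> 'rV[R]_n) (g : R -> R) : Prop :=
  [/\ {within `[a, b], continuous xi}, {within `[a, b], continuous p}, {within `[a, b], continuous g},
      forall t, a < t < b -> is_derive t 1 xi (DpH H t (xi t) (p t))
    & forall t, a < t < b -> is_derive t 1 g (dot (p t) (DpH H t (xi t) (p t)) - H (t, xi t, p t))].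

(** Kept apart from [action_arc]: in (i) both are given by the Hamiltonian system, whereas in (ii)
    the arc is known beforehand and this equation is a conclusion. *)
Definition momentum_eq (R : realType) n (H : R * 'rV[R]_n * 'rV[R]_n -> R) (a b : R)
    (xi p : R -> 'rV[R]_n) : Prop :=
  forall t, a < t < b -> is_derive t 1 p (- DxH H t (xi t) (p t)).

Lemma itv_oo_W (R : realType) (a b a' b' t : R) : a <= a' -> b' <= b -> a' < t < b' -> a < t < b.
Proof. by move=> aa bb /andP[h1 h2]; rewrite (le_lt_trans aa h1) (lt_le_trans h2 bb). Qed.

Lemma action_arc_W (R : realType) n (H : R * 'rV[R]_n * 'rV[R]_n -> R) (a b a' b' : R)
    (xi p : R -> 'rV[R]_n) (g : R -> R) :
  a <= a' -> b' <= b -> action_arc H a b xi p g -> action_arc H a' b' xi p g.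
Proof.
move=> aa bb [xc pc gc xd gd].
split; [exact: within_itv_W xc | exact: within_itv_W pc | exact: within_itv_W gc
  | move=> t tt; exact/xd/(itv_oo_W aa bb) | move=> t tt; exact/gd/(itv_oo_W aa bb)].
Qed.

Lemma momentum_eq_W (R : realType) n (H : R * 'rV[R]_n * 'rV[R]_n -> R) (a b a' b' : R)
    (xi p : R -> 'rV[R]_n) :
  a <= a' -> b' <= b -> momentum_eq H a b xi p -> momentum_eq H a' b' xi p.
Proof. by move=> aa bb pd t tt; exact/pd/(itv_oo_W aa bb). Qed.

Section Characteristics.
Variables (R : realType) (n : nat).
Local Notation E := 'rV[R]_n.
Variables (Omega : set E) (T : R) (H : R * E * E -> R) (u : R * E -> R).
Hypotheses (hyp : standing Omega T H u).

Lemma H_comp_within (a b : R) (xi p : R -> E) : 0 <= a -> b <= T ->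
  {within `[a, b], continuous xi} -> {within `[a, b], continuous p} ->
  (forall t, a <= t <= b -> Omega (xi t)) ->
  [/\ {within `[a, b], continuous (fun t => H (t, xi t, p t))},
      {within `[a, b], continuous (fun t => DxH H t (xi t) (p t))}
    & {within `[a, b], continuous (fun t => DpH H t (xi t) (p t))}].
Proof.
move=> a0 bT xc pc xO.
have abT t : a <= t <= b -> 0 <= t <= T.
  by move=> /andP[h1 h2]; rewrite (le_trans a0 h1) (le_trans h2 bT).
have K t0 : a <= t0 <= b -> exists2 C : R, 0 < C & forall d, 0 < d -> exists2 e : R, 0 < e &
    forall t, a <= t <= b -> `|t - t0| <= e ->
    [/\ `|H (t, xi t, p t) - H (t0, xi t0, p t0)| <= C * (3 * d),
        `|DxH H t (xi t) (p t) - DxH H t0 (xi t0) (p t0)| <= C * (3 * d)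
      & `|DpH H t (xi t) (p t) - DpH H t0 (xi t0) (p t0)| <= C * (3 * d)].
  move=> t0ab; have t0T : 0 <= t0 <= T by exact: abT.
  have [rho [L [r [C [th [[[rho0 L0 Lr C0 th0] [HO HE HL]] pr]]]]]] :=
    local_setting_ex (`|p t0| + 1) hyp t0T (xO t0 t0ab).
  exists C => // d d0.
  have m1 : 0 < Num.min d rho by rewrite lt_min d0.
  have m2 : 0 < Num.min d 1 by rewrite lt_min d0 ltr01.
  have [e1 e10 He1] := within_small xc t0ab m1.
  have [e2 e20 He2] := within_small pc t0ab m2.
  exists (Num.min d (Num.min e1 e2)) => [|t tab]; first by rewrite !lt_min d0 e10 e20.
  rewrite !le_min => /and3P[td te1 te2].
  have := He1 t tab te1; rewrite le_min => /andP[xd xr].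
  have := He2 t tab te2; rewrite le_min => /andP[pd p1].
  have tT := abT t tab.
  have x0 : `|xi t0 - xi t0| <= rho by rewrite subrr normr0 ltW.
  have p0r : `|p t0| <= r by apply: le_trans pr; rewrite lerDl.
  have ptr := norm_le_dist pr p1.
  have [h1 h2 h3 _ _] := HE t0 t (xi t0) (xi t) (p t0) (p t) t0T tT x0 xr p0r ptr.
  have B : C * (`|t - t0| + `|xi t - xi t0| + `|p t - p t0|) <= C * (3 * d).
    have -> : 3 * d = d + d + d by ring.
    by rewrite ler_pM2l // !lerD.
  by split; [exact: (le_trans h1 B) | exact: (le_trans h2 B) | exact: (le_trans h3 B)].
split; apply: within_continuous_modulus => t0 t0ab; have [C C0 HC] := K t0 t0ab; exists C => // d d0;
  have [e e0 He] := HC d d0; exists e => // t tab te; have [h1 h2 h3] := He t tab te.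
- exact: h1.
- exact: h2.
- exact: h3.
Qed.

Section Local.
Variables (t0 : R) (x0 : E) (rho L r C th : R).
Hypothesis loc : local_setting Omega T H u t0 x0 rho L r C th.
Hypothesis u_sub : viscosity_subsolution Omega T H u.

(** [curve_bound] for the curve [xi + h] and the function [g + S]. The lower expansion of [H] at [p]
    bounds [<q, xi' + h'> - H(t, xi + h, q)] by [g' + <q, h'> - <D_x H, h> - th |q - p|^2 + C
    |h|^2]. Writing [q = p + (q - p)] in [<q, h'>], Young's inequality spends the whole
    [th |q - p|^2] and leaves [|h'|^2 / (4 th)], so the bound is uniform in [q]. When
    [p' = - D_x H], the first two terms required of [S'] are the derivative of [<p, h>]. *)
Lemma char_bound (a b : R) (xi p h h' : R -> E) (g S S' : R -> R) :
  0 <= a -> a < b -> b <= T -> (forall t, a <= t <= b -> `|t - t0| <= rho) ->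
  action_arc H a b xi p g ->
  (forall t, a <= t <= b -> `|xi t - x0| <= rho) -> (forall t, a <= t <= b -> `|p t| <= r) ->
  {within `[a, b], continuous h} -> {within `[a, b], continuous h'} ->
  (forall t, a < t < b -> is_derive t 1 h (h' t)) ->
  {within `[a, b], continuous S} -> {within `[a, b], continuous S'} ->
  (forall t, a < t < b -> is_derive t 1 S (S' t)) ->
  (forall t, a <= t <= b -> `|xi t + h t - x0| <= rho / 2) ->
  (forall t, a < t < b -> dot (p t) (h' t) - dot (DxH H t (xi t) (p t)) (h t)
     + dot (h' t) (h' t) / (4 * th) + C * dot (h t) (h t) <= S' t) ->
  u (b, xi b + h b) - u (a, xi a + h a) <= g b + S b - (g a + S a).
Proof.
move=> a0 ab bT abrho [xc pc gc xd gd] xrho pr hc hc' hd Sc Sc' Sd xhrho HS.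
have [[rho0 L0 Lr C0 th0] [HO HE HL]] := loc.
have xO t : a <= t <= b -> Omega (xi t) by move=> tab; apply: HO; exact: xrho.
have [cH cHx cHp] := H_comp_within a0 bT xc pc xO.
have cg' : {within `[a, b], continuous (fun t => dot (p t) (DpH H t (xi t) (p t)) - H (t, xi t, p t))}.
  by move=> t; apply: cvgB; [exact: (within_dot pc cHp) | exact: cH].
have [oOmega _ _ u_lip] := hyp.
apply: (curve_bound oOmega u_sub (u_within oOmega u_lip) loc a0 ab bT abrho (within_add xc hc)
  (within_add cHp hc')
  (within_add gc Sc) (within_add cg' Sc') _ _ xhrho).
- by move=> t tab; apply: is_deriveD; [exact: xd | exact: hd].
- by move=> t tab; apply: is_deriveD; [exact: gd | exact: Sd].
move=> t tab q qL; have tab' : a <= t <= b by case/andP: tab => ? ?; rewrite !ltW.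
have tT : 0 <= t <= T by case/andP: tab' => h1 h2; rewrite (le_trans a0 h1) (le_trans h2 bT).
have xhr : `|xi t + h t - x0| <= rho by apply: le_trans (xhrho t tab') _; exact: ler_divSn (ltW rho0).
have [_ _ _ _] := HE t t (xi t) (xi t + h t) (p t) q tT tT (xrho t tab') xhr (pr t tab') (le_trans qL Lr).
have -> : xi t + h t - xi t = h t by rewrite addrC addKr.
have th4 : 0 < 4 * th by rewrite mulr_gt0.
have := HS t tab; have := dot_young (q - p t) (h' t) th0.
move: (dot (q - p t) (q - p t)) => w.
rewrite (dotDl q (- p t) (h' t)) dotNl.
rewrite (dotDr q (- p t) (DpH H t (xi t) (p t))) dotNr (dotDr (DpH H t (xi t) (p t)) (h' t) q).
rewrite (dotC (DpH H t (xi t) (p t)) q) (dotC (DpH H t (xi t) (p t)) (p t)).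
lra.
Qed.

End Local.
End Characteristics.

(** * Propagation of the proximal inequality *)

(** [N] is minus the curvature and [N'] the derivative of the curvature. Along the Hamiltonian
    system the terms of order 0 and 1 in [y] cancel, and what remains is at most
    [- d + (N' / 2 + C (1 + N^2)) |y|^2]. *)
Lemma slope_lt0 (R : realType) n (C M N' N d : R) (p hx hp y : 'rV[R]_n) (h0 h1 : R) :
  0 < C -> 0 <= M -> N <= M -> 0 <= N -> N' <= - (2 * (C * (1 + M ^+ 2))) -> 0 < d ->
  h1 <= h0 + dot hx y + dot hp (- N *: y) + C * (dot y y + dot (- N *: y) (- N *: y)) ->
  (dot p hp - h0 - d) + dot (- hx) y - dot p hp + N' / 2 * dot y y - (- N) * dot y hp + h1 < 0.
Proof.
move=> C0 M0 NM N0 N'le d0; rewrite dotNl !dotZr !dotZl (dotC y hp).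
have D0 := dot_ge0 y; move: (dot y y) D0 => D D0.
have N2 : N * N <= M ^+ 2 by rewrite expr2 ler_pM.
have h2 : C * (D + - N * (- N * D)) <= C * (1 + M ^+ 2) * D.
  rewrite -mulrA ler_pM2l // mulrDl mul1r lerD2l mulrA mulrNN.
  by rewrite ler_wpM2r.
have h3 : N' / 2 * D <= - (C * (1 + M ^+ 2) * D).
  by rewrite -mulNr ler_wpM2r //; lra.
move: (dot p hp) (dot hx y) (dot hp y) (C * (1 + M ^+ 2) * D) (N' / 2 * D) h2 h3 => a b c e f h2 h3 h4.
lra.
Qed.

Lemma lower_bound (R : realType) n (Omega : set 'rV[R]_n) (T : R) (H : R * 'rV[R]_n * 'rV[R]_n -> R)
    (u : R * 'rV[R]_n -> R) (y0 : 'rV[R]_n) (rho L r C th tau : R) (xi p : R -> 'rV[R]_n)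
    (g : R -> R) (K rho' : R) :
  standing Omega T H u ->
  local_setting Omega T H u 0 y0 rho L r C th ->
  viscosity_supersolution Omega T H u ->
  0 < tau <= T -> xi 0 = y0 -> `|p 0| + 2 <= r ->
  action_arc H 0 tau xi p g -> momentum_eq H 0 tau xi p ->
  (forall t, 0 <= t <= tau -> Omega (xi t)) ->
  g 0 = u (0, y0) -> 0 < K -> 0 < rho' ->
  (forall x, `|x - y0| <= rho' ->
     u (0, y0) + dot (p 0) (x - y0) - K / 2 * dot (x - y0) (x - y0) <= u (0, x)) ->
  exists t1 r1 M : R, [/\ 0 < t1 <= tau, 0 < r1, 0 < M & forall t y, 0 <= t <= t1 -> `|y| <= r1 ->
    g t + dot (p t) y - M / 2 * dot y y <= u (t, xi t + y)].
Proof.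
move=> hyp loc u_sup /andP[tau0 tauT] xi0 pr [xc pc gc xd gd] pd xO g0 K0 rho'0 Hu0.
have [oOmega _ _ u_lip] := hyp; have [[rho0 L0 Lr C0 th0] [HO HE HL]] := loc.
(* Minus the curvature of the test function will be [K + 1 + Lam * t]: the 1 added to [K] is the
   margin on the sides of the tube, and [Lam * t <= 1] keeps the whole below [M]. *)
pose M := K + 2.
have M0 : 0 < M by rewrite /M; lra.
(* The three bounds keep the tube in the box, keep it where the proximal inequality is valid, and
   keep the test gradient within distance 1 of [p t]. *)
pose r1 := Num.min (rho / 2) (Num.min rho' M^-1).
have r10 : 0 < r1 by rewrite !lt_min rho'0 invr_gt0 M0 divr_gt0.
have [r1a r1b r1c] : [/\ r1 <= rho / 2, r1 <= rho' & r1 <= M^-1].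
  by split; rewrite !ge_min lexx ?orbT.
(* The rate demanded by [slope_lt0]. *)
pose Lam := 2 * (C * (1 + M ^+ 2)).
have Lam0 : 0 < Lam by rewrite mulr_gt0 // mulr_gt0 // ltr_wpDr ?sqr_ge0.
(* On the sides, the margin [|y|^2 / 2] is at least [4 * e]. It pays for four errors of size at most
   [e]: [L * t], [L] times the displacement of [xi], the variation of [p] tested on [y], and the
   variation of [g]. *)
pose e := r1 ^+ 2 / 8.
have e0 : 0 < e by rewrite divr_gt0 // exprn_gt0.
have eL0 : 0 < e / L by exact: divr_gt0.
have m1 : 0 < Num.min (rho / 2) (e / L) by rewrite lt_min eL0 divr_gt0.
have rn0 : 0 < r1 * n.+1%:R by apply: mulr_gt0 => //; exact: ltr0Sn.
have m2 : 0 < Num.min 1 (e / (r1 * n.+1%:R)) by rewrite lt_min ltr01 /=; exact: divr_gt0.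
have t00 : 0 <= (0 : R) <= tau by rewrite lexx ltW.
have [d1 d10 Hd1] := within_small xc t00 m1.
have [d2 d20 Hd2] := within_small pc t00 m2.
have [d3 d30 Hd3] := within_small gc t00 e0.
pose t1 := Num.min tau (Num.min rho (Num.min Lam^-1 (Num.min (e / L) (Num.min d1 (Num.min d2 d3))))).
have t10 : 0 < t1 by rewrite !lt_min tau0 rho0 invr_gt0 Lam0 d10 d20 d30 eL0.
have [ta tb tc] : [/\ t1 <= tau, t1 <= rho & t1 <= Lam^-1] by split; rewrite !ge_min lexx ?orbT.
have [td te tf tg] : [/\ t1 <= e / L, t1 <= d1, t1 <= d2 & t1 <= d3] by split; rewrite !ge_min lexx ?orbT.
have small t : 0 <= t <= t1 -> [/\ 0 <= t <= tau, 0 <= t <= T & `|t - 0| <= t1].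
  by move=> /andP[t0 tt1]; rewrite subr0 ger0_norm // t0 (le_trans tt1 ta) (le_trans (le_trans tt1
    ta) tauT).
have xs t : 0 <= t <= t1 -> `|xi t - y0| <= rho / 2 /\ L * `|xi t - y0| <= e.
  move=> /small[tt _ tn]; have := Hd1 t tt (le_trans tn te);
    rewrite xi0 le_min (ler_pdivlMr _ _ L0) => /andP[h1 h2].
  by split=> //; rewrite mulrC.
have ps t : 0 <= t <= t1 -> `|p t - p 0| <= 1 /\ `|p t - p 0| * (r1 * n.+1%:R) <= e.
  by move=> /small[tt _ tn]; have := Hd2 t tt (le_trans tn tf);
    rewrite le_min (ler_pdivlMr _ _ rn0) => /andP[].
have gs t : 0 <= t <= t1 -> `|g t - g 0| <= e.
  by move=> /small[tt _ tn]; exact: Hd3 t tt (le_trans tn tg).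
have Lt t : 0 <= t <= t1 -> L * t <= e.
  by move=> /andP[_ tt1]; rewrite mulrC -ler_pdivlMr //; exact: le_trans tt1 td.
have xc1 := within_itv_W (lexx 0) ta xc; have pc1 := within_itv_W (lexx 0) ta pc.
have gc1 := within_itv_W (lexx 0) ta gc.
have t1T : t1 <= T := le_trans ta tauT.
have xO1 t : 0 <= t <= t1 -> Omega (xi t) by move=> /small[tt _ _]; exact: xO.
have inn t : 0 < t < t1 -> 0 < t < tau by move=> /andP[-> h]; exact: lt_le_trans h ta.
have [cH cHx cHp] := H_comp_within hyp (lexx 0) t1T xc1 pc1 xO1.
have cHx' : {within `[0, t1], continuous (fun t => - DxH H t (xi t) (p t))}.
  by move=> t; apply: cvgN; exact: cHx.
have cg' : {within `[0, t1], continuous (fun t => dot (p t) (DpH H t (xi t) (p t)) - H (t, xi t, p t))}.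
  by move=> t; apply: cvgB; [exact: (within_dot pc1 cHp) | exact: cH].
have hiT : T < T + 1 by rewrite ltrDl.
have bhi := le_lt_trans t1T hiT.
have [X [X' [HX XE]]] := c1_extend_rV (ltrN10 R) t10 bhi xc1 cHp (fun t tt => xd t (inn t tt)).
have [P [P' [HP PE]]] := c1_extend_rV (ltrN10 R) t10 bhi pc1 cHx' (fun t tt => pd t (inn t tt)).
have [G [G' [HG GE]]] := c1_extend (ltrN10 R) t10 bhi gc1 cg' (fun t tt => gd t (inn t tt)).
exists t1, r1, M; split=> //; first by rewrite t10.
move=> t2 y2 t2t1 y2r; apply/ler_addgt0Pr => d d0.
(* This decrease in time makes the subsolution strict; it costs at most [d] on [[0, t1]], and [d] is
   arbitrary. *)
pose dl := d / t1.
have dl0 : 0 < dl by rewrite divr_gt0.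
pose A t := G t - dl * t; pose A' t := G' t - dl.
pose N t := - (K + 1 + Lam * t).
have HA : c1curve `]-1, T + 1[%classic A A'.
  move=> t It; have [dG cG] := HG t It; split.
    by rewrite /A; apply: is_derive_eq; rewrite /A' /GRing.scale /=; ring.
  by apply: cvgB => //; exact: cvg_cst.
have HN : c1curve `]-1, T + 1[%classic N (fun=> - Lam).
  move=> t It; split; last exact: cvg_cst.
  by rewrite /N; apply: is_derive_eq; rewrite /GRing.scale /=; ring.
have SA : [set z : R * 'rV[R]_n | 0 <= z.1 <= t1 /\ Omega z.2] `<=` `[0, T]%classic `*` Omega.
  by move=> z [/small[_ zT _] Oz]; split=> //=; rewrite in_itv.
have tubr t y : 0 <= t <= t1 -> `|y| <= r1 -> `|X t + y - y0| <= rho.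
  move=> tt yr; have [-> _] := XE t tt; rewrite addrAC; apply: le_trans (ler_normD _ _) _.
  by have [h _] := xs t tt; rewrite (splitr rho) lerD // (le_trans yr).
have tubO t y : 0 <= t <= t1 -> `|y| <= r1 -> Omega (X t + y) by move=> *; apply: HO; exact: tubr.
have Nb t : 0 <= t <= t1 -> [/\ K + 1 <= - N t, 0 <= - N t & - N t <= M].
  move=> /andP[t0 tt1]; rewrite /N opprK /M.
  have h1 : 0 <= Lam * t by rewrite mulr_ge0 // ltW.
  have h2 : Lam * t <= 1 by rewrite mulrC -ler_pdivlMr // div1r (le_trans tt1).
  by clear -K0 h1 h2; split; lra.
have Xsub t (y : 'rV[R]_n) : X t + y - X t = y by rewrite addrC addKr.
have phiE t y : paraboloid A P X N (t, X t + y) = A t + dot (P t) y + N t / 2 * dot y y.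
  by rewrite /paraboloid /= Xsub.
have main : paraboloid A P X N (t2, X t2 + y2) <= u (t2, X t2 + y2).
  apply: (supersolution_compare oOmega (lexx 0) t10 t1T (ltrN10 R) hiT HA HP HX HN
    (continuous_subspaceW SA (u_within oOmega u_lip)) tubO u_sup) => //.
  - move=> t y tt yr; have tt' : 0 <= t <= t1 by case/andP: tt => ? ?; rewrite !ltW.
    have [_ tT _] := small t tt'.
    have [_ N0 NM] := Nb t tt'; have [p1 _] := ps t tt'; have [xr _] := xs t tt'.
    have tub := tubr t y tt' (ltW yr).
    have [Xt X't] := XE t tt'; have [Pt P't] := PE t tt'; have [_ G't] := GE t tt'.
    have pn : `|p t| <= `|p 0| + 1 by exact: norm_le_dist p1.
    have pr1 : `|p t| <= r by apply: le_trans pn (le_trans _ pr); rewrite lerD2l ler1n.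
    have qn : `|p t + N t *: y| <= r.
      apply: le_trans (ler_normD _ _) _; apply: le_trans pr; rewrite [2](_ : _ = 1 + 1) // addrA;
        apply: lerD => //.
      rewrite normrZ -(normrN (N t)) (ger0_norm N0).
      apply: (@le_trans _ _ (M * M^-1)); last by rewrite divff ?gt_eqF.
      exact: (ler_pM N0 (normr_ge0 y) NM (le_trans (ltW yr) r1c)).
    have xr' : `|xi t - y0| <= rho by apply: le_trans xr _; exact: ler_divSn (ltW rho0).
    rewrite Xt in tub.
    have [_ _ _ e1 _] := HE t t (xi t) (xi t + y) (p t) (p t + N t *: y) tT tT xr' tub pr1 qn.
    rewrite /A' G't X't P't Xt Pt; rewrite -[N t]opprK.
    apply: (slope_lt0 _ C0 (ltW M0) NM N0 _ dl0) => //.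
    by move: e1; rewrite opprK ![_ + y - _]addrC ![_ + N t *: y - _]addrC !addKr.
  - move=> y yr; have t0t1 : 0 <= (0 : R) <= t1 by rewrite lexx ltW.
    have [X0 _] := XE 0 t0t1; have [P0 _] := PE 0 t0t1; have [G0 _] := GE 0 t0t1.
    rewrite phiE /A /N X0 P0 G0 xi0 g0.
    have := Hu0 (y0 + y); rewrite addrC addKr => /(_ (le_trans yr r1b)).
    have := dot_ge0 y; rewrite !mulr0.
    move: (dot y y) (dot (p 0) y) (u (0, y0)) (u (0, y0 + y)); clear => *; lra.
  - move=> t y tt yr; rewrite phiE /A.
    have [_ tT _] := small t tt.
    have [Xt X't] := XE t tt; have [Pt P't] := PE t tt; have [Gt _] := GE t tt.
    have [NK _ _] := Nb t tt; have [_ p1] := ps t tt; have [xr xl] := xs t tt.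
    have yr' : `|y| <= r1 by rewrite yr.
    have h1 := Hu0 (y0 + y); rewrite [y0 + y - y0]addrC addKr in h1.
    have {h1} h1 := h1 (le_trans yr' r1b).
    have r0y : `|y0 + y - y0| <= rho.
      by rewrite [y0 + y - y0]addrC addKr; apply: le_trans yr' (le_trans r1a _);
        exact: ler_divSn (ltW rho0).
    have n0 : `|0 - 0 : R| <= rho by rewrite subrr normr0 ltW.
    have t0T : 0 <= (0 : R) <= T by rewrite lexx (le_trans (ltW t10)).
    have tn : `|t - 0| <= rho by case: (small t tt) => _ _ h; exact: le_trans h tb.
    have := HL 0 t (y0 + y) (X t + y) t0T tT n0 tn r0y (tubr t y tt yr').
    rewrite Xt opprD addrACA subrr addr0 subr0 (ger0_norm (proj1 (andP tt))) mulrDr ler_norml =>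
      /andP[h2 _].
    have h3 := Lt t tt.
    have h4 : dot (p t - p 0) y <= e.
      apply: le_trans (dot_le_norm _ _) _; apply: le_trans p1;
        rewrite yr mulrCA ler_wpM2l // mulrC ler_wpM2l ?(ltW r10) //.
      by rewrite ler_nat.
    have h5 := gs t tt; rewrite g0 ler_norml in h5; have /andP[_ h6] := h5.
    have h7 : r1 ^+ 2 <= dot y y by rewrite -yr; exact: sqr_norm_le_dot.
    have h8 : N t / 2 * dot y y <= - ((K + 1) / 2 * dot y y).
      by rewrite -mulNr ler_wpM2r ?dot_ge0 //; clear -NK; lra.
    have h9 : 0 <= dl * t by rewrite mulr_ge0 ?(ltW dl0) //; case/andP: tt.
    rewrite dotDl dotNl in h4; rewrite Gt Pt.
    have h10 : e = r1 ^+ 2 / 8 by [].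
    move: (dot y y) (dot (p t) y) (dot (p 0) y) (u (t, _)) (u (0, y0 + y)) (u (0, y0)) (g t) (N t /
      2 * _) (dl * t) (L * t) (L * _) (r1 ^+ 2) h1 h2 h3 h4 h6 h7 h8 h9 xl h10; clear; move=> *; lra.
move: main; rewrite phiE /A /dl.
have [Xt X't] := XE t2 t2t1; have [Pt P't] := PE t2 t2t1; have [Gt _] := GE t2 t2t1.
rewrite Xt Pt Gt.
have h1 : d / t1 * t2 <= d.
  by rewrite mulrAC ler_pdivrMr // ler_pM2l //; case/andP: t2t1.
have [_ _ NM] := Nb t2 t2t1.
have h2 : - (M / 2 * dot y2 y2) <= N t2 / 2 * dot y2 y2.
  by rewrite -mulNr ler_wpM2r ?dot_ge0 //; clear -NM; lra.
move: (d / t1 * t2) (M / 2 * _) (N t2 / 2 * _) h1 h2 (dot _ _) (g t2) (u _); clear; move=> *; lra.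
Qed.

(** * The equation at points of differentiability *)

(** Differentiability at [(t1, x1)] with time derivative [a1] and space gradient [q]. The free
    radius [m] stands for the norm of the increment and may be any larger number up to [d], so the
    error is uniform on a cylinder. *)
Definition first_order (R : realType) n (u : R * 'rV[R]_n ->
R) (t1 : R) (x1 : 'rV[R]_n) (a1 : R) (q : 'rV[R]_n) :=
  forall e, 0 < e -> exists2 d : R, 0 < d & forall m t y, m <= d -> `|t - t1| <= m -> `|y| <= m ->
    `|u (t, x1 + y) - u (t1, x1) - a1 * (t - t1) - dot q y| <= e * m.

Lemma Dx_coord (R : realType) n (f : R * 'rV[R]_n -> R) (t : R) (x : 'rV[R]_n) i :
  differentiable f (t, x) -> Dx f t x 0 i = 'd f (t, x) (0, 'e_i).
Proof.
move=> df; rewrite mxE.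
have d0 : is_diff x (fun y : 'rV[R]_n => (t, y)) (fun v : 'rV[R]_n => (0, v)).
  exact: (@is_diff_pair _ 'rV[R]_n R 'rV[R]_n (cst t) (cst 0) id id).
have d2 : is_diff (t, x) f ('d f (t, x)) by [].
by have [_ ->] := is_diff_is_derive 'e_i (is_diff_comp d0 d2).
Qed.

Lemma differentiable_first_order (R : realType) n (u : R * 'rV[R]_n -> R) (t1 : R) (x1 : 'rV[R]_n) :
  differentiable u (t1, x1) ->
  first_order u t1 x1 ('d u (t1, x1) (1, 0)) (Dx u t1 x1) /\
  forall t' (y : 'rV[R]_n), 'd u (t1, x1) (t', y) = 'd u (t1, x1) (1, 0) * t' + dot (Dx u t1 x1) y.
Proof.
move=> du.
have dE t' (y : 'rV[R]_n) : 'd u (t1, x1) (t', y) = 'd u (t1, x1) (1, 0) * t' + dot (Dx u t1 x1) y.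
  have -> : (t', y) = t' *: ((1, 0) : R * 'rV[R]_n) + \sum_(i < n) y 0 i *: ((0, 'e_i) : R * 'rV[R]_n).
    have -> : \sum_(i < n) y 0 i *: ((0, 'e_i) : R * 'rV[R]_n) = (0, y).
      rewrite {2}(row_delta_sum y).
      rewrite (big_morph (fun y : 'rV[R]_n => ((0, y) : R * 'rV[R]_n)) (id1 := 0) (op1 := +%R)) //;
        last first.
        by move=> a b; congr (_, _); rewrite ?addr0.
      by apply: eq_bigr => i _; congr (_, _); rewrite ?scaler0.
    by congr (_, _); rewrite /= ?scaler0 ?add0r // /GRing.scale /= mulr1 addr0.
  rewrite linearD linearZ /= mulrC; congr (_ + _).
  rewrite linear_sum; apply: eq_bigr => i _; rewrite linearZ /= mulrC; congr (_ * _).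
  by rewrite Dx_coord.
split=> // e e0.
have /landau.eqaddoP/(_ e e0) := diff_locally du.
move=> /nbhs_ballP[d /= d0 Hd]; exists (d / 2) => [|m t y md tm ym]; first by rewrite divr_gt0.
have md' : m < d by apply: le_lt_trans md _; exact: ltr_half.
have B : ball (0 : R * 'rV[R]_n) d (t - t1, y).
  by split; rewrite -ball_normE /= sub0r normrN; [exact: le_lt_trans tm md' | exact: le_lt_trans ym md'].
have E1 : ((t - t1, y) : R * 'rV[R]_n) + (t1, x1) = (t, x1 + y).
  by congr (_, _); rewrite /= ?subrK // addrC.
have h : `|u ((t - t1, y) + (t1, x1)) - (u (t1, x1) + 'd u (t1, x1) (t - t1, y))| <= e * `|((t -
  t1, y) : R * 'rV[R]_n)|.
  exact: (Hd _ B).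
rewrite E1 in h.
rewrite dE in h.
have -> : u (t, x1 + y) - u (t1, x1) - 'd u (t1, x1) (1, 0) * (t - t1) - dot (Dx u t1 x1) y =
   u (t, x1 + y) - (u (t1, x1) + ('d u (t1, x1) (1, 0) * (t - t1) + dot (Dx u t1 x1) y)) by ring.
apply: le_trans h _; rewrite ler_pM2l // prod_normE /= ge_max; exact/andP.
Qed.

(** Prepares a paraboloid of curvature [N] or [- N], shifted by [e * d] at the centre, on a backward
    cylinder of size [d]. With [N * d = 4 * e] the quadratic part is at least [2 * e * d] on the
    bottom and the sides, which covers the shift and the error of the expansion, while the gradient
    and the time slope move by at most [4 * e]. The variable [k] stands for either sign of the
    curvature. *)
Lemma perturbation_box (R : realType) n (Omega : set 'rV[R]_n) (T : R)
    (H : R * 'rV[R]_n * 'rV[R]_n -> R) (u : R * 'rV[R]_n -> R)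
    (t1 : R) (x1 q : 'rV[R]_n) (a1 c : R) :
  standing Omega T H u -> 0 < t1 < T -> Omega x1 -> first_order u t1 x1 a1 q -> 0 < c ->
  exists d N e L : R, [/\ 0 < d, 0 <= t1 - d, 0 < N, 0 < e & N * d = 4 * e] /\
   [/\ 0 <= L, forall y, `|y| <= d -> Omega (x1 + y),
      forall t y y', t1 - d <= t <= t1 -> `|y| <= d -> `|y'| <= d ->
         `|u (t, x1 + y') - u (t, x1 + y)| <= L * `|y' - y|,
      forall t y, t1 - d <= t <= t1 -> `|y| <= d ->
         `|u (t, x1 + y) - u (t1, x1) - a1 * (t - t1) - dot q y| <= e * d
     & forall t y k, t1 - d <= t <= t1 -> `|y| <= d -> `|k| = N ->
         `|k * (t - t1)| + `|H (t, x1 + y, q + k *: y) - H (t1, x1, q)| < c].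
Proof.
move=> hyp /andP[t10 t1T] Ox1 fo c0.
have t1T' : 0 <= t1 <= T by rewrite !ltW.
have [rho [L [r [C [th [loc qr]]]]]] := local_setting_ex (`|q| + 1) hyp t1T' Ox1.
have [[rho0 L0 Lr C0 th0] [HO HE HL]] := loc.
have C1 : 0 < 16 * (1 + C) by rewrite mulr_gt0 // addr_gt0.
have C2 : 0 < 8 * C by rewrite mulr_gt0.
(* The bound [4^-1] keeps the momenta within distance 1 of [q]; the other one, with the bound
   [c / (8 * C)] on [d], makes the total perturbation at most [c / 2]. *)
pose e := Num.min 4^-1 (c / (16 * (1 + C))).
have ec0 : 0 < c / (16 * (1 + C)) by rewrite divr_gt0.
have dc0 : 0 < c / (8 * C) by rewrite divr_gt0.
have e0 : 0 < e by rewrite lt_min ec0 invr_gt0 andbT.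
have [e1 e2] : e <= 4^-1 /\ e <= c / (16 * (1 + C)) by rewrite !ge_min !lexx orbT.
have [d1 d10 Hd1] := fo e e0.
pose d := Num.min t1 (Num.min rho (Num.min d1 (c / (8 * C)))).
have d0 : 0 < d by rewrite !lt_min t10 rho0 d10 dc0.
have [da db dc dd] : [/\ d <= t1, d <= rho, d <= d1 & d <= c / (8 * C)].
  by split; rewrite !ge_min lexx ?orbT.
have Nd : 4 * e / d * d = 4 * e by rewrite divfK // gt_eqF.
have N0 : 0 < 4 * e / d by rewrite divr_gt0 // mulr_gt0.
have tdT t : t1 - d <= t <= t1 -> `|t - t1| <= d /\ 0 <= t <= T.
  move=> /andP[h1 h2]; split; first by rewrite ler0_norm ?subr_le0 // opprB lerBlDl -lerBlDr.
  by rewrite (le_trans h2 (ltW t1T)) andbT; apply: le_trans h1; rewrite subr_ge0.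
have tubr (y : 'rV[R]_n) : `|y| <= d -> `|x1 + y - x1| <= rho.
  by move=> yd; rewrite addrAC subrr add0r (le_trans yd).
exists d, (4 * e / d), e, L; split; first by split; rewrite ?subr_ge0.
split=> [|y yd|t y y' /tdT[td tT] yd yd'|t y /tdT[td _] yd|t y k /tdT[td tT] yd kN].
- exact: ltW.
- by apply: HO; exact: tubr.
- have tr := le_trans td db.
  have := HL t t (x1 + y) (x1 + y') tT tT tr tr (tubr y yd) (tubr y' yd').
  by rewrite subrr normr0 add0r opprD addrACA subrr add0r.
- exact: (Hd1 d t y).
have kd (x : R) : 0 <= x -> x <= d -> `|k| * x <= 4 * e.
  move=> x0 xd; rewrite kN; apply: (@le_trans _ _ (4 * e / d * d)); last by rewrite Nd.
  by rewrite ler_pM2l.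
have qr' : `|q| <= r by apply: le_trans qr; rewrite lerDl.
have qkr : `|q + k *: y| <= r.
  apply: le_trans (ler_normD _ _) _; apply: le_trans qr; rewrite lerD2l normrZ.
  apply: le_trans (kd _ (normr_ge0 y) yd) _.
  by move: e1; rewrite -(ler_pM2l (ltr0Sn R 3)) divff // pnatr_eq0.
have x1r : `|x1 - x1| <= rho by rewrite subrr normr0 ltW.
have yr := tubr y yd.
have [h1 _ _ _ _] := HE t1 t x1 (x1 + y) q (q + k *: y) t1T' tT x1r yr qr' qkr.
have h2 : `|k * (t - t1)| <= 4 * e by rewrite normrM; exact: kd.
have h3 : `|H (t, x1 + y, q + k *: y) - H (t1, x1, q)| <= C * (d + d + 4 * e).
  apply: le_trans h1 _; rewrite ler_pM2l //.
  have -> : x1 + y - x1 = y by rewrite addrAC subrr add0r.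
  have -> : q + k *: y - q = k *: y by rewrite addrAC subrr add0r.
  by rewrite normrZ; apply: lerD; [exact: lerD | exact: kd].
apply: le_lt_trans (lerD h2 h3) _.
have h4 : C * d <= c / 8.
  by move: dd; rewrite ler_pdivlMr // ler_pdivlMr // mulrCA mulrC [C * d]mulrC mulrAC.
have h5 : e * (1 + C) <= c / 16.
  by move: e2; rewrite ler_pdivlMr // ler_pdivlMr // mulrCA mulrC [e * _]mulrC mulrAC.
have -> : 4 * e + C * (d + d + 4 * e) = 2 * (C * d) + 4 * (e * (1 + C)) by ring.
clear -c0 h4 h5; lra.
Qed.

Lemma parabola_c1curve (R : realType) (lo hi a0 a1 k t1 : R) :
  c1curve `]lo, hi[%classic (fun t => a0 + a1 * (t - t1) + k / 2 * ((t - t1) * (t - t1)))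
    (fun t => a1 + k * (t - t1)).
Proof.
move=> t _; split.
  apply: is_derive_eq; rewrite /GRing.scale /=; by field.
apply: cvgD; first exact: cvg_cst.
apply: cvgM; first exact: cvg_cst.
by apply: cvgB; [exact: cvg_id | exact: cvg_cst].
Qed.

Lemma cst_c1curve (R : realType) (V : normedModType R) (lo hi : R) (v : V) :
  c1curve `]lo, hi[%classic (fun=> v) (fun=> 0).
Proof. by move=> t _; split; [exact: is_derive_cst | exact: cvg_cst]. Qed.

(** Instead of building a C1 function that touches [u] at the point, argue by comparison. Were the
    left-hand side positive, the paraboloid of [perturbation_box] would have positive slope on the
    whole backward cylinder and dominate [u] on its bottom and sides, hence at the centre too, where
    it lies [e * d] below [u]. *)
Lemma subsolution_first_order (R : realType) n (Omega : set 'rV[R]_n) (T : R)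
    (H : R * 'rV[R]_n * 'rV[R]_n -> R) (u : R * 'rV[R]_n -> R) (t1 : R) (x1 q : 'rV[R]_n) (a1 : R) :
  standing Omega T H u -> 0 < t1 < T -> Omega x1 -> first_order u t1 x1 a1 q ->
  viscosity_subsolution Omega T H u -> a1 + H (t1, x1, q) <= 0.
Proof.
move=> hyp t1T Ox1 fo u_sub; rewrite leNgt; apply/negP => c0.
have [oOmega _ _ u_lip] := hyp.
have [d [N [e [L [[d0 a_ge0 N0 e0 Nd] [L0 HO HL F1 F2]]]]]] := perturbation_box hyp t1T Ox1 fo c0.
have ed0 : 0 < e * d by rewrite mulr_gt0.
pose a0 := u (t1, x1) - e * d.
have ab : t1 - d < t1 by rewrite gtrBl.
have bT : t1 <= T by case/andP: t1T => _ /ltW.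
have hiT : T < T + 1 by rewrite ltrDl.
have tubO (t : R) (y : 'rV[R]_n) : t1 - d <= t <= t1 -> `|y| <= d -> Omega (x1 + y) by move=> _; exact: HO.
have SA : [set z : R * 'rV[R]_n | t1 - d <= z.1 <= t1 /\ Omega z.2] `<=` `[0, T]%classic `*` Omega.
  move=> z [/andP[h1 h2] Oz]; split=> //=.
  by rewrite in_itv /= (le_trans a_ge0 h1) (le_trans h2 bT).
pose A t := a0 + a1 * (t - t1) + N / 2 * ((t - t1) * (t - t1)).
have phiE t y : paraboloid A (fun=> q) (fun=> x1) (fun=> N) (t, x1 + y) = A t + dot q y + N / 2 * dot y y.
  by rewrite /paraboloid /= (addrC x1) addrK.
have bd t y : t1 - d <= t <= t1 -> `|y| <= d -> d ^+ 2 <= (t - t1) * (t - t1) + dot y y ->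
    u (t, x1 + y) <= paraboloid A (fun=> q) (fun=> x1) (fun=> N) (t, x1 + y).
  move=> tt yd; rewrite -(ler_pM2l N0) => hd.
  have := F1 t y tt yd; rewrite ler_norml => /andP[_ h].
  rewrite phiE /A /a0.
  have h2 : N * d ^+ 2 = 4 * (e * d) by rewrite expr2 mulrA Nd mulrA.
  move: hd; rewrite h2 mulrDr.
  have -> : N / 2 * ((t - t1) * (t - t1)) = (N * ((t - t1) * (t - t1))) / 2 by ring.
  have -> : N / 2 * dot y y = (N * dot y y) / 2 by ring.
  move: (N * _) (N * dot _ _) (e * d) (dot q y) (u _) (u _) (a1 * _) h ed0; clear; move=> *; lra.
have HA : c1curve `]-1, T + 1[%classic A (fun t => a1 + N * (t - t1)) by exact: parabola_c1curve.
have HP := @cst_c1curve R 'rV[R]_n (-1) (T + 1) q.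
have HX := @cst_c1curve R 'rV[R]_n (-1) (T + 1) x1.
have HN := @cst_c1curve R R (-1) (T + 1) N.
have main : u (t1, x1 + 0) <= paraboloid A (fun=> q) (fun=> x1) (fun=> N) (t1, x1 + 0).
  apply: (subsolution_compare oOmega a_ge0 ab bT (ltrN10 R) hiT HA HP HX HN
    (continuous_subspaceW SA (u_within oOmega u_lip)) tubO u_sub L0).
  - move=> t y y' tt yd yd'; have tt' : t1 - d <= t <= t1 by case/andP: tt => *; rewrite !ltW.
    exact: HL (ltW yd) (ltW yd').
  - move=> t y tt yd _; have tt' : t1 - d <= t <= t1 by case/andP: tt => *; rewrite !ltW.
    have := F2 t y N tt' (ltW yd) (gtr0_norm N0).
    rewrite dot0l !dot0r mul0r mul0r mulr0 !subr0 !addr0 => h.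
    have [h1 _] := andP (etrans (esym (ler_norml _ _)) (lexx `|N * (t - t1)|)).
    have [h2 _] := andP (etrans (esym (ler_norml _ _)) (lexx `|H (t, x1 + y, q + N *: y) - H (t1, x1, q)|)).
    move: (N * (t - t1)) (H _) (H _) h1 h2 h => k h0 h3; move: `|k| `|h0 - h3|; clear; move=> *; lra.
  - move=> y yd; apply: bd => //; first by rewrite lexx ltW.
    by rewrite addrAC subrr add0r mulrNN -expr2 lerDl dot_ge0.
  - move=> t y tt yd; apply: bd => //; first by rewrite yd.
    by apply: le_trans (_ : dot y y <= _); rewrite -?yd ?sqr_norm_le_dot // lerDr -expr2 sqr_ge0.
  - by rewrite lexx ltW.
  - by rewrite normr0 ltW.
move: main; rewrite phiE dot0l dot0r /A subrr !mulr0 !addr0 /a0 => h.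
by move: ed0 h; move: (e * d) (u _); clear; move=> *; lra.
Qed.

(** The same comparison from below, with curvature [- N] and the centre raised by [e * d]. *)
Lemma supersolution_first_order (R : realType) n (Omega : set 'rV[R]_n) (T : R)
    (H : R * 'rV[R]_n * 'rV[R]_n -> R) (u : R * 'rV[R]_n -> R) (t1 : R) (x1 q : 'rV[R]_n) (a1 : R) :
  standing Omega T H u -> 0 < t1 < T -> Omega x1 -> first_order u t1 x1 a1 q ->
  viscosity_supersolution Omega T H u -> 0 <= a1 + H (t1, x1, q).
Proof.
move=> hyp t1T Ox1 fo u_sup; rewrite leNgt; apply/negP => c0'.
have c0 : 0 < - (a1 + H (t1, x1, q)) by rewrite oppr_gt0.
have [oOmega _ _ u_lip] := hyp.
have [d [N [e [L [[d0 a_ge0 N0 e0 Nd] [L0 HO HL F1 F2]]]]]] := perturbation_box hyp t1T Ox1 fo c0.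
have ed0 : 0 < e * d by rewrite mulr_gt0.
pose a0 := u (t1, x1) + e * d.
have ab : t1 - d < t1 by rewrite gtrBl.
have bT : t1 <= T by case/andP: t1T => _ /ltW.
have hiT : T < T + 1 by rewrite ltrDl.
have tubO (t : R) (y : 'rV[R]_n) : t1 - d <= t <= t1 -> `|y| <= d -> Omega (x1 + y) by move=> _; exact: HO.
have SA : [set z : R * 'rV[R]_n | t1 - d <= z.1 <= t1 /\ Omega z.2] `<=` `[0, T]%classic `*` Omega.
  move=> z [/andP[h1 h2] Oz]; split=> //=.
  by rewrite in_itv /= (le_trans a_ge0 h1) (le_trans h2 bT).
pose A t := a0 + a1 * (t - t1) + - N / 2 * ((t - t1) * (t - t1)).
have phiE t y : paraboloid A (fun=> q) (fun=> x1) (fun=> - N) (t, x1 + y) = A t + dot q y + - N / 2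
  * dot y y.
  by rewrite /paraboloid /= (addrC x1) addrK.
have bd t y : t1 - d <= t <= t1 -> `|y| <= d -> d ^+ 2 <= (t - t1) * (t - t1) + dot y y ->
    paraboloid A (fun=> q) (fun=> x1) (fun=> - N) (t, x1 + y) <= u (t, x1 + y).
  move=> tt yd; rewrite -(ler_pM2l N0) => hd.
  have := F1 t y tt yd; rewrite ler_norml => /andP[h _].
  rewrite phiE /A /a0.
  have h2 : N * d ^+ 2 = 4 * (e * d) by rewrite expr2 mulrA Nd mulrA.
  move: hd; rewrite h2 mulrDr.
  have -> : - N / 2 * ((t - t1) * (t - t1)) = - (N * ((t - t1) * (t - t1))) / 2 by ring.
  have -> : - N / 2 * dot y y = - (N * dot y y) / 2 by ring.
  move: (N * _) (N * dot _ _) (e * d) (dot q y) (u _) (u _) (a1 * _) h ed0; clear; move=> *; lra.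
have HA : c1curve `]-1, T + 1[%classic A (fun t => a1 + - N * (t - t1)) by exact: parabola_c1curve.
have HP := @cst_c1curve R 'rV[R]_n (-1) (T + 1) q.
have HX := @cst_c1curve R 'rV[R]_n (-1) (T + 1) x1.
have HN := @cst_c1curve R R (-1) (T + 1) (- N).
have main : paraboloid A (fun=> q) (fun=> x1) (fun=> - N) (t1, x1 + 0) <= u (t1, x1 + 0).
  apply: (supersolution_compare oOmega a_ge0 ab bT (ltrN10 R) hiT HA HP HX HN
    (continuous_subspaceW SA (u_within oOmega u_lip)) tubO u_sup).
  - move=> t y tt yd; have tt' : t1 - d <= t <= t1 by case/andP: tt => *; rewrite !ltW.
    have := F2 t y (- N) tt' (ltW yd) (etrans (normrN N) (gtr0_norm N0)).
    rewrite dot0l !dot0r mul0r mul0r mulr0 !subr0 !addr0 => h.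
    have h1 := ler_norm (- N * (t - t1)).
    have h2 := ler_norm (H (t, x1 + y, q + - N *: y) - H (t1, x1, q)).
    move: (- N * (t - t1)) (H _) (H _) h1 h2 h => k h0 h3; move: `|k| `|h0 - h3|; clear; move=> *; lra.
  - move=> y yd; apply: bd => //; first by rewrite lexx ltW.
    by rewrite addrAC subrr add0r mulrNN -expr2 lerDl dot_ge0.
  - move=> t y tt yd; apply: bd => //; first by rewrite yd.
    by apply: le_trans (_ : dot y y <= _); rewrite -?yd ?sqr_norm_le_dot // lerDr -expr2 sqr_ge0.
  - by rewrite lexx ltW.
  - by rewrite normr0 ltW.
move: main; rewrite phiE dot0l dot0r /A subrr !mulr0 !addr0 /a0 => h.
by move: ed0 h; move: (e * d) (u _); clear; move=> *; lra.
Qed.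

(** * Existence for the Hamiltonian system *)

(** Subtracting and adding the geometric tail gives an increasing and a decreasing sequence
    enclosing [u]; the supremum of the former is the limit, and the enclosure is the rate. *)
Lemma geometric_limit (R : realType) (u : nat -> R) (c : R) :
  0 <= c -> (forall k, `|u k.+1 - u k| <= c / 2 ^+ k) ->
  exists l, forall k, `|u k - l| <= 2 * c / 2 ^+ k.
Proof.
move=> c0 Hu; pose a k := u k - 2 * c / 2 ^+ k; pose b k := u k + 2 * c / 2 ^+ k.
have p2 k : (0 : R) < 2 ^+ k by rewrite exprn_gt0.
have half k : 2 * c / 2 ^+ k.+1 = c / 2 ^+ k by rewrite exprS; field; rewrite gt_eqF.
have am k : a k <= a k.+1.
  rewrite /a half; have := Hu k; rewrite ler_norml => /andP[h _].
  by have : 2 * c / 2 ^+ k = c / 2 ^+ k + c / 2 ^+ k; [ring | lra].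
have bm k : b k.+1 <= b k.
  rewrite /b half; have := Hu k; rewrite ler_norml => /andP[_ h].
  by have : 2 * c / 2 ^+ k = c / 2 ^+ k + c / 2 ^+ k; [ring | lra].
have aM i j : (i <= j)%N -> a i <= a j.
  by move=> ij; rewrite -(subnKC ij); elim: (j - i)%N => [|k IH]; rewrite ?addn0 // addnS (le_trans IH).
have bM i j : (i <= j)%N -> b j <= b i.
  by move=> ij; rewrite -(subnKC ij); elim: (j - i)%N => [|k IH]; rewrite ?addn0 // addnS (le_trans (bm _)).
have abk k : a k <= b k.
  by rewrite /a /b; have : 0 <= 2 * c / 2 ^+ k; [rewrite divr_ge0 ?mulr_ge0 // ltW | lra].
have ab i j : a i <= b j.
  apply: (le_trans (aM i (maxn i j) (leq_maxl _ _))).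
  exact: le_trans (abk _) (bM j (maxn i j) (leq_maxr _ _)).
have hs : has_sup (range a).
  by split; [exists (a 0%N); exists 0%N | exists (b 0%N) => _ [k _ <-]].
exists (sup (range a)) => k; rewrite ler_norml.
have h1 : a k <= sup (range a) by apply: sup_upper_bound => //; exists k.
have h2 : sup (range a) <= b k.
  by apply: ge_sup => [|_ [j _ <-]]; [exact: hs.1 | exact: ab].
by move: h1 h2; rewrite /a /b; lra.
Qed.

Lemma mvt_norm (R : realType) n (f f' : R -> 'rV[R]_n) (tau c t : R) :
  0 <= c -> {within `[0, tau], continuous f} ->
  (forall s, 0 < s < tau -> is_derive s 1 f (f' s)) ->
  (forall s, 0 < s < tau -> `|f' s| <= c) -> 0 <= t <= tau -> `|f t - f 0| <= c * tau.
Proof.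
move=> c0 fc fd fb /andP[t0 ttau].
apply: norm_le_coord => [|i]; first by rewrite mulr_ge0 // (le_trans t0).
have fci := within_itv_W (lexx 0) ttau (continuous_within_coord (i := i) fc).
have D (s : R) : s \in `]0, t[ -> is_derive s 1 (fun t => f t 0 i) (f' s 0 i).
  rewrite in_itv /= => /andP[s0 st]; apply: is_derive_coord; apply: fd.
  by rewrite s0 (lt_le_trans st).
have := t0; rewrite le_eqVlt => /predU1P[<-|t_gt0].
  by rewrite subrr mxE normr0 mulr_ge0 // (le_trans t0).
have [s] := MVT t_gt0 D fci.
rewrite in_itv /= subr0 !mxE => /andP[s0 st] ->.
rewrite normrM (ger0_norm t0); apply: ler_pM => //.
by apply: le_trans (coord_le_norm _ _) (fb s _); rewrite s0 (lt_le_trans st).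
Qed.

(** Integrating the clamped function over a larger interval makes [F] differentiable at 0 and [tau]
    too, whence its continuity up to the endpoints. *)
Lemma antiderivative_itv (R : realType) (f : R -> R) (tau : R) :
  0 < tau -> {within `[0, tau], continuous f} ->
  exists F : R -> R, [/\ F 0 = 0, {within `[0, tau], continuous F} &
    forall t, 0 < t < tau -> is_derive t 1 F (f t)].
Proof.
move=> tau0 fc.
have lo : -1 < tau + 1 by apply: lt_trans (ltrN10 _) _; rewrite addr_gt0.
have [F HF] := antiderivative (continuous_clamp_comp (ltW tau0) fc) lo.
have dF t : -1 < t < tau + 1 -> is_derive t 1 (fun s => F s - F 0) (f (clamp 0 tau t)).
  by move=> tt; have dF := HF t tt; apply: is_derive_eq; rewrite subr0.
exists (fun t => F t - F 0); split; first by rewrite subrr.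
- apply: continuous_in_subspaceT => t; rewrite inE /= in_itv /= => /andP[t0 tt].
  apply: (is_derive_continuous (dF t _)).
  by rewrite (lt_le_trans (ltrN10 _) t0) (le_lt_trans tt) // ltrDl.
- move=> t /andP[t0 tt]; rewrite -{2}(@clamp_id _ 0 tau t) ?ltW //.
  by apply: dF; rewrite (lt_trans (ltrN10 _) t0) (lt_trans tt) // ltrDl.
Qed.

Lemma within_rV (R : realType) n (f : R -> 'rV[R]_n) (A : set R) :
  (forall i, {within A, continuous (fun t => f t 0 i)}) -> {within A, continuous f}.
Proof.
move=> Hf; apply/subspace_continuousP => t At; apply/cvgrPdist_lt => e e0; near=> s.
apply: norm_lt_coord => // i; rewrite !mxE.
move: i; near: s; apply: filter_forall => i.
by have /subspace_continuousP/(_ t At)/cvgrPdist_lt := Hf i; apply.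
Unshelve. all: by end_near. Qed.

Lemma antiderivative_path (R : realType) n (f : R -> 'rV[R]_n) (x0 : 'rV[R]_n) (tau : R) :
  0 < tau -> {within `[0, tau], continuous f} ->
  exists Y : R -> 'rV[R]_n, [/\ Y 0 = x0, {within `[0, tau], continuous Y} &
    forall t, 0 < t < tau -> is_derive t 1 Y (f t)].
Proof.
move=> tau0 fc.
have /choice[F HF] := fun i => antiderivative_itv tau0 (continuous_within_coord (i := i) fc).
exists (fun t => \row_i (x0 0 i + F i t)); split.
- by apply/rowP => i; rewrite mxE; have [-> _ _] := HF i; rewrite addr0.
- apply: within_rV => i; have [_ Fc _] := HF i.
  have -> : (fun t => (\row_i (x0 0 i + F i t)) 0 i) = (fun t => x0 0 i + F i t).
    by apply/funext => t; rewrite mxE.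
  by move=> t; apply: cvgD; [exact: cvg_cst | exact: Fc].
- move=> t tt; apply: is_derive_rV => i; have [_ _ /(_ t tt) dF] := HF i.
  have -> : (fun t => (\row_i (x0 0 i + F i t)) 0 i) = (fun t => x0 0 i + F i t).
    by apply/funext => s; rewrite mxE.
  by apply: is_derive_eq; rewrite add0r mul1r.
Qed.

(** Iteration of the integral operator, which halves uniform distances. Regularity of [F] in time is
    expressed by the last hypothesis: [F] composed with a continuous path is continuous, which is
    all that integration requires. *)
Lemma picard (R : realType) m (x0 : 'rV[R]_m) (F : R -> 'rV[R]_m -> 'rV[R]_m) (rho tau0 Lf M : R) :
  0 < rho -> 0 < tau0 -> 0 < Lf -> 0 < M ->
  (forall t x x', 0 <= t <= tau0 -> `|x - x0| <= rho -> `|x' - x0| <= rho ->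
     `|F t x - F t x'| <= Lf * `|x - x'|) ->
  (forall t x, 0 <= t <= tau0 -> `|x - x0| <= rho -> `|F t x| <= M) ->
  (forall (tau : R) (X : R -> 'rV[R]_m), tau <= tau0 -> {within `[0, tau], continuous X} ->
     (forall t, 0 <= t <= tau -> `|X t - x0| <= rho) ->
     {within `[0, tau], continuous (fun t => F t (X t))}) ->
  exists (tau : R) (X : R -> 'rV[R]_m), [/\ 0 < tau <= tau0, X 0 = x0, {within `[0, tau], continuous X},
    forall t, 0 <= t <= tau -> `|X t - x0| <= rho &
    forall t, 0 < t < tau -> is_derive t 1 X (F t (X t))].
Proof.
move=> rho0 tau00 L0 M0 FL FM Fc.
(* [rho / M] keeps the iterates in the ball, and [(2 * Lf)^-1] gives the contraction factor 1/2. *)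
pose tau := Num.min tau0 (Num.min (rho / M) (2 * Lf)^-1).
have tau_gt0 : 0 < tau by rewrite !lt_min tau00 divr_gt0 // invr_gt0 mulr_gt0.
have [ta tb tc] : [/\ tau <= tau0, tau <= rho / M & tau <= (2 * Lf)^-1].
  by split; rewrite !ge_min lexx ?orbT.
have Mtau : M * tau <= rho by rewrite mulrC -ler_pdivlMr.
have Ltau : Lf * tau <= 2^-1.
  by move: tc; rewrite -(ler_pM2l L0) invfM mulrCA divff ?mulr1 // gt_eqF.
have tin t : 0 <= t <= tau -> 0 <= t <= tau0 by move=> /andP[-> h]; exact: le_trans h ta.
have oin t : 0 < t < tau -> 0 <= t <= tau by move=> /andP[h1 h2]; rewrite !ltW.
pose good (X : R -> 'rV[R]_m) := [/\ X 0 = x0, {within `[0, tau], continuous X} &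
  forall t, 0 <= t <= tau -> `|X t - x0| <= rho].
(* The integral operator, made total by choice; its values are meaningful on [good] paths only. *)
have /choice[Step HStep] : forall X : R -> 'rV[R]_m, exists Y : R -> 'rV[R]_m, good X ->
    good Y /\ forall t, 0 < t < tau -> is_derive t 1 Y (F t (X t)).
  move=> X; have [gX|nX] := pselect (good X); last by exists X.
  have [X0 Xc Xr] := gX.
  have [Y [Y0 Yc Yd]] := antiderivative_path x0 tau_gt0 (Fc tau X ta Xc Xr).
  exists Y => _; split=> //; split=> // t tt; rewrite -Y0; apply: le_trans Mtau.
  apply: (mvt_norm (ltW M0) Yc Yd) => // s /oin ss.
  by apply: FM; [exact: tin | exact: Xr].
have contr X X' e : good X -> good X' -> (forall t, 0 <= t <= tau -> `|X t - X' t| <= e) ->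
    forall t, 0 <= t <= tau -> `|Step X t - Step X' t| <= e / 2.
  move=> gX gX' He t tt.
  have e0 : 0 <= e by apply: le_trans (He 0 _); rewrite // lexx ltW.
  have [[S0 Sc _] Sd] := HStep X gX; have [[S0' Sc' _] Sd'] := HStep X' gX'.
  have [_ _ Xr] := gX; have [_ _ Xr'] := gX'.
  pose D t := Step X t - Step X' t.
  have D0 : D 0 = 0 by rewrite /D S0 S0' subrr.
  have Dc : {within `[0, tau], continuous D} by move=> s; apply: (@cvgB _ 'rV[R]_m);
    [exact: Sc | exact: Sc'].
  have Dd s : 0 < s < tau -> is_derive s 1 D (F s (X s) - F s (X' s)).
    by move=> ss; apply: is_deriveB; [exact: Sd | exact: Sd'].
  have Db s : 0 < s < tau -> `|F s (X s) - F s (X' s)| <= Lf * e.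
    move=> /oin ss; apply: le_trans (FL s _ _ (tin s ss) (Xr s ss) (Xr' s ss)) _.
    by rewrite ler_pM2l // He.
  have := mvt_norm (mulr_ge0 (ltW L0) e0) Dc Dd Db tt; rewrite D0 subr0 => h.
  by apply: le_trans h _; rewrite mulrAC mulrC ler_wpM2l.
pose X k := iter k Step (fun=> x0).
have gX k : good (X k).
  elim: k => [|k IH]; last by have [] := HStep _ IH.
  split=> // [|t tt]; last by rewrite subrr normr0 ltW.
  by move=> t; exact: cvg_cst.
have dX k t : 0 <= t <= tau -> `|X k.+1 t - X k t| <= rho / 2 ^+ k.
  elim: k t => [|k IH] t tt.
    by rewrite expr0 divr1; have [_ _] := gX 1%N; apply.
  rewrite exprSr invfM mulrA; exact: (contr (X k.+1) (X k) _ (gX _) (gX _) IH t tt).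
have HlimX t i : exists l : R, 0 <= t <= tau -> forall k, `|X k t 0 i - l| <= 2 * rho / 2 ^+ k.
  have [tt|tt] := boolP (0 <= t <= tau); last by exists 0.
  have [|l Hl] := @geometric_limit R (fun k => X k t 0 i) rho (ltW rho0); last by exists l.
  move=> k; have := coord_le_norm (X k.+1 t - X k t) i; rewrite !mxE => h.
  exact: le_trans h (dX k t tt).
have /choice[Z HZ] : forall t, exists z : 'rV[R]_m, 0 <= t <= tau ->
forall k, `|X k t - z| <= 2 * rho / 2 ^+ k.
  move=> t; have /choice[l Hl] := HlimX t; exists (\row_i l i) => tt k.
  apply: norm_le_coord => [|i]; first by rewrite divr_ge0 ?mulr_ge0 ?exprn_ge0 // ltW.
  by rewrite !mxE; exact: Hl.
have small e : 0 < e -> exists k, 2 * rho / 2 ^+ k <= e.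
  move=> e0; have /cvgrPdist_lt : (2^-1 : R) ^+ k @[k --> \oo] --> 0.
    by apply: cvg_expr; rewrite gtr0_norm ?invr_gt0 // invf_lt1 // ltr1n.
  have r2 : 0 < 2 * rho by rewrite mulr_gt0.
  move=> /(_ (e / (2 * rho)) (divr_gt0 e0 r2))[k _ Hk]; exists k.
  have := Hk k (leqnn k); rewrite /= sub0r normrN gtr0_norm ?exprn_gt0 ?invr_gt0 //.
  by rewrite ltr_pdivlMr // exprVn mulrC => /ltW.
have Z0 : Z 0 = x0.
  apply/eqP; rewrite -subr_eq0 -normr_le0; apply/ler_addgt0Pr => e e0; rewrite add0r.
  have [k hk] := small e e0; apply: le_trans hk.
  by have [<- _ _] := gX k; rewrite distrC; apply: HZ; rewrite lexx ltW.
have Zr t : 0 <= t <= tau -> `|Z t - x0| <= rho.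
  move=> tt; apply/ler_addgt0Pr => e e0; have [k hk] := small e e0.
  apply: le_trans (ler_distD (X k t) _ _) _; rewrite addrC; apply: lerD.
    by have [_ _] := gX k; apply.
  by rewrite distrC; apply: le_trans hk; exact: HZ.
have Zc : {within `[0, tau], continuous Z}.
  apply: within_continuousP => t0 t0t e e0.
  have e3 : 0 < e / 3 by rewrite divr_gt0.
  have [k hk] := small (e / 3) e3.
  have [_ Xc _] := gX k; have [d d0 Hd] := within_small Xc t0t e3.
  exists d => // t tt td; have -> : e = e / 3 + e / 3 + e / 3 by field.
  apply: le_trans (ler_distD (X k t0) _ _) _; apply: lerD; last by apply: le_trans hk; exact: HZ.
  apply: le_trans (ler_distD (X k t) _ _) _; apply: lerD; last exact: Hd.
  by rewrite distrC; apply: le_trans hk; exact: HZ.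
have gZ : good Z by [].
have [[Y0 Yc Yr] Yd] := HStep Z gZ.
have ZY t : 0 <= t <= tau -> Z t = Step Z t.
  move=> tt; apply/eqP; rewrite -subr_eq0 -normr_le0; apply/ler_addgt0Pr => e e0; rewrite add0r.
  have e2 : 0 < e / 2 by rewrite divr_gt0.
  have [k hk] := small (e / 2) e2.
  apply: le_trans (ler_distD (X k.+1 t) _ _) _; rewrite (splitr e); apply: lerD.
    rewrite distrC; apply: le_trans (HZ t tt k.+1) _; apply: le_trans hk.
    rewrite ler_wpM2l ?mulr_ge0 ?(ltW rho0) // lef_pV2 ?posrE ?exprn_gt0 //.
    by rewrite ler_eXn2l // ltr1n.
  apply: le_trans (contr (X k) Z (2 * rho / 2 ^+ k) (gX k) gZ _ t tt) _; first by move=> s ss; exact: HZ.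
  apply: le_trans hk; rewrite ler_pdivrMr // ler_peMr ?ler1n //.
  by rewrite divr_ge0 ?mulr_ge0 ?exprn_ge0 // ltW.
(* The fixed point is returned as [Step Z]: it agrees with the limit [Z] on [[0, tau]], and its
   derivative there is known by construction. *)
exists tau, (Step Z); split=> //; first by rewrite tau_gt0.
by move=> t tt; rewrite -(ZY t (oin t tt)); exact: Yd.
Qed.

Lemma within_short (R : realType) (V W : normedModType R) (f : V -> W) (X : R -> V) (a b : R) :
  (forall x y, `|f x - f y| <= `|x - y|) ->
  {within `[a, b], continuous X} -> {within `[a, b], continuous (fun t => f (X t))}.
Proof.
move=> fs Xc; apply: within_continuousP => t0 t0ab e e0.
have [d d0 Hd] := within_small Xc t0ab e0; exists d => // t tab td.
exact: le_trans (fs _ _) (Hd t tab td).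
Qed.

Section SplitRow.
Variables (R : realType) (n : nat).
Implicit Types (Z : 'rV[R]_(n + n)).

Lemma norm_lsubmx Z : `|lsubmx Z| <= `|Z|.
Proof. by apply: norm_le_coord => // i; rewrite mxE; exact: coord_le_norm. Qed.

Lemma norm_rsubmx Z : `|rsubmx Z| <= `|Z|.
Proof. by apply: norm_le_coord => // i; rewrite mxE; exact: coord_le_norm. Qed.

Lemma norm_row_mx (x y : 'rV[R]_n) (c : R) : `|x| <= c -> `|y| <= c -> `|row_mx x y| <= c.
Proof.
move=> xc yc; have c0 : 0 <= c by apply: le_trans xc.
apply: norm_le_coord => // i; rewrite mxE; case: splitP => j _.
  by apply: le_trans (coord_le_norm _ _) xc.
by apply: le_trans (coord_le_norm _ _) yc.
Qed.

Lemma within_lsubmx (X : R -> 'rV[R]_(n + n)) (a b : R) :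
  {within `[a, b], continuous X} -> {within `[a, b], continuous (fun t => lsubmx (X t))}.
Proof. by apply: within_short => x y; rewrite -linearB; exact: norm_lsubmx. Qed.

Lemma within_rsubmx (X : R -> 'rV[R]_(n + n)) (a b : R) :
  {within `[a, b], continuous X} -> {within `[a, b], continuous (fun t => rsubmx (X t))}.
Proof. by apply: within_short => x y; rewrite -linearB; exact: norm_rsubmx. Qed.

Lemma within_row_mx (x y : R -> 'rV[R]_n) (a b : R) :
  {within `[a, b], continuous x} -> {within `[a, b], continuous y} ->
  {within `[a, b], continuous (fun t => row_mx (x t) (y t))}.
Proof.
move=> xc yc; apply: within_continuousP => t0 t0ab e e0.
have [d1 d10 H1] := within_small xc t0ab e0; have [d2 d20 H2] := within_small yc t0ab e0.
exists (Num.min d1 d2) => [|t tab]; first by rewrite lt_min d10.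
rewrite le_min => /andP[td1 td2]; rewrite opp_row_mx add_row_mx.
by apply: norm_row_mx; [exact: H1 | exact: H2].
Qed.

End SplitRow.

(** Position and momentum are packed into one row of length [n + n]. For the sup norm both
    projections are 1-Lipschitz, so the estimates on [D_p H] and [D_x H] become those required of
    the vector field. *)
Lemma hamiltonian_solution_ex (R : realType) n (Omega : set 'rV[R]_n) (T : R)
    (H : R * 'rV[R]_n * 'rV[R]_n -> R) (u : R * 'rV[R]_n -> R) (y0 p0 : 'rV[R]_n) :
  standing Omega T H u -> 0 < T -> Omega y0 ->
  exists tau xi p, hamiltonian_solution Omega T H tau y0 p0 xi p.
Proof.
move=> hyp T0 Oy0.
have t0T : 0 <= (0 : R) <= T by rewrite lexx ltW.
have [rho [L [r [C [th [[[rho0 L0 Lr C0 th0] [HO HE HL]] pr]]]]]] :=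
  local_setting_ex (`|p0| + 1) hyp t0T Oy0.
pose Z0 := row_mx y0 p0.
pose F t (Z : 'rV[R]_(n + n)) := row_mx (DpH H t (lsubmx Z) (rsubmx Z)) (- DxH H t (lsubmx Z) (rsubmx Z)).
pose d := Num.min rho 1.
have d0 : 0 < d by rewrite lt_min rho0 ltr01.
have [dr d1] : d <= rho /\ d <= 1 by rewrite !ge_min !lexx orbT.
have lZ0 : lsubmx Z0 = y0 by rewrite row_mxKl.
have rZ0 : rsubmx Z0 = p0 by rewrite row_mxKr.
have inl Z : `|Z - Z0| <= d -> `|lsubmx Z - y0| <= d.
  by move=> Zd; rewrite -lZ0 -linearB; exact: le_trans (norm_lsubmx _) Zd.
have inrr Z : `|Z - Z0| <= d -> `|rsubmx Z - p0| <= d.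
  by move=> Zd; rewrite -rZ0 -linearB; exact: le_trans (norm_rsubmx _) Zd.
have inr Z : `|Z - Z0| <= d -> `|rsubmx Z| <= r.
  by move=> Zd; apply: norm_le_dist pr (le_trans (inrr Z Zd) d1).
have Fest t s Z Z' : 0 <= t <= T -> 0 <= s <= T -> `|Z - Z0| <= d -> `|Z' - Z0| <= d ->
    `|F s Z' - F t Z| <= C * (`|s - t| + `|Z' - Z| + `|Z' - Z|).
  move=> tT sT Zd Zd'; rewrite /F opp_row_mx add_row_mx.
  have [_ h2 h3 _ _] := HE t s (lsubmx Z) (lsubmx Z') (rsubmx Z) (rsubmx Z') tT sT
    (le_trans (inl Z Zd) dr) (le_trans (inl Z' Zd') dr) (inr Z Zd) (inr Z' Zd').
  have B : C * (`|s - t| + `|lsubmx Z' - lsubmx Z| + `|rsubmx Z' - rsubmx Z|) <=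
      C * (`|s - t| + `|Z' - Z| + `|Z' - Z|).
    rewrite ler_pM2l // -!linearB; apply: lerD; last exact: norm_rsubmx.
    by rewrite lerD2l; exact: norm_lsubmx.
  apply: norm_row_mx; first exact: le_trans h3 B.
  by rewrite -opprD normrN; exact: le_trans h2 B.
have Z00 : `|Z0 - Z0| <= d by rewrite subrr normr0 ltW.
(* Measured from the starting point, time moves by at most [T] and each half of the row by at most
   [d]. *)
pose M := `|F 0 Z0| + C * (T + d + d) + 1.
have M0 : 0 < M.
  by rewrite ltr_wpDl // addr_ge0 // mulr_ge0 ?(ltW C0) // !addr_ge0 // ltW.
have L2 : 0 < 2 * C by rewrite mulr_gt0.
have FL t Z Z' : 0 <= t <= T -> `|Z - Z0| <= d -> `|Z' - Z0| <= d ->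
    `|F t Z - F t Z'| <= 2 * C * `|Z - Z'|.
  move=> tT Zd Zd'; apply: le_trans (Fest t t Z' Z tT tT Zd' Zd) _.
  have -> : 2 * C * `|Z - Z'| = C * (`|Z - Z'| + `|Z - Z'|) by ring.
  by rewrite subrr normr0 add0r.
have FM t Z : 0 <= t <= T -> `|Z - Z0| <= d -> `|F t Z| <= M.
  move=> tT Zd; rewrite -(subrK (F 0 Z0) (F t Z)); apply: le_trans (ler_normD _ _) _.
  rewrite addrC /M -addrA lerD2l; apply: le_trans (Fest 0 t Z0 Z t0T tT Z00 Zd) _.
  rewrite ler_wpDr // ler_pM2l // subr0 ger0_norm; last by case/andP: tT.
  by rewrite !lerD //; case/andP: tT.
have Fc (tau : R) (X : R -> 'rV[R]_(n + n)) : tau <= T -> {within `[0, tau], continuous X} ->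
    (forall t, 0 <= t <= tau -> `|X t - Z0| <= d) -> {within `[0, tau], continuous (fun t => F t (X t))}.
  move=> tauT Xc Xd.
  have XO t : 0 <= t <= tau -> Omega (lsubmx (X t)).
    by move=> tt; apply: HO; exact: le_trans (inl _ (Xd t tt)) dr.
  have [_ cx cp] := H_comp_within hyp (lexx 0) tauT
    (within_lsubmx Xc) (within_rsubmx Xc) XO.
  have cx' : {within `[0, tau], continuous (fun t => - DxH H t (lsubmx (X t)) (rsubmx (X t)))}.
    by move=> t; apply: (@cvgN _ 'rV[R]_n); exact: cx.
  exact: (within_row_mx cp cx').
have [tau [X [/andP[tau0 tauT] X0 Xc Xd XD]]] := picard d0 T0 L2 M0 FL FM Fc.
exists tau, (fun t => lsubmx (X t)), (fun t => rsubmx (X t)); split.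
- by rewrite tau0.
- by split; [exact: within_lsubmx | exact: within_rsubmx].
- by move=> t tt; apply: HO; exact: le_trans (inl _ (Xd t tt)) dr.
- move=> t tt; have DX := XD t tt; split; apply: is_derive_rV => i.
    have -> : (fun y => lsubmx (X y) 0 i) = (fun y => X y 0 (lshift n i)) by apply/funext => y; rewrite mxE.
    have := is_derive_coord (lshift n i) DX; rewrite /F row_mxEl; exact.
  have -> : (fun y => rsubmx (X y) 0 i) = (fun y => X y 0 (rshift n i)) by apply/funext => y; rewrite mxE.
  have := is_derive_coord (rshift n i) DX; rewrite /F row_mxEr; exact.
- by rewrite X0 lZ0 rZ0.
Qed.

(** * From proximal subgradients to characteristics *)

Lemma differentiable_quadratic (R : realType) (V : normedModType R) (f : V -> R) (z : V) (Q : R) :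
  (\forall y \near 0, `|f (y + z)| <= Q * `|y| ^+ 2) -> differentiable f z /\ 'd f z = (0 : V ->
  R) :> (V -> R).
Proof.
move=> Hf.
have fz0 : f z = 0.
  have := nbhs_singleton Hf; rewrite add0r normr0 expr0n /= mulr0 normr_le0 => /eqP//.
have c0 : continuous (0 : V -> R) by exact: cst_continuous.
have Hexp : f \o shift z = cst (f z) + (\0 : V -> R) +o_ 0 id.
  apply/landau.eqaddoP => e e0; rewrite fz0.
  have Q1 : 0 < `|Q| + 1 by rewrite ltr_wpDl.
  have eQ : 0 < e / (`|Q| + 1) by rewrite divr_gt0.
  near=> y; rewrite /= !fctE /= addr0 subr0.
  have h : `|f (y + z)| <= Q * `|y| ^+ 2 by near: y.
  apply: le_trans h _; rewrite expr2 mulrA; apply: ler_wpM2r => //.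
  have h2 : `|y| <= e / (`|Q| + 1) by near: y; exact: nbhs0_le.
  move: h2; rewrite ler_pdivlMr // => h2.
  apply: le_trans h2; rewrite mulrC; apply: ler_wpM2l => //.
  by apply: le_trans (ler_norm Q) _; rewrite lerDl.
have dE : 'd f z = (\0 : V -> R) :> (V -> R) by exact: diff_unique.
split; last by rewrite dE.
by apply/diff_locallyP; rewrite dE.
Unshelve. all: by end_near. Qed.

Lemma differentiable_sandwich (R : realType) (V : normedModType R) (f phi : V -> R) (z : V) (Q : R) :
  differentiable phi z -> (\forall y \near 0, `|f (y + z) - phi (y + z)| <= Q * `|y| ^+ 2) ->
  differentiable f z /\ forall v, 'd f z v = 'd phi z v.
Proof.
move=> dphi Hf.
have [de dE] := @differentiable_quadratic R V (fun z => f z - phi z) z Q Hf.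
have fE : f = (fun z => f z - phi z) + phi by apply/funext => y; rewrite fctE subrK.
have dD := diffD de dphi.
split=> [|v]; first by rewrite fE; exact: differentiableD.
have e1 : 'd ((fun z => f z - phi z) + phi) z v = 'd (fun z => f z - phi z) z v + 'd phi z v.
  by rewrite dD.
have e2 : 'd (fun z => f z - phi z) z v = 0.
  by rewrite dE.
rewrite -fE e2 add0r in e1.
exact: e1.
Qed.

Lemma c1curve_C1_open (R : realType) (V : normedModType R) (I : set R) (f f' : R -> V) :
  open I -> c1curve I f f' -> C1_open I f.
Proof.
move=> oI Hf.
have df t : I t -> differentiable f t by move=> It; have [[d _] _] := Hf t It; exact/derivable1_diffP.
split=> // v t It.
apply: (@near_continuous_at _ _ _ (fun y : R => v *: f' y)).
  near=> y; have Iy : I y by near: y; exact: open_nbhs_nbhs.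
  have [D _] := Hf y Iy.
  by rewrite (diff1E (df y Iy)) (derive1_is_derive D).
apply: (@continuous_comp _ _ _ f' (fun w : V => v *: w)); first by have [_] := Hf t It.
exact: scaler_continuous.
Unshelve. all: by end_near. Qed.

(** [char_bound] with a displacement affine in time; the momentum equation turns the linear terms
    into the increment of [<p, h>]. It serves twice: with [w0 = 0], for a displacement growing from
    0, and with [w1] a negative multiple of [w0], for one that shrinks to 0. *)
Lemma upper_bound_linear (R : realType) n (Omega : set 'rV[R]_n) (T : R)
    (H : R * 'rV[R]_n * 'rV[R]_n -> R) (u : R * 'rV[R]_n -> R)
    (t0 : R) (x0 : 'rV[R]_n) (rho L r C th a b : R) (xi p : R -> 'rV[R]_n)
    (g : R -> R) (w0 w1 : 'rV[R]_n) (D : R) :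
  standing Omega T H u ->
  local_setting Omega T H u t0 x0 rho L r C th -> viscosity_subsolution Omega T H u ->
  0 <= a -> a < b -> b <= T -> (forall t, a <= t <= b -> `|t - t0| <= rho) ->
  action_arc H a b xi p g -> momentum_eq H a b xi p ->
  (forall t, a <= t <= b -> `|xi t - x0| <= rho / 4) -> (forall t, a <= t <= b -> `|p t| <= r) ->
  (forall t, a <= t <= b -> `|w0 + (t - a) *: w1| <= rho / 4) ->
  (forall t, a <= t <= b -> dot (w0 + (t - a) *: w1) (w0 + (t - a) *: w1) <= D) ->
  u (b, xi b + (w0 + (b - a) *: w1)) - u (a, xi a + w0) <=
    g b - g a + dot (p b) (w0 + (b - a) *: w1) - dot (p a) w0
    + (dot w1 w1 / (4 * th) + C * D) * (b - a).
Proof.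
move=> hyp loc u_sub a0 ab bT abrho arc pd xrho pr wrho wD; have [xc pc _ _ _] := arc.
have [[rho0 L0 Lr C0 th0] [HO HE HL]] := loc.
pose h t := w0 + (t - a) *: w1.
pose k := dot w1 w1 / (4 * th) + C * D.
pose S t := dot (p t) (h t) + k * (t - a).
pose S' t := dot (- DxH H t (xi t) (p t)) (h t) + dot (p t) w1 + k.
have xO t : a <= t <= b -> Omega (xi t).
  by move=> tt; apply: HO; apply: le_trans (xrho t tt) _; exact: ler_divSn (ltW rho0).
have [cH cHx cHp] := H_comp_within hyp a0 bT xc pc xO.
have cHx' : {within `[a, b], continuous (fun t => - DxH H t (xi t) (p t))}.
  by move=> t; apply: (@cvgN _ 'rV[R]_n); exact: cHx.
have hd (t : R) : is_derive t 1 h w1.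
  apply: is_derive_rV => i.
  have -> : (fun y => h y 0 i) = (fun y => w0 0 i + w1 0 i * (y - a)).
    by apply/funext => y; rewrite !mxE mulrC.
  by apply: is_derive_eq; rewrite /GRing.scale /=; ring.
have hc : {within `[a, b], continuous h}.
  by apply: continuous_in_subspaceT => t _; exact: (is_derive_continuous (hd t)).
have wc : {within `[a, b], continuous (fun=> w1)} by move=> t; exact: cvg_cst.
have Sd t : a < t < b -> is_derive t 1 S (S' t).
  move=> tt; apply: is_deriveD; first exact: (is_derive_dot (pd t tt) (hd t)).
  by apply: is_derive_eq; rewrite /GRing.scale /=; ring.
have lc : {within `[a, b], continuous (fun t => k * (t - a))}.
  apply: continuous_in_subspaceT => t _; apply: cvgM; first exact: cvg_cst.
  by apply: cvgB; [exact: cvg_id | exact: cvg_cst].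
have Sc : {within `[a, b], continuous S}.
  by move=> t; apply: cvgD; [exact: (within_dot pc hc) | exact: lc].
have Sc' : {within `[a, b], continuous S'}.
  move=> t; apply: cvgD; last exact: cvg_cst.
  by apply: cvgD; [exact: (within_dot cHx' hc) | exact: (within_dot pc wc)].
have xrho' t : a <= t <= b -> `|xi t - x0| <= rho.
  by move=> tt; apply: le_trans (xrho t tt) _; exact: ler_divSn (ltW rho0).
have xh t : a <= t <= b -> `|xi t + h t - x0| <= rho / 2.
  move=> tt; rewrite addrAC; apply: le_trans (ler_normD _ _) _.
  have -> : rho / 2 = rho / 4 + rho / 4 by field.
  by apply: lerD; [exact: xrho | exact: wrho].
have HS t : a < t < b -> dot (p t) w1 - dot (DxH H t (xi t) (p t)) (h t)
    + dot w1 w1 / (4 * th) + C * dot (h t) (h t) <= S' t.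
  move=> /andP[t1 t2]; rewrite /S' dotNl /k.
  have h1 : C * dot (h t) (h t) <= C * D by rewrite ler_pM2l //; apply: wD; rewrite !ltW.
  by rewrite addrA [X in X + _ + _]addrC lerD2l.
have := char_bound hyp loc u_sub a0 ab bT abrho arc xrho' pr
  hc wc (fun t _ => hd t) Sc Sc' Sd xh HS.
have ha : h a = w0 by rewrite /h subrr scale0r addr0.
rewrite /S ha -/(h b) -/k subrr mulr0 addr0.
move: (u _) (u _) (dot _ (h b)) (dot _ w0) (k * _) => *; lra.
Qed.

Lemma is_derive_local_lipschitz (R : realType) (V : normedModType R) (X : R -> V) (t : R) (dX : V) :
  is_derive t 1 X dX -> \forall s \near (0 : R), `|X (s + t) - X t| <= (`|dX| + 1) * `|s|.
Proof.
move=> DX; have [d _] := DX; have dt : differentiable X t by exact/derivable1_diffP.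
have /eqaddoP/(_ 1 ltr01) := diff_locally dt.
apply: filterS => s; rewrite mul1r => h.
have {h} h : `|X (s + t) - (X t + 'd X t s)| <= `|s| by exact: h.
have dE : 'd X t s = s *: dX by rewrite (diff1E dt) (derive1_is_derive DX).
rewrite dE in h.
have -> : X (s + t) - X t = (X (s + t) - (X t + s *: dX)) + s *: dX.
  by rewrite opprD addrA subrK.
apply: le_trans (ler_normD _ _) _; rewrite normrZ mulrDl mul1r addrC mulrC.
by rewrite lerD2l.
Qed.

(** The bound measures displacements from [X s] at time [s], whereas differentiability concerns
    increments from [(t, X t)]. As [X] is Lipschitz at [t], the two are comparable, so [u] is within
    a quadratic error of a C1 function and shares its differential. *)
Lemma squeeze_differentiable (R : realType) n (u : R * 'rV[R]_n -> R) (lo hi : R)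
    (X X' P P' : R -> 'rV[R]_n) (G G' : R -> R) (t d Q : R) :
  c1curve `]lo, hi[%classic X X' -> c1curve `]lo, hi[%classic P P' -> c1curve `]lo, hi[%classic G G' ->
  lo < t < hi -> 0 < d -> 0 <= Q ->
  (forall s w, `|s - t| <= d -> `|w| <= d -> `|u (s, X s + w) - G s - dot (P s) w| <= Q * dot w w) ->
  differentiable u (t, X t) /\ Dx u t (X t) = P t.
Proof.
move=> HX HP HG tI d0 Q0 Hu.
have It : `]lo, hi[%classic t by rewrite /= in_itv.
pose phi := paraboloid G P X (fun=> 0).
have HN := @cst_c1curve R R lo hi 0.
have [dphi _] := paraboloid_C1 (@interval_open R (BRight lo) (BLeft hi) isT isT) openT HG HP HX HN.
have {}dphi : differentiable phi (t, X t) by exact: dphi.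
have phiE s x : phi (s, x) = G s + dot (P s) (x - X s).
  by rewrite /phi /paraboloid /= mul0r mul0r addr0.
have [DX _] := HX t It.
(* [|X' t| + 1] is a Lipschitz constant of [X] at [t]; the other 1 accounts for the increment in
   space. *)
pose l := `|X' t| + 1 + 1.
have l0 : 0 < l by rewrite ltr_wpDl // addr_ge0.
have HL := is_derive_local_lipschitz DX.
have nb (e : R) : 0 < e -> \forall y \near (0 : R * 'rV[R]_n), `|y| <= e.
  by move=> e0; exact: (@nbhs0_le R (R * 'rV[R]_n)%type e e0).
have fst0 : (fst y) @[y --> (0 : R * 'rV[R]_n)] --> (0 : R) by exact: cvg_fst.
have near1 := fst0 _ HL.
have near_u : \forall y \near (0 : R * 'rV[R]_n),
    `|u (y + (t, X t)) - phi (y + (t, X t))| <= (Q * (n%:R * l ^+ 2)) * `|y| ^+ 2.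
  near=> y.
  have y1 : `|y.1| <= `|y| by rewrite prod_normE le_max lexx.
  have y2 : `|y.2| <= `|y| by rewrite prod_normE le_max lexx orbT.
  have yd : `|y| <= d by near: y; exact: nb.
  have yl : `|y| <= d / l by near: y; exact: nb (divr_gt0 d0 l0).
  have h : `|X (y.1 + t) - X t| <= (`|X' t| + 1) * `|y.1|.
    by near: y; exact: near1.
  pose w := y.2 + X t - X (y.1 + t).
  have wn : `|w| <= l * `|y|.
    rewrite /w -addrA; apply: le_trans (ler_normD _ _) _; rewrite (distrC (X t)).
    rewrite /l [_ + 1 + 1]addrC mulrDl mul1r; apply: lerD => //.
    by apply: le_trans h _; apply: ler_wpM2l => //; rewrite addr_ge0.
  have wd : `|w| <= d by apply: le_trans wn _; rewrite mulrC -ler_pdivlMr.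
  have sd : `|y.1 + t - t| <= d by rewrite addrK (le_trans y1).
  have -> : y + (t, X t) = (y.1 + t, X (y.1 + t) + w).
    by case: (y) @w wn wd sd h y1 y2 => s v w *; congr (_, _); rewrite /w /= [RHS]addrC subrK.
  rewrite phiE addrAC subrr add0r opprD addrA; apply: le_trans (Hu _ _ sd wd) _.
  rewrite -mulrA; apply: ler_wpM2l => //; apply: le_trans (dot_le_norm _ _) _.
  rewrite -mulrA; apply: ler_wpM2l => //; rewrite -expr2 -exprMn.
  by rewrite lerXn2r // nnegrE // mulr_ge0 // ltW.
have [du dE] := differentiable_sandwich dphi near_u.
split=> //; apply/rowP => i; rewrite Dx_coord // dE -(Dx_coord i dphi).
by rewrite paraboloid_Dx scale0r addr0.
Unshelve. all: by end_near. Qed.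

(** The displacement [(s / t) w] starts at 0 and reaches [w] at time [t]. Its velocity [w / t]
    contributes [|w|^2 / t^2], so the constant is uniform only for times bounded below by [t2]. *)
Lemma upper_bound_quadratic (R : realType) n (Omega : set 'rV[R]_n) (T : R)
    (H : R * 'rV[R]_n * 'rV[R]_n -> R) (u : R * 'rV[R]_n -> R)
    (y0 : 'rV[R]_n) (rho L r C th tau : R) (xi p : R -> 'rV[R]_n) (g : R -> R) (t2 : R) :
  standing Omega T H u ->
  local_setting Omega T H u 0 y0 rho L r C th -> viscosity_subsolution Omega T H u ->
  0 < tau -> tau <= T -> tau <= rho ->
  action_arc H 0 tau xi p g -> momentum_eq H 0 tau xi p ->
  (forall t, 0 <= t <= tau -> `|xi t - y0| <= rho / 4) -> (forall t, 0 <= t <= tau -> `|p t| <= r) ->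
  g 0 = u (0, xi 0) -> 0 < t2 ->
  exists2 Q : R, 0 <= Q & forall t w, t2 <= t <= tau -> `|w| <= rho / 4 ->
    u (t, xi t + w) - g t - dot (p t) w <= Q * dot w w.
Proof.
move=> hyp loc u_sub tau0 tauT taurho arc pd xr pr g0 t20.
have [[rho0 L0 Lr C0 th0] [HO HE HL]] := loc.
have th4 : 0 < 4 * th by rewrite mulr_gt0.
exists ((t2^-1 ^+ 2 / (4 * th) + C) * tau).
  by rewrite mulr_ge0 ?(ltW tau0) // addr_ge0 ?(ltW C0) // divr_ge0 ?sqr_ge0 // ltW.
move=> t w /andP[t2t ttau] wr.
have t0 : 0 < t by exact: lt_le_trans t2t.
pose w1 := t^-1 *: w.
have inn s : 0 <= s <= t -> 0 <= s <= tau by move=> /andP[-> h]; exact: le_trans h ttau.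
have frac s : 0 <= s <= t -> 0 <= s / t <= 1.
  by move=> /andP[s0 st]; rewrite divr_ge0 ?(ltW t0) //= ler_pdivrMr // mul1r.
have hE s : 0 + (s - 0) *: w1 = (s / t) *: w by rewrite add0r subr0 scalerA.
have := upper_bound_linear (w0 := 0) (w1 := w1) (D :=
  dot w w) hyp loc u_sub (lexx 0) t0 (le_trans ttau tauT) _
  (action_arc_W (lexx 0) ttau arc) (momentum_eq_W (lexx 0) ttau pd)
  (fun s ss => xr s (inn s ss)) (fun s ss => pr s (inn s ss)).
rewrite hE divff ?gt_eqF // scale1r addr0 dot0r subr0 subr0 -g0 => h.
have {h} h : u (t, xi t + w) - g 0 <= g t - g 0 + dot (p t) w + (dot w1 w1 / (4 * th) + C * dot w w) * t.
  apply: h => s ss.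
  - by case/andP: (inn s ss) => s0 st; rewrite subr0 ger0_norm // (le_trans st).
  - rewrite hE normrZ; have /andP[f0 f1] := frac s ss.
    by rewrite ger0_norm // (le_trans _ wr) // ler_piMl.
  - rewrite hE dotZl dotZr mulrA; have /andP[f0 f1] := frac s ss.
    by rewrite ler_piMl ?dot_ge0 // mulr_ile1.
have D0 := dot_ge0 w.
have h1 : dot w1 w1 <= t2^-1 ^+ 2 * dot w w.
  rewrite /w1 dotZl dotZr mulrA -expr2; apply: ler_wpM2r => //.
  by rewrite lerXn2r ?nnegrE ?invr_ge0 ?(ltW t0) ?(ltW t20) // lef_pV2 ?posrE.
have h2 : dot w1 w1 / (4 * th) + C * dot w w <= (t2^-1 ^+ 2 / (4 * th) + C) * dot w w.
  rewrite [leRHS](mulrDl (t2^-1 ^+ 2 / (4 * th)) C) lerD2r mulrAC; apply: ler_wpM2r => //.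
  by rewrite invr_ge0 ltW.
have h3 : (dot w1 w1 / (4 * th) + C * dot w w) * t <= (t2^-1 ^+ 2 / (4 * th) + C) * tau * dot w w.
  rewrite [leRHS]mulrAC; apply: ler_pM => //; last exact: ltW.
  by rewrite addr_ge0 // ?divr_ge0 ?mulr_ge0 ?dot_ge0 // ltW.
clear -h h3; lra.
Qed.

Lemma characteristic_of_proximal (R : realType) n (Omega : set 'rV[R]_n) (T : R)
    (H : R * 'rV[R]_n * 'rV[R]_n -> R) (u0 : 'rV[R]_n -> R) (u : R * 'rV[R]_n -> R)
    (y0 p0 : 'rV[R]_n) (tau : R) (xi p : R -> 'rV[R]_n) :
  standing Omega T H u ->
  viscosity_solution Omega T H u0 u -> Omega y0 ->
  proximal_subdifferential u0 y0 p0 -> hamiltonian_solution Omega T H tau y0 p0 xi p ->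
  exists tau0 : R, 0 < tau0 <= tau /\ classical_characteristic Omega T H u 0 tau0 xi.
Proof.
move=> hyp [u_sub u_sup uu0] Oy0 [K K0 HK] [/andP[tau0 tauT] [xc pc] xO xpd [xi0 p00]].
have xd t : 0 < t < tau -> is_derive t 1 xi (DpH H t (xi t) (p t)) by move=> /xpd[].
have pd : momentum_eq H 0 tau xi p by move=> t /xpd[].
have t0T : 0 <= (0 : R) <= T by rewrite lexx (le_trans (ltW tau0)).
have t0tau : 0 <= (0 : R) <= tau by rewrite lexx ltW.
(* The margin 2 leaves 1 for the variation of [p] and 1 for the curvature term of the test gradient
   in [lower_bound]. *)
have [rho [L [r [C [th [loc pr0]]]]]] :=
  local_setting_ex (`|p 0| + 2) hyp t0T Oy0.
have [[rho0 L0 Lr C0 th0] [HO HE HL]] := loc.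
have [rho' rho'0 Hrho'] : exists2 rho' : R, 0 < rho' & forall x, `|x - y0| <= rho' ->
    u (0, y0) + dot (p 0) (x - y0) - K / 2 * dot (x - y0) (x - y0) <= u (0, x).
  have /nbhs_ballP[e /= e0 He] := HK.
  exists (Num.min rho (e / 2)) => [|x]; first by rewrite lt_min rho0 divr_gt0.
  rewrite le_min => /andP[x1 x2]; rewrite p00 !uu0 //; last exact: HO.
  apply: He; rewrite -ball_normE /= distrC; apply: le_lt_trans x2 _.
  by exact: ltr_half.
have [cH cHx cHp] := H_comp_within hyp (lexx 0) tauT xc pc xO.
have cg' : {within `[0, tau], continuous (fun t => dot (p t) (DpH H t (xi t) (p t)) - H (t, xi t, p t))}.
  by move=> t; apply: cvgB; [exact: (within_dot pc cHp) | exact: cH].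
have [F [F0 Fc Fd]] := antiderivative_itv tau0 cg'.
pose g t := u (0, y0) + F t.
have g0 : g 0 = u (0, y0) by rewrite /g F0 addr0.
have gc : {within `[0, tau], continuous g} by move=> t; apply: cvgD; [exact: cvg_cst | exact: Fc].
have gd t : 0 < t < tau -> is_derive t 1 g (dot (p t) (DpH H t (xi t) (p t)) - H (t, xi t, p t)).
  by move=> tt; have := Fd t tt => D; apply: is_derive_eq; rewrite add0r ?mul1r.
have arc : action_arc H 0 tau xi p g by [].
have tauT' : 0 < tau <= T by rewrite tau0.
have [t1 [r1 [M [/andP[t10 t1tau] r10 M0 Hlow]]]] :=
  lower_bound hyp loc u_sup tauT' xi0 pr0 arc pd xO g0 K0 rho'0 Hrho'.
have rho4 : 0 < rho / 4 by rewrite divr_gt0.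
have [dx dx0 Hdx] := within_small xc t0tau rho4.
have [dp dp0 Hdp] := within_small pc t0tau (@ltr01 R).
pose tau1 := Num.min t1 (Num.min rho (Num.min dx dp)).
have tau10 : 0 < tau1 by rewrite !lt_min t10 rho0 dx0 dp0.
have [ta tb tc td] : [/\ tau1 <= t1, tau1 <= rho, tau1 <= dx & tau1 <= dp].
  by split; rewrite !ge_min lexx ?orbT.
have tau1tau : tau1 <= tau := le_trans ta t1tau.
have tau1T : tau1 <= T := le_trans tau1tau tauT.
have inn s : 0 <= s <= tau1 -> 0 <= s <= tau by move=> /andP[-> h]; exact: le_trans h tau1tau.
have ino s : 0 < s < tau1 -> 0 < s < tau by move=> /andP[-> h]; exact: lt_le_trans h tau1tau.
have sn s : 0 <= s <= tau1 -> `|s - 0| <= tau1 by move=> /andP[h1 h2]; rewrite subr0 ger0_norm.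
have xr t : 0 <= t <= tau1 -> `|xi t - y0| <= rho / 4.
  by move=> tt; rewrite -xi0; exact: (Hdx t (inn t tt) (le_trans (sn t tt) tc)).
have pr t : 0 <= t <= tau1 -> `|p t| <= r.
  move=> tt; apply: norm_le_dist pr0 _.
  by apply: le_trans (Hdp t (inn t tt) (le_trans (sn t tt) td)) _; rewrite ler1n.
have hiT : T < T + 1 by rewrite ltrDl.
have bhi := le_lt_trans tauT hiT.
have cHx' : {within `[0, tau], continuous (fun t => - DxH H t (xi t) (p t))}.
  by move=> t; apply: (@cvgN _ 'rV[R]_n); exact: cHx.
have [X [X' [HX XE]]] := c1_extend_rV (ltrN10 R) tau0 bhi xc cHp xd.
have [P [P' [HP PE]]] := c1_extend_rV (ltrN10 R) tau0 bhi pc cHx' pd.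
have [G [G' [HG GE]]] := c1_extend (ltrN10 R) tau0 bhi gc cg' gd.
exists tau1; split; first by rewrite tau10.
split; first by rewrite lexx tau10.
split.
- exists `]-1, T + 1[%classic, X; split.
  + exact: interval_open.
  + by move=> t; rewrite /= !in_itv /= => /andP[h1 h2];
    rewrite (lt_le_trans (ltrN10 R) h1) (le_lt_trans (le_trans h2 tau1T) hiT).
  + by move=> t; rewrite /= in_itv /= => /inn tt; have [-> _] := XE t tt.
  + by apply: c1curve_C1_open HX; exact: interval_open.
- by move=> t tt; apply: xO; exact: inn.
move=> t /[dup] tt /andP[t0 ttau1].
have tt' : 0 <= t <= tau1 by rewrite !ltW.
have [Xt _] := XE t (inn t tt'); have [Pt _] := PE t (inn t tt').
have D := xd t (ino t tt).
suff [du dxu] : differentiable u (t, X t) /\ Dx u t (X t) = P t.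
  rewrite Xt Pt in du dxu.
  by split; [exact: du | rewrite (derive1_is_derive D) dxu].
have t20 : 0 < t / 2 by rewrite divr_gt0.
have g0' : g 0 = u (0, xi 0) by rewrite xi0.
have [Q Q0 HQ] := upper_bound_quadratic hyp loc u_sub tau10 tau1T tb
  (action_arc_W (lexx 0) tau1tau arc) (momentum_eq_W (lexx 0) tau1tau pd) xr pr g0' t20.
(* Times within [d] of [t] stay in [[t / 2, tau1]], where [Q] is uniform, and displacements of norm
   at most [d] satisfy both one-sided bounds. *)
pose d := Num.min (Num.min (t / 2) (tau1 - t)) (Num.min (rho / 4) r1).
have d0 : 0 < d by rewrite !lt_min t20 subr_gt0 ttau1 rho4 r10.
have [da db dc dd] : [/\ d <= t / 2, d <= tau1 - t, d <= rho / 4 & d <= r1].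
  by split; rewrite !ge_min lexx ?orbT.
have tI : -1 < t < T + 1 by rewrite (lt_trans (ltrN10 R) t0) (lt_trans (lt_le_trans ttau1 tau1T) hiT).
have QM : 0 <= Q + M / 2 by rewrite addr_ge0 // divr_ge0 // ltW.
apply: (squeeze_differentiable HX HP HG tI d0 QM) => s w sd wd.
have {}sd : t / 2 <= s <= tau1.
  move: sd; rewrite ler_distl => /andP[h1 h2]; apply/andP; split.
    by apply: le_trans h1; rewrite lerBrDr [X in _ <= X](splitr t) lerD2l.
  by apply: le_trans h2 _; rewrite addrC -lerBrDr.
have s0 : 0 <= s <= tau1 by case/andP: sd => h1 ->; rewrite (le_trans (ltW t20) h1).
have s1 : 0 <= s <= t1 by case/andP: s0 => -> h; exact: le_trans h ta.
have [-> _] := XE s (inn s s0); have [-> _] := PE s (inn s s0); have [-> _] := GE s (inn s s0).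
have h1 := HQ s w sd (le_trans wd dc).
have h2 := Hlow s w s1 (le_trans wd dd).
rewrite ler_norml mulrDl.
have h3 : 0 <= Q * dot w w by rewrite mulr_ge0 ?dot_ge0.
have h4 : 0 <= M / 2 * dot w w by rewrite mulr_ge0 ?dot_ge0 // divr_ge0 // ltW.
clear -h1 h2 h3 h4; lra.
Qed.

(** * From characteristics to proximal subgradients *)

Lemma itv_interior_near (R : realType) (a b t d : R) : a < b -> a <= t <= b -> 0 < d ->
  exists2 s : R, a < s < b & `|s - t| <= d.
Proof.
move=> ab /andP[ta tb] d0.
have [h|h] := leP t ((a + b) / 2).
  exists (t + Num.min d ((b - a) / 4)); last first.
    by rewrite addrAC subrr add0r ger0_norm ?ge_min ?lexx // le_min (ltW d0) divr_ge0 // subr_ge0 ltW.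
  have m1 : Num.min d ((b - a) / 4) <= (b - a) / 4 by rewrite ge_min lexx orbT.
  have m2 : 0 < Num.min d ((b - a) / 4) by rewrite lt_min d0 divr_gt0 // subr_gt0.
  by apply/andP; split; lra.
exists (t - Num.min d ((b - a) / 4)); last first.
  by rewrite addrAC subrr add0r normrN ger0_norm ?ge_min ?lexx // le_min (ltW d0) divr_ge0 // subr_ge0 ltW.
have m1 : Num.min d ((b - a) / 4) <= (b - a) / 4 by rewrite ge_min lexx orbT.
have m2 : 0 < Num.min d ((b - a) / 4) by rewrite lt_min d0 divr_gt0 // subr_gt0.
by apply/andP; split; lra.
Qed.

(** The hypothesis is the Cauchy criterion at every point of the closed interval, the endpoints
    included; [P] is the pointwise limit of [p] along interior points. *)
Lemma continuous_extension (R : realType) n (p : R -> 'rV[R]_n) (a b : R) :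
  a < b ->
  (forall t0, a <= t0 <= b -> forall e, 0 < e -> exists2 d : R, 0 < d &
     forall s t, a < s < b -> a < t < b -> `|s - t0| <= d -> `|t - t0| <= d -> `|p s - p t| <= e) ->
  exists2 P : R -> 'rV[R]_n, {within `[a, b], continuous P} & forall t, a < t < b -> P t = p t.
Proof.
move=> ab Hp.
(* Outside [[a, b]] the limit is given the arbitrary value 0. *)
have lim t0 : exists l, a <= t0 <= b -> forall e, 0 < e -> exists2 d : R, 0 < d &
    forall s, a < s < b -> `|s - t0| <= d -> `|p s - l| <= e.
  have [t0ab|?] := boolP (a <= t0 <= b); last by exists 0.
  pose F := p @ within `]a, b[%classic (nbhs t0).
  have FF : ProperFilter F.
    apply: fmap_proper_filter; apply: Build_ProperFilter_ex => S [e /= e0 He].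
    have [s sab st] := itv_interior_near ab t0ab (divr_gt0 e0 (@ltr0Sn R 1)).
    exists s; apply: He; last by rewrite /= in_itv.
    by rewrite /= distrC; apply: le_lt_trans st _; exact: ltr_half.
  have /cauchy_cvgP Fc : cauchy F.
    apply/cauchy_ballP => e e0; have [d d0 Hd] := Hp t0 t0ab (e / 2) (divr_gt0 e0 (@ltr0Sn R 1)).
    have N : \forall s \near within `]a, b[%classic (nbhs t0), a < s < b /\ `|s - t0| <= d.
      exists d => //= s sd; rewrite in_itv /= => sab; split=> //; apply: ltW; by rewrite distrC.
    exists (p @` [set s | a < s < b /\ `|s - t0| <= d], p @` [set s | a < s < b /\ `|s - t0| <= d]).
      by split; apply: filterS N => s Ns; exists s.
    move=> [x y] /= [[s [s1 s2] <-] [t [h1 h2] <-]]; rewrite -ball_normE /=.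
    by apply: le_lt_trans (Hd s t s1 h1 s2 h2) _; exact: ltr_half.
  have [l Fl] : exists l : 'rV[R]_n, F --> l by exists (lim F).
  exists l => _ e e0; move/cvgrPdist_le: Fl => /(_ e e0) [d /= d0 Hd].
  exists (d / 2); first by rewrite divr_gt0.
  move=> s sab sd; rewrite distrC; apply: Hd; last by rewrite /= in_itv.
  by rewrite /= distrC; apply: le_lt_trans sd _; exact: ltr_half.
have [P HP] := choice lim.
exists P.
  apply: within_continuousP => t0 t0ab e e0.
  have e2 : 0 < e / 2 by rewrite divr_gt0.
  have [d d0 Hd] := HP t0 t0ab _ e2.
  exists (d / 2); first by rewrite divr_gt0.
  move=> t tab td; have [d' d'0 Hd'] := HP t tab _ e2.
  have m0 : 0 < Num.min d' (d / 2) by rewrite lt_min d'0 divr_gt0.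
  have [s sab] := itv_interior_near ab tab m0; rewrite le_min => /andP[s1 s2].
  have h1 := Hd' s sab s1.
  have st : `|s - t0| <= d.
    rewrite -(subrK t s) -addrA (splitr d); apply: le_trans (ler_normD _ _) _; exact: lerD.
  have h2 := Hd s sab st.
  have -> : P t - P t0 = (p s - P t0) - (p s - P t) by rewrite opprB [RHS]addrC addrA subrK.
  rewrite (splitr e); apply: le_trans (ler_normB _ _) _; exact: lerD.
move=> t tab; apply/eqP; rewrite -subr_eq0 -normr_le0; apply/ler_addgt0Pr => e e0; rewrite add0r.
have tt : a <= t <= b by case/andP: tab => ? ?; rewrite !ltW.
have [d d0 Hd] := HP t tt e e0.
by rewrite distrC; apply: Hd; rewrite // subrr normr0 ltW.
Qed.

Lemma is_derive_littleo (R : realType) (f : R -> R) (t a : R) :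
  (forall e, 0 < e -> exists2 d : R, 0 < d &
     forall s, `|s - t| <= d -> `|f s - f t - (s - t) * a| <= e * `|s - t|) ->
  is_derive t 1 f a.
Proof.
move=> Hf.
have C : h^-1 *: (f (h *: (1 : R) + t) - f t) @[h --> 0^'] --> a.
  apply/cvgrPdist_le => e e0; have [d d0 Hd] := Hf e e0.
  exists d => // h /=; rewrite sub0r normrN => hd h0.
  have := Hd (h *: (1 : R) + t); rewrite addrK [h *: 1]mulr1 => /(_ (ltW hd)) hh.
  have nh : 0 < `|h| by rewrite normr_gt0.
  rewrite -(ler_pM2r nh) -normrM.
  have -> : (a - h^-1 *: (f (h + t) - f t)) * h = - (f (h + t) - f t - h * a).
    by rewrite /GRing.scale /=; field.
  by rewrite normrN.
apply: DeriveDef; first by apply/cvg_ex; exists a.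
exact: cvg_lim C.
Qed.

Lemma C1_on_itv_derive (R : realType) (V : normedModType R) (a b : R) (f : R -> V) : a < b ->
  C1_on `[a, b] f -> exists f' : R -> V,
  [/\ {within `[a, b], continuous f}, {within `[a, b], continuous f'}
    & forall t, a < t < b -> is_derive t 1 f (f' t)].
Proof.
move=> ab [U [g [oU IU fg [dg cg]]]].
have IU' t : a <= t <= b -> U t by move=> tt; apply: IU; rewrite /= in_itv.
have fg' t : a <= t <= b -> f t = g t by move=> tt; apply: fg; rewrite /= in_itv.
exists (fun t => 'd g t 1); split.
- apply: within_continuousP => t0 t0ab e e0.
  have gc : {for t0, continuous g} by apply: differentiable_continuous; apply: dg; exact: IU'.
  move/cvgrPdist_le: gc => /(_ e e0) [d /= d0 Hd]; exists (d / 2); first by rewrite divr_gt0.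
  move=> t tab td; rewrite !fg' // distrC; apply: Hd.
  by rewrite /= distrC; apply: le_lt_trans td _; exact: ltr_half.
- apply: continuous_in_subspaceT => t; rewrite inE /= in_itv /= => tab.
  by apply: cg; exact: IU'.
move=> t /andP[ta tb].
have tab : a <= t <= b by rewrite !ltW.
have dt := dg t (IU' t tab).
have D : is_derive t 1 g ('d g t 1).
  by apply: DeriveDef; [exact: diff_derivable | exact: deriveE].
apply: (near_eq_is_derive _ D).
have It : `]a, b[%classic t by rewrite /= in_itv /= ta.
have := open_nbhs_nbhs (conj (@interval_open R (BRight a) (BLeft b) isT isT) It).
by apply: filterS => s; rewrite /= in_itv /= => /andP[h1 h2]; rewrite fg' // !ltW.
Qed.

(** The strict inequality on [x] leaves room for a small step along each ['e_i] inside the box,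
    where the Lipschitz bound on [u] controls the corresponding component of [q]. *)
Lemma slope_le_lipschitz (R : realType) n (u : R * 'rV[R]_n -> R) (T t0 t : R)
    (x0 x q : 'rV[R]_n) (rho L a1 : R) :
  lipschitz_box u T t0 x0 rho L -> 0 <= L -> 0 <= t <= T -> `|t - t0| <= rho -> `|x - x0| < rho ->
  first_order u t x a1 q -> `|q| <= L.
Proof.
move=> HL L0 tT tr xr fo; apply: norm_le_coord => // i; apply/ler_addgt0Pr => e e0.
have [d d0 Hd] := fo e e0.
pose m := Num.min d (rho - `|x - x0|).
have m0 : 0 < m by rewrite lt_min d0 subr_gt0.
have md : m <= d by rewrite ge_min lexx.
have mr : m <= rho - `|x - x0| by rewrite ge_min lexx orbT.
have em : `|m *: ('e_i : 'rV[R]_n)| <= m.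
  apply: norm_le_coord => [|j]; first exact: ltW.
  by rewrite !mxE /= normrM (ger0_norm (ltW m0)) ler_piMr ?(ltW m0) //; case: (_ == _);
    rewrite ?normr1 ?normr0.
have tt0 : `|t - t| <= m by rewrite subrr normr0 ltW.
have := Hd m t (m *: 'e_i) md tt0 em; rewrite subrr mulr0 subr0 dotZr dot_delta => h1.
have xm : `|x + m *: 'e_i - x0| <= rho.
  rewrite addrAC; apply: le_trans (ler_normD _ _) _; clear -em mr; lra.
have := HL t t x (x + m *: 'e_i) tT tT tr tr (ltW xr) xm.
rewrite subrr normr0 add0r [x + _]addrC addrK => h2.
have h3 : L * `|m *: ('e_i : 'rV[R]_n)| <= L * m by rewrite ler_wpM2l.
rewrite -(ler_pM2l m0) -{1}(gtr0_norm m0) -normrM.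
have -> : m * q 0 i = (u (t, m *: 'e_i + x) - u (t, x)) - (u (t, m *: 'e_i + x) - u (t, x) - m * q
  0 i) by ring.
apply: le_trans (ler_normB _ _) _; rewrite mulrDr (mulrC m L) (mulrC m e); apply: lerD.
  exact: le_trans h2 h3.
by move: h1; rewrite [x + _]addrC.
Qed.

(** Adding the strong convexity inequalities at [p] and at [q] gives [2 th |q - p|^2 <= <D_p H(q) -
    D_p H(p), q - p>] at a common base point; moving the base point costs [C (|t - s| + |y - x|)].
    So the inverse of the Legendre map is Lipschitz: this gives both the continuity of [D_x u] along
    a characteristic and the uniqueness of the momentum. *)
Lemma gradient_le_velocity (R : realType) n (H : R * 'rV[R]_n * 'rV[R]_n -> R) (T : R)
    (x0 : 'rV[R]_n) (rho r C th : R) (s t : R) (x y p q : 'rV[R]_n) :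
  0 < C -> 0 < th -> box_estimates H T x0 rho r C th -> 0 <= s <= T -> 0 <= t <= T ->
  `|x - x0| <= rho -> `|y - x0| <= rho -> `|p| <= r -> `|q| <= r ->
  2 * th * `|q - p| <= n%:R * (`|DpH H t y q - DpH H s x p| + C * (`|t - s| + `|y - x|)).
Proof.
move=> C0 th0 HE sT tT xr yr pr qr.
have [_ _ _ _ e1] := HE s s x x p q sT sT xr xr pr qr.
have [_ _ _ _ e2] := HE s s x x q p sT sT xr xr qr pr.
have [_ _ e3 _ _] := HE s t x y q q sT tT xr yr qr qr.
rewrite !subrr !normr0 ?addr0 !dot0r mulr0 !subr0 in e1 e2 e3.
set v := q - p in e1 *.
have ev : p - q = - v by rewrite opprB.
clearbody v.
rewrite ev !dotE opprK ?addr0 in e2; rewrite ?addr0 in e1 e2 e3.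
have e4 : 2 * th * dot v v <= dot (DpH H s x q - DpH H s x p) v.
  rewrite dotDl dotNl; clear -e1 e2; lra.
have e5 := dot_le_norm (DpH H s x q - DpH H s x p) v.
have e6 := sqr_norm_le_dot v.
have e7 : `|DpH H s x q - DpH H s x p| <= `|DpH H t y q - DpH H s x p| + C * (`|t - s| + `|y - x|).
  have -> : DpH H s x q - DpH H s x p = (DpH H t y q - DpH H s x p) - (DpH H t y q - DpH H s x q).
    by rewrite opprB [RHS]addrC addrA subrK.
  by apply: le_trans (ler_normB _ _) _; rewrite lerD2l.
have [->|v0] := eqVneq v 0.
  by rewrite normr0 mulr0 mulr_ge0 ?ler0n // addr_ge0 // mulr_ge0 ?(ltW C0) // addr_ge0.
have nv : 0 < `|v| by rewrite normr_gt0.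
rewrite -(ler_pM2r nv) -[leLHS]mulrA -(expr2 `|v|).
apply: le_trans (_ : 2 * th * dot v v <= _); first by rewrite ler_wpM2l // mulr_ge0 // ltW.
apply: le_trans e4 (le_trans e5 _); rewrite -mulrA ler_wpM2l ?ler0n //.
by rewrite ler_wpM2r // ltW.
Qed.

Section Converse.
Variables (R : realType) (n : nat) (Omega : set 'rV[R]_n) (T : R).
Variables (H : R * 'rV[R]_n * 'rV[R]_n -> R) (u : R * 'rV[R]_n -> R).
Hypotheses (hyp : standing Omega T H u).

Lemma momentum_ex (tau : R) (xi : R -> 'rV[R]_n) :
  classical_characteristic Omega T H u 0 tau xi ->
  exists2 P : R -> 'rV[R]_n, {within `[0, tau], continuous P} &
    forall t, 0 < t < tau -> P t = Dx u t (xi t).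
Proof.
move=> [[_ tau0 tauT] [xC1 xO xch]].
have [xi' [xc xc' xd]] := C1_on_itv_derive tau0 xC1.
have xE t : 0 < t < tau -> xi' t = DpH H t (xi t) (Dx u t (xi t)).
  by move=> tt; have [_ <-] := xch t tt; rewrite (derive1_is_derive (xd t tt)).
apply: continuous_extension => // t0 t0tau e e0.
have t0T : 0 <= t0 <= T by case/andP: t0tau => -> h; exact: le_trans h tauT.
(* No momentum has to be prescribed: where [u] is differentiable its gradient is bounded by
   [L <= r]. *)
have [rho [L [r [C [th [loc _]]]]]] :=
  local_setting_ex 0 hyp t0T (xO t0 t0tau).
have [[rho0 L0 Lr C0 th0] [HO HE HL]] := loc.
have k0 : 0 < (n.+1)%:R * (2 + 4 * C) by rewrite mulr_gt0 ?ltr0Sn // addr_gt0 // mulr_gt0.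
(* Between two times close to [t0], velocity, time and position each vary by at most [2 * eta], so
   the right-hand side of [gradient_le_velocity] is at most [n * eta * (2 + 4 * C)]. *)
pose eta := 2 * th * e / ((n.+1)%:R * (2 + 4 * C)).
have eta0 : 0 < eta by rewrite divr_gt0 // !mulr_gt0.
have rho2 : 0 < rho / 2 by rewrite divr_gt0.
have [d1 d10 Hd1] := within_small xc t0tau rho2.
have [d2 d20 Hd2] := within_small xc t0tau eta0.
have [d3 d30 Hd3] := within_small xc' t0tau eta0.
exists (Num.min (Num.min d1 d2) (Num.min d3 (Num.min eta rho))).
  by rewrite !lt_min d10 d20 d30 eta0.
have bounds s : 0 < s < tau -> `|s - t0| <= Num.min (Num.min d1 d2) (Num.min d3 (Num.min eta rho)) ->
    [/\ 0 <= s <= T, `|xi s - xi t0| <= rho, `|Dx u s (xi s)| <= r &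
    [/\ `|s - t0| <= eta, `|xi s - xi t0| <= eta & `|xi' s - xi' t0| <= eta]].
  move=> ss; rewrite !le_min => /andP[/andP[s1 s2] /and3P[s3 s4 s5]].
  have ss' : 0 <= s <= tau by case/andP: ss => ? ?; rewrite !ltW.
  have sT : 0 <= s <= T by case/andP: ss' => -> h; exact: le_trans h tauT.
  have xr := Hd1 s ss' s1.
  have xr' : `|xi s - xi t0| < rho by apply: le_lt_trans xr _; exact: ltr_half.
  split=> //; first exact: ltW.
    have [du _] := xch s ss; have [fo _] := differentiable_first_order du.
    exact: le_trans (slope_le_lipschitz HL (ltW L0) sT s5 xr' fo) Lr.
  by split=> //; [exact: Hd2 | exact: Hd3].
move=> s t ss tt sd td.
have [sT xs ps [s1 s2 s3]] := bounds s ss sd; have [tT xt pt [t1 t2 t3]] := bounds t tt td.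
have tri (V : normedModType R) (f : R -> V) : `|f s - f t0| <= eta -> `|f t - f t0| <= eta ->
    `|f s - f t| <= eta + eta.
  move=> h1 h2; have -> : f s - f t = (f s - f t0) - (f t - f t0) by rewrite opprB addrA subrK.
  by apply: le_trans (ler_normB _ _) _; exact: lerD.
have := gradient_le_velocity C0 th0 HE tT sT xt xs pt ps.
rewrite -!xE // => h.
have h1 := tri _ xi' s3 t3; have h2 := tri _ xi s2 t2; have h3 := tri _ id s1 t1.
have h4 : `|xi' s - xi' t| + C * (`|s - t| + `|xi s - xi t|) <= eta * (2 + 4 * C).
  have : C * (`|s - t| + `|xi s - xi t|) <= C * (eta + eta + (eta + eta)) by rewrite ler_pM2l // lerD.
  clear -h1; lra.
have th2 : 0 < 2 * th by rewrite mulr_gt0.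
rewrite -(ler_pM2l th2); apply: le_trans h _.
apply: le_trans (_ : n.+1%:R * (eta * (2 + 4 * C)) <= _).
  by apply: ler_pM; rewrite ?ler0n ?ler_nat // addr_ge0 // mulr_ge0 ?(ltW C0) // addr_ge0.
by rewrite mulrCA /eta divfK ?gt_eqF.
Qed.

Lemma equation_at_differentiable (t : R) (x : 'rV[R]_n) :
  viscosity_subsolution Omega T H u -> viscosity_supersolution Omega T H u ->
  0 < t < T -> Omega x -> differentiable u (t, x) -> 'd u (t, x) (1, 0) = - H (t, x, Dx u t x).
Proof.
move=> sub sup tT Ox du; have [fo _] := differentiable_first_order du.
have h1 := subsolution_first_order hyp tT Ox fo sub.
have h2 := supersolution_first_order hyp tT Ox fo sup.
by apply/eqP; rewrite -addr_eq0 eq_le h1 h2.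
Qed.

(** The chain rule with [d_t u] replaced through the equation. It identifies [u] along [xi] as the
    function [g] of an action arc. *)
Lemma is_derive_along (t : R) (xi : R -> 'rV[R]_n) (dxi : 'rV[R]_n) :
  viscosity_subsolution Omega T H u -> viscosity_supersolution Omega T H u ->
  0 < t < T -> Omega (xi t) -> differentiable u (t, xi t) -> is_derive t 1 xi dxi ->
  is_derive t 1 (fun s => u (s, xi s)) (dot (Dx u t (xi t)) dxi - H (t, xi t, Dx u t (xi t))).
Proof.
move=> sub sup tT Ox du D.
have [_ duE] := differentiable_first_order du.
have Dc : is_derive t 1 (fun s : R => (s, xi s)) ((1 : R), dxi).
  have [dx <-] := D.
  have cc : (h^-1 *: ((h *: (1 : R) + t, xi (h *: (1 : R) + t)) - (t, xi t))) @[h --> 0^'] --> ((1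
    : R), 'D_1 xi t).
    have c1 : (h^-1 *: ((h *: (1 : R) + t) - t)) @[h --> (0 : R)^'] --> (1 : R).
      by have [h E] := @is_derive_id R R t 1; rewrite -[X in _ --> X]E; exact: h.
    exact: (cvg_pair c1 dx).
  apply: DeriveDef; first by apply/cvg_ex; exists ((1 : R), 'D_1 xi t).
  exact: cvg_lim cc.
have := is_derive_chain Dc du; rewrite duE mulr1 addrC.
by rewrite equation_at_differentiable.
Qed.

End Converse.

Section Momentum.
Variables (R : realType) (n : nat) (Omega : set 'rV[R]_n) (T : R).
Variables (H : R * 'rV[R]_n * 'rV[R]_n -> R) (u : R * 'rV[R]_n -> R).
Hypotheses (hyp : standing Omega T H u)
  (u_sub : viscosity_subsolution Omega T H u).

(** Take the constant displacement [eps *: v] in [char_bound]. Differentiability of [u] at both ends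
    turns the increment of [u] along the displaced arc into that along [xi] plus
    [eps * <P b - P a, v>] and [o(eps)]; the former equals [g b - g a] and cancels. Divide by [eps]
    and let it tend to 0. *)
Lemma momentum_increment (t0 : R) (x0 : 'rV[R]_n) (rho L r C th a b : R)
    (xi P : R -> 'rV[R]_n) (g : R -> R) (v : 'rV[R]_n) (m aa ab : R) :
  local_setting Omega T H u t0 x0 rho L r C th ->
  0 <= a -> a < b -> b <= T -> (forall t, a <= t <= b -> `|t - t0| <= rho) ->
  action_arc H a b xi P g ->
  (forall t, a <= t <= b -> `|xi t - x0| <= rho / 4) -> (forall t, a <= t <= b -> `|P t| <= r) ->
  first_order u a (xi a) aa (P a) -> first_order u b (xi b) ab (P b) ->
  g a = u (a, xi a) -> g b = u (b, xi b) ->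
  (forall t, a < t < b -> dot (- DxH H t (xi t) (P t)) v <= m) ->
  dot (P b - P a) v <= (b - a) * m.
Proof.
move=> loc a0 lab bT abrho arc xrho pr foa fob ga gb Hm.
have [[rho0 L0 Lr C0 th0] [HO HE HL]] := loc.
have rho4 : rho / 4 <= rho by exact: ler_divSn (ltW rho0).
have ba : 0 < b - a by rewrite subr_gt0.
have v0 : 0 <= dot v v := dot_ge0 v.
have nv : 0 < `|v| + 1 by rewrite ltr_pwDr.
(* [k * e] collects what is left after division by [eps]: the quadratic term of [char_bound], where
   [eps <= e], and the two errors of the first-order expansions. *)
pose k := (b - a) * C * dot v v + 2 * (`|v| + 1).
have k0 : 0 < k.
  by rewrite ltr_wpDl ?mulr_gt0 // !mulr_ge0 // ltW.
apply/ler_addgt0Pr => e' e'0; pose e := e' / k.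
have e0 : 0 < e by rewrite divr_gt0.
have [da da0 Hda] := foa e e0; have [db db0 Hdb] := fob e e0.
pose eps := Num.min e (Num.min (rho / 4) (Num.min da db) / (`|v| + 1)).
have eps0 : 0 < eps by rewrite lt_min e0 divr_gt0 // !lt_min da0 db0 divr_gt0.
have epse : eps <= e by rewrite ge_min lexx.
pose mm := eps * (`|v| + 1).
have mmle : mm <= Num.min (rho / 4) (Num.min da db).
  by rewrite /mm -ler_pdivlMr // ge_min lexx orbT.
move: mmle; rewrite !le_min => /and3P[mr ma mb].
have evm : `|eps *: v| <= mm.
  by rewrite normrZ (gtr0_norm eps0) ler_pM2l // lerDl.
have mm0 : 0 <= mm by apply: le_trans evm.
have att : `|a - a| <= mm by rewrite subrr normr0.
have btt : `|b - b| <= mm by rewrite subrr normr0.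
have := Hda mm a (eps *: v) ma att evm; have := Hdb mm b (eps *: v) mb btt evm.
rewrite !subrr !mulr0 !subr0 !dotZr => hb ha.
pose S t := (eps * m + C * (eps ^+ 2 * dot v v)) * t.
have Sd (t : R) : is_derive t 1 S (eps * m + C * (eps ^+ 2 * dot v v)).
  by apply: is_derive_eq; rewrite /GRing.scale /=; ring.
have Sc : {within `[a, b], continuous S}.
  by apply: continuous_in_subspaceT => t _; exact: (is_derive_continuous (Sd t)).
have := char_bound hyp loc u_sub a0 lab bT abrho arc
  (fun t tt => le_trans (xrho t tt) rho4) pr (h := fun=> eps *: v) (h' := fun=> 0) (S := S)
  (S' := fun=> eps * m + C * (eps ^+ 2 * dot v v)).
move=> /(_ (fun t => cvg_cst _) (fun t => cvg_cst _) (fun t _ => is_derive_cst _ _ _) Sc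
  (fun t => cvg_cst _) (fun t _ => Sd t)) cb.
have {cb} cb : u (b, xi b + eps *: v) - u (a, xi a + eps *: v) <= g b + S b - (g a + S a).
  apply: cb => [t tt|t tt].
    rewrite addrAC; apply: le_trans (ler_normD _ _) _.
    have -> : rho / 2 = rho / 4 + rho / 4 by field.
    by apply: lerD; [exact: xrho | exact: le_trans evm mr].
  have := Hm t tt; rewrite !dot0r mul0r addr0 sub0r !dotZr !dotZl (mulrA eps eps (dot v v)) -(expr2
    eps) dotNl => h.
  by rewrite lerD2r -mulrN ler_pM2l.
move: ha hb; rewrite !ler_norml => /andP[ha1 ha2] /andP[hb1 hb2].
have D : dot (P b - P a) v = dot (P b) v - dot (P a) v by rewrite dotDl dotNl.
have h1 : eps * dot (P b - P a) v <= eps * ((b - a) * m + (b - a) * C * dot v v * eps + 2 * (`|v| + 1) * e).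
  rewrite D; move: cb ha1 ha2 hb1 hb2; rewrite /S /mm ga gb.
  move: (u (b, xi b + _)) (u (a, xi a + _)) (dot v v) => U1 U2 w.
  clear; move=> h1 h2 h3 h4 h5; lra.
move: h1; rewrite ler_pM2l // => h1.
have h2 : (b - a) * C * dot v v * eps <= (b - a) * C * dot v v * e.
  by rewrite ler_wpM2l // !mulr_ge0 // ltW.
have h3 : k * e = e' by rewrite /e mulrCA divff ?gt_eqF // mulr1.
rewrite -h3 /k; clear -h1 h2; lra.
Qed.

(** [momentum_increment] between [t0] and a nearby time, with [v] equal to ['e_i] and to [- 'e_i],
    encloses the increment of each component of [P]; continuity of [D_x H] along the arc makes the
    enclosure [o(s - t0)]. *)
Lemma momentum_derive (tau : R) (xi P : R -> 'rV[R]_n) (g : R -> R) :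
  viscosity_supersolution Omega T H u ->
  tau <= T -> action_arc H 0 tau xi P g -> (forall t, 0 <= t <= tau -> Omega (xi t)) ->
  (forall t, 0 < t < tau -> differentiable u (t, xi t) /\ P t = Dx u t (xi t)) ->
  (forall t, g t = u (t, xi t)) -> momentum_eq H 0 tau xi P.
Proof.
move=> u_sup tauT arc xO uP gE t0 t0tau; have [xc pc _ _ _] := arc.
have t0tau' : 0 <= t0 <= tau by case/andP: t0tau => ? ?; rewrite !ltW.
have t0T : 0 <= t0 <= T by case/andP: t0tau' => -> h; exact: le_trans h tauT.
have [rho [L [r [C [th [loc pr0]]]]]] :=
  local_setting_ex (`|P t0| + 1) hyp t0T (xO t0 t0tau').
have [[rho0 L0 Lr C0 th0] [HO HE HL]] := loc.
have rho4 : 0 < rho / 4 by rewrite divr_gt0.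
have [_ cHx _] := H_comp_within hyp (lexx 0) tauT xc pc xO.
have [d1 d10 Hd1] := within_small xc t0tau' rho4.
have [d2 d20 Hd2] := within_small pc t0tau' (@ltr01 R).
apply: is_derive_rV => i; apply: is_derive_littleo => e e0.
have [d3 d30 Hd3] := within_small cHx t0tau' e0.
have [t00 t0t] := andP t0tau.
pose d := Num.min (Num.min (t0 / 2) ((tau - t0) / 2)) (Num.min (Num.min d1 d2) (Num.min d3 rho)).
have d0 : 0 < d by rewrite !lt_min d10 d20 d30 rho0 !divr_gt0 // subr_gt0.
have dle s : `|s - t0| <= d -> 0 < s < tau /\
  [/\ `|s - t0| <= d1, `|s - t0| <= d2, `|s - t0| <= d3 & `|s - t0| <= rho].
  rewrite !le_min => /andP[/andP[h1 h2] /and3P[/andP[h3 h4] h5 h6]]; split; last by split.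
  move: h1 h2; rewrite !ler_distl => /andP[h1 _] /andP[_ h2].
  by apply/andP; split; lra.
(* The condition [dot w v <= |w|], with the sup norm of [w], holds for the two vectors in view, plus
   and minus ['e_i], and avoids a dimensional factor. *)
have incr a b v : `|v| <= 1 -> (forall w : 'rV[R]_n, dot w v <= `|w|) -> a < b -> `|a - t0| <= d ->
`|b - t0| <= d ->
    dot (P b - P a) v <= (b - a) * (dot (- DxH H t0 (xi t0) (P t0)) v + e).
  move=> v1 Hv lab ad bd.
  have [a0 _] := dle a ad; have [b0 _] := dle b bd.
  have abd t : a <= t <= b -> `|t - t0| <= d.
    by move=> /andP[h1 h2]; move: ad bd; rewrite !ler_distl; clear -h1 h2 => *; apply/andP; split; lra.
  have inn t : a <= t <= b -> 0 < t < tau by move=> /abd /dle[].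
  have inn' t : a <= t <= b -> 0 <= t <= tau by move=> /inn /andP[h1 h2]; rewrite !ltW.
  have ino t : a < t < b -> a <= t <= b by move=> /andP[h1 h2]; rewrite !ltW.
  have [[a00 a0t] [b00 b0t]] := (andP a0, andP b0).
  have [dua Pa] := uP a a0; have [dub Pb] := uP b b0.
  have [foa _] := differentiable_first_order dua; have [fob _] := differentiable_first_order dub.
  rewrite -Pa in foa; rewrite -Pb in fob.
  apply: (momentum_increment loc (ltW a00) lab (le_trans (ltW b0t) tauT) _
    (action_arc_W (ltW a00) (ltW b0t) arc) _ _ foa fob (gE a) (gE b)).
  - by move=> t /abd /dle[_ []].
  - by move=> t tt; have [_ [? _ _ _]] := dle t (abd t tt); exact: Hd1 (inn' t tt) _.
  - move=> t tt; have [_ [_ h _ _]] := dle t (abd t tt); have := Hd2 t (inn' t tt) h => h'.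
    exact: norm_le_dist pr0 h'.
  move=> t /ino tt; have [_ [_ _ h _]] := dle t (abd t tt); have := Hd3 t (inn' t tt) h => h'.
  rewrite -lerBlDl -dotNl -dotDl; apply: le_trans (Hv _) _.
  by rewrite -normrN opprD !opprK.
have ei1 : `|('e_i : 'rV[R]_n)| <= 1.
  apply: norm_le_coord => // j; rewrite !mxE /=; case: (_ == _) => /=; rewrite ?normr1 ?normr0 //.
have Hei (w : 'rV[R]_n) : dot w 'e_i <= `|w|.
  by rewrite dot_delta; apply: le_trans (ler_norm _) _; exact: coord_le_norm.
have Hei' (w : 'rV[R]_n) : dot w (- 'e_i) <= `|w|.
  by rewrite dotNr dot_delta; apply: le_trans (ler_norm _) _; rewrite normrN; exact: coord_le_norm.
have ei1' : `|(- 'e_i : 'rV[R]_n)| <= 1 by rewrite normrN.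
have incr2 a b : a < b -> `|a - t0| <= d -> `|b - t0| <= d ->
    `|P b 0 i - P a 0 i - (b - a) * (- DxH H t0 (xi t0) (P t0)) 0 i| <= e * (b - a).
  move=> lab ad bd.
  have := incr a b _ ei1 Hei lab ad bd; have := incr a b _ ei1' Hei' lab ad bd.
  rewrite !dotNr !dot_delta !mxE => h1 h2.
  rewrite ler_norml; clear -h1 h2; apply/andP; split; lra.
have t0d : `|t0 - t0| <= d by rewrite subrr normr0 ltW.
exists d => // s sd; have [st|ts|->] := ltgtP s t0.
- have h := incr2 s t0 st sd t0d; rewrite (@ltr0_norm _ (s - t0)) ?subr_lt0 // opprB.
  apply: le_trans h; rewrite -normrN; set c := (- DxH _ _ _ _) 0 i.
  by have -> : - (P s 0 i - P t0 0 i - (s - t0) * c) = P t0 0 i - P s 0 i - (t0 - s) * c by ring.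
- by have := incr2 t0 s ts t0d sd; rewrite (@gtr0_norm _ (s - t0)) ?subr_gt0.
by rewrite !subrr mul0r subr0 normr0 mulr0.
Qed.

(** The displacement [(1 - s / b) w0] joins [x] at time 0 to the characteristic at time [b]. There
    [u(b, xi b)] appears on both sides and cancels, so the upper bound on the increment becomes a
    lower bound for [u(0, x)], quadratic in [w0]. *)
Lemma momentum_proximal (u0 : 'rV[R]_n -> R) (tau : R) (xi P : R -> 'rV[R]_n) (g : R -> R) :
  0 < tau -> tau <= T -> action_arc H 0 tau xi P g -> momentum_eq H 0 tau xi P ->
  (forall t, 0 <= t <= tau -> Omega (xi t)) ->
  (forall t, g t = u (t, xi t)) -> (forall x, Omega x -> u (0, x) = u0 x) ->
  proximal_subdifferential u0 (xi 0) (P 0).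
Proof.
move=> tau0 tauT arc pd xO gE uu0; have [xc pc _ _ _] := arc.
have t0tau : 0 <= (0 : R) <= tau by rewrite lexx ltW.
have t0T : 0 <= (0 : R) <= T by rewrite lexx (le_trans (ltW tau0)).
have [rho [L [r [C [th [loc pr0]]]]]] :=
  local_setting_ex (`|P 0| + 1) hyp t0T (xO 0 t0tau).
have [[rho0 L0 Lr C0 th0] [HO HE HL]] := loc.
have rho4 : 0 < rho / 4 by rewrite divr_gt0.
have [d1 d10 Hd1] := within_small xc t0tau rho4.
have [d2 d20 Hd2] := within_small pc t0tau (@ltr01 R).
pose b := Num.min (Num.min tau rho) (Num.min d1 d2).
have b0 : 0 < b by rewrite !lt_min tau0 rho0 d10.
have [bt br b1 b2] : [/\ b <= tau, b <= rho, b <= d1 & b <= d2].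
  by split; rewrite !ge_min lexx ?orbT.
have inn s : 0 <= s <= b -> 0 <= s <= tau by move=> /andP[-> h]; exact: le_trans h bt.
have sn s : 0 <= s <= b -> `|s - 0| <= b by move=> /andP[h1 h2]; rewrite subr0 ger0_norm.
have xr t : 0 <= t <= b -> `|xi t - xi 0| <= rho / 4.
  by move=> tt; exact: (Hd1 t (inn t tt) (le_trans (sn t tt) b1)).
have pr t : 0 <= t <= b -> `|P t| <= r.
  by move=> tt; exact: norm_le_dist pr0 (Hd2 t (inn t tt) (le_trans (sn t tt) b2)).
have nr t : 0 <= t <= b -> `|t - 0| <= rho by move=> tt; exact: le_trans (sn t tt) br.
have th4 : 0 < 4 * th by rewrite mulr_gt0.
(* [K / 2] is the constant of [upper_bound_linear] over a time [b], for a displacement of velocity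
   [- w0 / b] whose length is at most that of [w0]. *)
pose K := 2 * ((b^-1 ^+ 2 / (4 * th) + C) * b).
have K0 : 0 < K.
  by rewrite !mulr_gt0 // ltr_wpDl // divr_ge0 ?sqr_ge0 // ltW.
exists K => //; apply/nbhs_ballP; exists (rho / 4) => // x; rewrite -ball_normE /= distrC => xb.
have w0r : `|x - xi 0| <= rho / 4 by exact: ltW.
set w0 := x - xi 0 in w0r *.
have frac s : 0 <= s <= b -> 0 <= 1 - s / b <= 1.
  move=> /andP[s0 sb]; rewrite subr_ge0 ler_pdivrMr // mul1r sb /= gerBl.
  by rewrite divr_ge0 // ltW.
have hE s : w0 + (s - 0) *: (- b^-1 *: w0) = (1 - s / b) *: w0.
  by rewrite subr0 scalerA mulrN scalerBl scale1r scaleNr.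
have := upper_bound_linear (D := dot w0 w0) (w0 := w0) (w1 :=
  - b^-1 *: w0) hyp loc u_sub (lexx 0) b0 (le_trans bt tauT) nr
  (action_arc_W (lexx 0) bt arc) (momentum_eq_W (lexx 0) bt pd) xr pr.
rewrite hE divff ?gt_eqF // subrr scale0r addr0 dot0r addr0 subr0 !gE => h.
have {h} h : u (b, xi b) - u (0, xi 0 + w0) <= u (b, xi b) - u (0, xi 0) - dot (P 0) w0
   + (dot (- b^-1 *: w0) (- b^-1 *: w0) / (4 * th) + C * dot w0 w0) * b.
  apply: h => s ss; rewrite hE; have /andP[f0 f1] := frac s ss.
    by rewrite normrZ ger0_norm // (le_trans _ w0r) // ler_piMl.
  by rewrite dotZl dotZr mulrA ler_piMl ?dot_ge0 // mulr_ile1.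
have e1 : dot (- b^-1 *: w0) (- b^-1 *: w0) = b^-1 ^+ 2 * dot w0 w0.
  by rewrite dotZl dotZr mulrA mulrNN expr2.
have e2 : xi 0 + w0 = x by rewrite /w0 addrC subrK.
have Ox : Omega x.
  by apply: HO; apply: le_trans w0r _; exact: ler_divSn (ltW rho0).
have e3 : K / 2 * dot w0 w0 = (b^-1 ^+ 2 * dot w0 w0 / (4 * th) + C * dot w0 w0) * b.
  by rewrite /K; field; rewrite !gt_eqF.
rewrite e1 e2 -e3 in h; rewrite -!uu0 //; last exact: xO.
clear -h; lra.
Qed.
End Momentum.

(** At interior times both momenta have the same image [xi'] under [D_p H], which is injective by
    strong convexity; continuity carries the equality down to time 0. *)
Lemma momentum_unique (R : realType) n (Omega : set 'rV[R]_n) (T : R)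
    (H : R * 'rV[R]_n * 'rV[R]_n -> R) (u : R * 'rV[R]_n -> R)
    (tau : R) (y0 p0 q0 : 'rV[R]_n) (xi p q : R -> 'rV[R]_n) :
  standing Omega T H u ->
  hamiltonian_solution Omega T H tau y0 p0 xi p ->
  hamiltonian_solution Omega T H tau y0 q0 xi q -> p0 = q0.
Proof.
move=> hyp [/andP[tau0 tauT] [_ pc] xO pd [_ p00]] [_ [_ qc] _ qd [_ q00]].
have eqi t : 0 < t < tau -> p t = q t.
  move=> /[dup] tt /andP[h1 h2].
  have ttau : 0 <= t <= tau by rewrite !ltW.
  have tT : 0 <= t <= T by rewrite (ltW h1) (le_trans (ltW h2)).
  have [rho [L [r [C [th [[[rho0 L0 Lr C0 th0] [_ HE _]] rr]]]]]] :=
    local_setting_ex (Num.max `|p t| `|q t|) hyp tT (xO t ttau).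
  move: rr; rewrite ge_max => /andP[pr qr].
  have xx : `|xi t - xi t| <= rho by rewrite subrr normr0 ltW.
  have := gradient_le_velocity C0 th0 HE tT tT xx xx pr qr.
  have [Dp _] := pd t tt; have [Dq _] := qd t tt.
  rewrite -(derive1_is_derive Dp) -(derive1_is_derive Dq) !subrr !normr0 addr0 mulr0 addr0 mulr0.
  by rewrite pmulr_rle0 ?mulr_gt0 // normr_le0 subr_eq0 => /eqP ->.
rewrite -p00 -q00; apply/eqP; rewrite -subr_eq0 -normr_le0; apply/ler_addgt0Pr => e e0; rewrite add0r.
have z : 0 <= (0 : R) <= tau by rewrite lexx ltW.
have dc : {within `[0, tau], continuous (fun t => p t - q t)}.
  by move=> t; apply: (@cvgB _ 'rV[R]_n); [exact: pc | exact: qc].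
have [d d0 Hd] := within_small dc z e0; have [s ss sd] := itv_interior_near tau0 z d0.
have ss' : 0 <= s <= tau by case/andP: ss => ? ?; rewrite !ltW.
by have := Hd s ss' sd; rewrite (eqi s ss) subrr sub0r normrN.
Qed.

Lemma proximal_of_characteristic (R : realType) n (Omega : set 'rV[R]_n) (T : R)
    (H : R * 'rV[R]_n * 'rV[R]_n -> R) (u0 : 'rV[R]_n -> R) (u : R * 'rV[R]_n -> R)
    (tau : R) (xi : R -> 'rV[R]_n) :
  standing Omega T H u ->
  viscosity_solution Omega T H u0 u -> classical_characteristic Omega T H u 0 tau xi ->
  exists p0 p, proximal_subdifferential u0 (xi 0) p0 /\
    hamiltonian_solution Omega T H tau (xi 0) p0 xi p.
Proof.
move=> hyp [u_sub u_sup uu0] ch.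
have [P pc PE] := momentum_ex hyp ch.
have [[_ tau0 tauT] [xC1 xO xch]] := ch.
have [xi' [xc _ xd']] := C1_on_itv_derive tau0 xC1.
have xd t : 0 < t < tau -> is_derive t 1 xi (DpH H t (xi t) (P t)).
  move=> tt; have D := xd' t tt; have [_] := xch t tt.
  by rewrite (derive1_is_derive D) -PE // => <-.
(* Here the action function is [u] along [xi] itself, so that the values of [g] and of [u] agree at
   all times; in (i) it had to be built by integration. *)
pose g t := u (t, xi t).
have gc : {within `[0, tau], continuous g}.
  apply/subspace_continuousP => t; rewrite /= in_itv /= => tt.
  have xt : xi s @[s --> within `[0, tau]%classic (nbhs t)] --> xi t.
    by move/subspace_continuousP: xc => /(_ t); rewrite /= in_itv; apply.
  have tT : 0 <= t <= T by case/andP: tt => -> h; exact: le_trans h tauT.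
  have ct : (s, xi s) @[s --> within `[0, tau]%classic (nbhs t)] --> (t, xi t).
    have c1 : s @[s --> within `[0, tau]%classic (nbhs t)] --> t by exact: cvg_within.
    exact: (cvg_pair c1 xt).
  have [oOmega _ _ u_lip] := hyp; have /subspace_continuousP/(_ (t, xi t)) := u_within oOmega u_lip.
  move=> /(_ _) uc; apply: (cvg_within_comp _ ct (uc _)).
    move=> s; rewrite /= in_itv /= => ss; split; last exact: xO.
    by rewrite /= in_itv /=; case/andP: ss => -> h; exact: le_trans h tauT.
  by split; [rewrite /= in_itv | exact: xO].
have uP t : 0 < t < tau -> differentiable u (t, xi t) /\ P t = Dx u t (xi t).
  by move=> tt; have [du _] := xch t tt; split; [exact: du | exact: PE].
have gd t : 0 < t < tau -> is_derive t 1 g (dot (P t) (DpH H t (xi t) (P t)) - H (t, xi t, P t)).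
  move=> tt; have [du pE] := uP t tt; have := xd t tt; rewrite pE => D.
  have [h1 h2] := andP tt.
  have tT : 0 < t < T by rewrite h1 (lt_le_trans h2).
  have tc : 0 <= t <= tau by rewrite !ltW.
  exact: (is_derive_along hyp u_sub u_sup tT (xO t tc) du D).
have arc : action_arc H 0 tau xi P g by [].
have pd := momentum_derive hyp u_sub u_sup tauT arc xO uP (fun t => erefl).
exists (P 0), P; split.
  exact: (momentum_proximal hyp u_sub tau0 tauT arc pd xO (fun t => erefl) uu0).
by split=> //; [rewrite tau0 | move=> s ss; split; [exact: xd | exact: pd]].
Qed.

Theorem theorem2 (R : realType) (n : nat) (Omega : set 'rV[R]_n) (T : R)
    (H : R * 'rV[R]_n * 'rV[R]_n -> R) (u0 : 'rV[R]_n -> R)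
    (u : R * 'rV[R]_n -> R)
    (Omega_open : open Omega)
    (T_gt0 : 0 < T)
    (H_C2 : C2_on (`[0, T] `*` Omega `*` [set: 'rV[R]_n]) H)
    (H_convex : forall (t : R) (x p : 'rV[R]_n), 0 <= t <= T -> Omega x ->
       posdef (DppH H t x p))
    (u0_lip : [locally [lipschitz u0 x | x in Omega]])
    (u_lip : [locally [lipschitz u z | z in `[0, T] `*` Omega]])
    (u_sol : viscosity_solution Omega T H u0 u)
    (y0 : 'rV[R]_n) (y0_Omega : Omega y0) :
  (forall p0 : 'rV[R]_n, proximal_subdifferential u0 y0 p0 ->
     (exists (tau : R) (xi p : R -> 'rV[R]_n),
        hamiltonian_solution Omega T H tau y0 p0 xi p) /\
     (forall (tau : R) (xi p : R -> 'rV[R]_n),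
        hamiltonian_solution Omega T H tau y0 p0 xi p ->
        exists tau0 : R, 0 < tau0 <= tau /\
          classical_characteristic Omega T H u 0 tau0 xi))
  /\
  (forall (tau0 : R) (xi : R -> 'rV[R]_n),
     classical_characteristic Omega T H u 0 tau0 xi -> xi 0 = y0 ->
     exists! p0 : 'rV[R]_n,
       proximal_subdifferential u0 y0 p0 /\
       exists p : R -> 'rV[R]_n,
         hamiltonian_solution Omega T H tau0 y0 p0 xi p).
Proof.
have hyp : standing Omega T H u by [].
split=> [p0 Hp0|tau0 xi ch xi0].
  split; first exact: (hamiltonian_solution_ex p0 hyp T_gt0 y0_Omega).
  move=> tau xi p hs.
  exact: (characteristic_of_proximal hyp u_sol y0_Omega Hp0 hs).
have [p0 [p [Hp0 hp]]] := proximal_of_characteristic hyp u_sol ch.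
rewrite xi0 in Hp0 hp; exists p0; split; first by split=> //; exists p.
move=> q0 [_ [q hq]].
exact: (momentum_unique hyp hp hq).
Qed.
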